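(* Let $1<p<\infty$ with $p\neq 2$. Then the $p$-convexified Tsirelson space $\mathcal T^{(p)}$ has a family, of the cardinality of the continuum, of pairwise permutatively non-equivalent greedy bases, whose greedy constants are uniformly bounded and whose fundamental functions are uniformly equivalent to $(m^{1/p})_{m=1}^\infty$ (i.e. there are constants $0<c\le C<\infty$ such that $c\,m^{1/p}\le \varphi(m)\le C\,m^{1/p}$ for all $m\in\mathbb N$ and for the fundamental function $\varphi$ of every basis in the family).
   Context: $\mathbb N=\{1,2,\dots\}$; scalars are $\mathbb F=\mathbb R$ or $\mathbb C$. Tsirelson's space $\mathcal T$ is the completion of $c_{00}$ (finitely supported scalar sequences indexed by $\mathbb N$) under the unique norm satisfying $\|x\|=\max\{\|x\|_\infty,\ \tfrac12\sup\sum_{i=1}^k\|E_ix\|\}$, the supremum being over all $k\in\mathbb N$ and all finite nonempty $E_1<\dots<E_k$ in $\mathbb N$ with $k\le\min E_1$ ($E_i<E_{i+1}$ means $\max E_i<\min E_{i+1}$; $Ex$ is the restriction of $x$ to $E$). The unit vectors form a normalized $1$-unconditional basis of $\mathcal T$, so $\mathcal T$ is regarded as a space of sequences. For $0<p<\infty$, $\mathcal T^{(p)}$ is the space of scalar sequences $f=(a_n)_{n=1}^\infty$ with $|f|^p=(|a_n|^p)_{n=1}^\infty\in\mathcal T$, with quasi-norm $\|f\|=\||f|^p\|_{\mathcal T}^{1/p}$. A basis of a (quasi-)Banach space $X$ is a norm-bounded sequence $\mathcal X=(x_n)_{n=1}^\infty$ with dense linear span for which there is a norm-bounded sequence $(x_n^*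 )_{n=1}^\infty$ in $X^*$ biorthogonal to it. Given $f\in X$, let $\rho\colon\mathbb N\to\mathbb N$ be the greedy ordering of $f$: the injective map with $\{n: x_n^*(f)\ne0\}\subseteq\rho(\mathbb N)$ such that for $j<k$ either $|x^*_{\rho(j)}(f)|>|x^*_{\rho(k)}(f)|$, or these are equal and $\rho(j)<\rho(k)$. Put $\mathcal G_m(f)=\sum_{j=1}^m x^*_{\rho(j)}(f)x_{\rho(j)}$. The basis is greedy if there is $C\ge1$ with $\|f-\mathcal G_m(f)\|\le C\inf\{\|f-\sum_{n\in A}\alpha_nx_n\|: |A|=m,\ \alpha_n\in\mathbb F\}$ for all $f\in X$, $m\in\mathbb N$; the least such $C$ is its greedy constant. The fundamental function is $\varphi(m)=\sup_{|A|\le m}\|\sum_{n\in A}x_n\|$. Two bases $(x_n)$, $(y_n)$ are equivalent if $x_n\mapsto y_n$ extends to a linear isomorphism between their closed spans; they are permutatively equivalent if one is equivalent to a permutation of the other. *)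

(* Defs.v *)
From HB Require Import structures.
From mathcomp Require Import all_boot all_order all_algebra.
From mathcomp Require Import finmap complex.
From mathcomp Require Import all_classical all_reals all_analysis.

Set Implicit Arguments.
Unset Strict Implicit.
Unset Printing Implicit Defensive.

Import Order.TTheory GRing.Theory Num.Theory.
Import numFieldNormedType.Exports.

Local Open Scope classical_set_scope.
Local Open Scope ring_scope.

Variant scalars := RealScalars | ComplexScalars.

Definition scalar_field (R : realType) (F : scalars) : numFieldType :=
  match F with
  | RealScalars => R
  | ComplexScalars => R[i]
  end.

Definition modulus (R : realType) (F : scalars) : scalar_field R F -> R :=
  match F return scalar_field R F -> R with
  | RealScalars => fun x : R => `|x|
  | ComplexScalars => fun z : R[i] => ComplexField.Normc.normc z
  end.

(* Sequences are indexed from 0: the index n stands for the positive integer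
   n.+1.  Hence "k <= min E_1" reads k <= n.+1 for all n in the first set. *)
Section Tsirelson.
Variable R : realType.
Implicit Types (x a : nat -> R) (N : (nat -> R) -> R).

Definition c00 : set (nat -> R) := [set x | finite_set [set n | x n != 0]].

(* E 0 < ... < E k.-1; the values E i with k <= i are irrelevant. *)
Definition admissible (k : nat) (E : nat -> {fset nat}) : Prop :=
  [/\ (0 < k)%N,
      forall i, (i < k)%N -> E i != fset0,
      forall i, (i.+1 < k)%N ->
        forall m n, m \in E i -> n \in E i.+1 -> (m < n)%N &
      forall n, n \in E 0%N -> (k <= n.+1)%N].

Definition restr (A : {fset nat}) x : nat -> R :=
  fun n => if n \in A then x n else 0.

Definition norm_on_c00 N : Prop :=
  [/\ forall x, c00 x -> 0 <= N x,
      forall x, c00 x -> N x = 0 -> forall n, x n = 0,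
      forall (t : R) x, c00 x -> N (t *: x) = `|t| * N x &
      forall x y, c00 x -> c00 y -> N (x + y) <= N x + N y].

(* Both suprema are over nonempty bounded sets when N is a norm and x is
   finitely supported, since only finitely many restrictions of x occur. *)
Definition tsirelson_equation N : Prop :=
  forall x, c00 x ->
    N x = Num.max (sup [set `|x n| | n in [set: nat]])
            (2^-1 * sup [set s | exists k E, admissible k E /\
                               s = \sum_(i < k) N (restr (E i) x)]).

(* Only the values on c00 are meaningful; there the norm is unique. *)
Definition tsirelson_norm : (nat -> R) -> R :=
  xget (fun _ => 0) [set N | norm_on_c00 N /\ tsirelson_equation N].

Definition trunc (n : nat) a : nat -> R :=
  fun i => if (i < n)%N then a i else 0.

(* The completion of c00, as a space of sequences: the unit vectors being a
   basis of it, a sequence represents an element if and only if its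
   truncations form a Cauchy sequence.  Real scalars suffice, because T^(p)
   only involves the nonnegative sequences |f|^p, on which the norms for real
   and for complex scalars agree. *)
Definition tsirelson_space : set (nat -> R) :=
  [set a | forall e, 0 < e -> exists n0, forall m n, (n0 <= m)%N ->
    (n0 <= n)%N -> tsirelson_norm (trunc m a - trunc n a) < e].

Definition tsirelson_space_norm a : R :=
  lim (tsirelson_norm (trunc n a) @[n --> \oo]).

End Tsirelson.

Section ConvexifiedTsirelson.
Variables (R : realType) (F : scalars) (p : R).

Definition scalar_seq : lmodType (scalar_field R F) :=
  (nat -> (scalar_field R F)^o).

Definition abs_pow (f : scalar_seq) : nat -> R :=
  fun n => modulus (f n : scalar_field R F) `^ p.

Definition tsirelson_conv : set scalar_seq :=
  [set f | tsirelson_space (abs_pow f)].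

Definition tsirelson_conv_norm (f : scalar_seq) : R :=
  tsirelson_space_norm (abs_pow f) `^ p^-1.

End ConvexifiedTsirelson.

(* A (quasi-)normed space is given here as a subspace X of a vector space V,
   with a function nrm of which only the values on X matter; abs is the
   real-valued absolute value of the scalars. *)
Section Bases.
Variables (R : realType) (K : numFieldType) (abs : K -> R).
Variables (V : lmodType K) (X : set V) (nrm : V -> R).
Implicit Types (x y : nat -> V) (xs : nat -> V -> K) (f : V).

Definition linear_on (W : lmodType K) (D : set V) (T : V -> W) : Prop :=
  forall (a : K) u v, D u -> D v -> T (a *: u + v) = a *: T u + T v.

Definition lin_span x : set V :=
  [set f | exists n (c : nat -> K), f = \sum_(i < n) c i *: x i].

Definition closed_span x : set V :=
  [set f | X f /\ forall e : R, 0 < e ->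
                    exists2 g, lin_span x g & nrm (f - g) < e].

Definition dual_system x xs : Prop :=
  [/\ forall n, linear_on X (xs n : V -> K^o),
      exists M : R, forall n f, X f -> abs (xs n f) <= M * nrm f &
      forall m n, xs m (x n) = (m == n)%:R].

Definition basis x : Prop :=
  [/\ forall n, X (x n),
      exists M : R, forall n, nrm (x n) <= M,
      forall f, X f -> closed_span x f &
      exists xs, dual_system x xs].

(* Unique on X if x is a basis. *)
Definition coord x : nat -> V -> K :=
  xget (fun _ _ => 0) [set xs | dual_system x xs].

Definition is_greedy_ordering (a : nat -> K) (rho : nat -> nat) : Prop :=
  [/\ injective rho,
      [set n | a n != 0] `<=` range rho &
      forall j k, (j < k)%N ->
        abs (a (rho k)) < abs (a (rho j)) \/
        abs (a (rho j)) = abs (a (rho k)) /\ (rho j < rho k)%N].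

Definition greedy_ordering (a : nat -> K) : nat -> nat :=
  xget (id : nat -> nat) [set rho | is_greedy_ordering a rho].

Definition greedy_sum x (m : nat) f : V :=
  \sum_(j < m) let n := greedy_ordering (fun i => coord x i f) j in
               coord x n f *: x n.

Definition best_error x (m : nat) f : R :=
  inf [set s | exists (A : {fset nat}) (al : nat -> K),
         #|` A| = m /\ s = nrm (f - \sum_(n <- A) al n *: x n)].

Definition greedy_with x (C : R) : Prop :=
  1 <= C /\ forall f m, X f -> (0 < m)%N ->
              nrm (f - greedy_sum x m f) <= C * best_error x m f.

Definition greedy_basis x : Prop :=
  basis x /\ exists C, greedy_with x C.

Definition greedy_constant x : R := inf [set C | greedy_with x C].

Definition fundamental_function x (m : nat) : R :=
  sup [set nrm (\sum_(n <- A) x n) | A in [set A : {fset nat} | (#|` A| <= m)%N]].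

Definition equivalent x y : Prop :=
  exists T : V -> V,
    [/\ linear_on (closed_span x) T,
        set_bij (closed_span x) (closed_span y) T,
        exists M : R, forall f, closed_span x f ->
          nrm (T f) <= M * nrm f /\ nrm f <= M * nrm (T f) &
        forall n, T (x n) = y n].

Definition permutatively_equivalent x y : Prop :=
  exists2 pi : nat -> nat, bijective pi & equivalent x (y \o pi).

End Bases.

(* Main.v *)
(* Inside T^(p), disjoint blocks I_j of coordinates with |I_j| <= min I_j and
   min I_(j+1) > 4 max I_j span uniform copies of l_p^|I_j|, and a diagonal sum
   of uniformly bounded operators of these blocks is bounded on T^(p).  So the
   unit vector basis may be replaced on each block by any basis of l_p^m that is
   unconditional and democratic with a constant depending on p only; the result
   is greedy, with fundamental function of the order of m^(1/p).

   A democratic basis of l_p^m far from the unit vectors comes from independent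
   variables xi_i taking the values 1, -1 with probability del_i / 2 each and 0
   otherwise, normalized in L_p: by Rosenthal's inequality their span is
   complemented with norm equivalent to the max or, for p < 2, the dual of the
   max of the l_p-norm and of the l_2-norm with weights del_i^(1-2/p).  If
   del_i <= 1/(i+1) this is democratic, but its distance to l_p grows like a
   power of the sum of the del_i.  A finite version of Eilenberg's swindle absorbs
   the span, together with a complement, into a space l_p^m.

   Use such bases with weights taken from longer and longer segments of the
   harmonic series, one segment per type n, each type on infinitely many blocks.
   For a set M of types, replace the blocks with type in M and keep the unit
   vectors on the others.  If n lies in M but not in M' and is large, then a
   vector supported by one far block of type n, moved by any permutation to a
   place where the types n' <> n only distort it a little, shows that the
   bases of M and M' are not permutatively equivalent.  It remains to
   take continuum many sets M with pairwise infinite differences. *)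

Require Import Defs.
From HB Require Import structures.
From mathcomp Require Import all_boot all_order all_algebra.
From mathcomp Require Import finmap complex.
From mathcomp Require Import all_classical all_reals all_analysis.
From mathcomp Require Import ring lra zify.
Set Implicit Arguments.
Unset Strict Implicit.
Unset Printing Implicit Defensive.
Import Order.TTheory GRing.Theory Num.Theory.
Import numFieldNormedType.Exports.
Local Open Scope classical_set_scope.
Local Open Scope ring_scope.

(** * Tsirelson's norm *)

(** The factor 4 in the lacunarity reconciles two notions of admissibility. Intervals starting
    inside block J may number up to the end of J, more than a family indexed by blocks may have at
    J. But each interval costs at most four breakpoints in block indices, and four times the end of
    J lies before the start of block J+1. So block J is estimated alone by its l_1-norm, and all
    later blocks by a Tsirelson-type norm of their block sums. The weights 1/(i+1) are critical: for
    0 < r < 1 the sum of del_i^r over any m indices is at most of order m^(1-r), which gives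
    democracy, while the sum of the del_i is unbounded, which gives distortion. The distortion is a
    power of that sum with exponent |p/2 - 1|; it disappears for p = 2. The variables supply only d
    vectors in a space of dimension 3^d, and nothing is known about a basis of a complement; the
    swindle completes them without choosing one. All block matrices are real, so that both scalar
    fields are served by the same blocks, through real and imaginary parts. Norms are handled
    through their p-th powers, which live in Tsirelson's space itself. *)

Section TsirelsonType.
Variable R : realType.
Implicit Types (x y z : nat -> R) (s : nat -> nat) (tau : nat -> nat).

Definition window (a b : nat) x : nat -> R :=
  fun n => if (a <= n < b)%N then x n else 0.

Definition vanishes_from (m : nat) x := forall n, (m <= n)%N -> x n = 0.

(* The values of the norming functionals of the Tsirelson-type norm in which
   k consecutive intervals starting at s 0 are admissible when k <= tau (s 0). *)
Inductive tval tau : (nat -> R) -> R -> Prop :=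
| tval_coord x n : tval tau x `|x n|
| tval_adm x k s (v : nat -> R) :
    (forall i, (s i <= s i.+1)%N) -> (k <= tau (s 0%N))%N ->
    (forall i, (i < k)%N -> tval tau (window (s i) (s i.+1) x) (v i)) ->
    tval tau x (2^-1 * \sum_(i < k) v i).

(** The parameter serves two norms: [succn] gives Tsirelson's norm for sequences indexed from 0, and
    [fun j => (t j).+1] the norm on sequences with one entry per block. *)
Definition tn tau x : R := sup [set v | tval tau x v].

Lemma vanishes_from_window m a b x : vanishes_from m x -> vanishes_from m (window a b x).
Proof. by move=> hx n hn; rewrite /window hx // if_same. Qed.

Lemma vanishes_from_window_end a b x : vanishes_from b (window a b x).
Proof. by move=> n hn; rewrite /window ltnNge hn andbF. Qed.

Lemma window_le a b x n : `|window a b x n| <= `|x n|.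
Proof. by rewrite /window; case: ifP => // _; rewrite normr0. Qed.

Lemma mono_windows s : (forall i, (s i <= s i.+1)%N) -> {homo s : i j / (i <= j)%N}.
Proof. by move=> h; apply: homo_leq => // a b c; exact: leq_trans. Qed.

Lemma sum_window k s x n : (forall i, (s i <= s i.+1)%N) ->
  \sum_(i < k) window (s i) (s i.+1) x n = window (s 0%N) (s k) x n.
Proof.
move=> hs; elim: k => [|k IH].
  by rewrite big_ord0 /window; case: ifP => // /andP[h1 h2]; move: (leq_ltn_trans h1 h2); rewrite ltnn.
rewrite big_ord_recr /= IH /window.
have h0k : (s 0%N <= s k)%N by apply: (mono_windows hs).
have := hs k; case: (leqP (s k) n) => h1 h2; rewrite /= ?andbF ?andbT ?add0r.
  by rewrite (leq_trans h0k h1).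
by rewrite (leq_trans h1 h2) andbT addr0.
Qed.

Lemma norm_window a b x n : `|window a b x n| = window a b (fun i => `|x i|) n.
Proof. by rewrite /window; case: ifP => //; rewrite normr0. Qed.

Lemma sum_norm_window_le k s x n : (forall i, (s i <= s i.+1)%N) ->
  \sum_(i < k) `|window (s i) (s i.+1) x n| <= `|x n|.
Proof.
move=> hs; under eq_bigr do rewrite norm_window.
by rewrite sum_window // -norm_window window_le.
Qed.

Lemma tval_l1 tau x v m : tval tau x v -> vanishes_from m x ->
  v <= \sum_(n < m) `|x n|.
Proof.
move=> h; elim: h m => [y n|y k s w hs hk _ IH] m hm.
  case: (ltnP n m) => hn; last by rewrite hm // normr0 sumr_ge0.
  by rewrite (bigD1 (Ordinal hn)) //= lerDl sumr_ge0.
have h : \sum_(i < k) w i <= \sum_(n < m) `|y n|.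
  apply: (@le_trans _ _ (\sum_(i < k) \sum_(n < m) `|window (s i) (s i.+1) y n|)).
    by apply: ler_sum => i _; apply: IH => //; exact: vanishes_from_window.
  by rewrite exchange_big /=; apply: ler_sum => n _; exact: sum_norm_window_le.
have h0 : 0 <= \sum_(n < m) `|y n| by rewrite sumr_ge0.
lra.
Qed.

Lemma tval_nonempty tau x : [set v | tval tau x v] !=set0.
Proof. by exists `|x 0%N|; exact: tval_coord. Qed.

Lemma tval_has_sup tau x m : vanishes_from m x -> has_sup [set v | tval tau x v].
Proof.
move=> hm; split; first exact: tval_nonempty.
by exists (\sum_(n < m) `|x n|) => v /= /tval_l1; apply.
Qed.

Lemma tval_le_tn tau x m v : vanishes_from m x -> tval tau x v -> v <= tn tau x.
Proof. by move=> hm hv; apply: sup_upper_bound => //; exact: tval_has_sup hm. Qed.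

Lemma tn_le tau x B : (forall v, tval tau x v -> v <= B) -> tn tau x <= B.
Proof. by move=> h; apply: ge_sup => //; exact: tval_nonempty. Qed.

Lemma tn_coord tau x m n : vanishes_from m x -> `|x n| <= tn tau x.
Proof. by move=> hm; apply: (tval_le_tn hm); exact: tval_coord. Qed.

Lemma tn_ge0 tau x : 0 <= tn tau x.
Proof.
rewrite /tn; case: (pselect (has_sup [set v | tval tau x v])) => h; last by rewrite sup_out.
apply: (@le_trans _ _ `|x 0%N|) => //.
by apply: sup_upper_bound => //; exact: tval_coord.
Qed.

Lemma tn_l1 tau x m : vanishes_from m x -> tn tau x <= \sum_(n < m) `|x n|.
Proof. by move=> hm; apply: tn_le => v /tval_l1; apply. Qed.

Lemma tn_adm tau x m k s : vanishes_from m x ->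
  (forall i, (s i <= s i.+1)%N) -> (k <= tau (s 0%N))%N ->
  2^-1 * \sum_(i < k) tn tau (window (s i) (s i.+1) x) <= tn tau x.
Proof.
move=> hm hs hk; apply/ler_addgt0Pr => e e0.
have h i : exists v, tval tau (window (s i) (s i.+1) x) v /\
    tn tau (window (s i) (s i.+1) x) - e / k.+1%:R < v.
  have e1 : 0 < e / k.+1%:R by rewrite divr_gt0.
  have [v hv1 hv2] := sup_adherent e1 (tval_has_sup tau (vanishes_from_window (s i) (s i.+1) hm)).
  by exists v.
have [v hv] := boolp.choice h.
have h1 : tval tau x (2^-1 * \sum_(i < k) v i).
  by apply: (tval_adm hs hk) => i _; case: (hv i).
have h2 := tval_le_tn hm h1.
have h3 : \sum_(i < k) tn tau (window (s i) (s i.+1) x) <= \sum_(i < k) v i + e.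
  apply: (@le_trans _ _ (\sum_(i < k) (v i + e / k.+1%:R))).
    by apply: ler_sum => i _; case: (hv i) => _ /ltW; rewrite lerBlDr.
  rewrite big_split /= lerD2l sumr_const card_ord -[leLHS]mulr_natr.
  rewrite -[leRHS]mulr1 -mulrA ler_wpM2l ?(ltW e0) // mulrC ler_pdivrMr //.
  by rewrite mul1r ler_nat leqnSn.
lra.
Qed.

(** A pointwise bound on moduli is inherited by windows, so one induction on the norming value
    yields the triangle inequality, homogeneity and unconditionality together. *)
Lemma tn_comb tau c d x y z m : 0 <= c -> 0 <= d ->
  vanishes_from m x -> vanishes_from m y ->
  (forall n, `|z n| <= c * `|x n| + d * `|y n|) ->
  tn tau z <= c * tn tau x + d * tn tau y.
Proof.
move=> c0 d0 hx hy hz; apply: tn_le => v hv.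
elim: hv x y hx hy hz => {z v} [z n|z k s w hs hk _ IH] x y hx hy hz.
  apply: (le_trans (hz n)); apply: lerD; apply: ler_wpM2l => //; [exact: tn_coord hx|exact: tn_coord hy].
have h : \sum_(i < k) w i <= c * (\sum_(i < k) tn tau (window (s i) (s i.+1) x))
      + d * (\sum_(i < k) tn tau (window (s i) (s i.+1) y)).
  rewrite !mulr_sumr -big_split /=; apply: ler_sum => i _; apply: IH => //.
  - exact: vanishes_from_window.
  - exact: vanishes_from_window.
  - by move=> n; rewrite /window; case: ifP => _ //; rewrite normr0 !mulr0 addr0.
have := ler_wpM2l c0 (tn_adm hx hs hk); have := ler_wpM2l d0 (tn_adm hy hs hk).
lra.
Qed.

Lemma tn_dom tau c x z m : 0 <= c -> vanishes_from m x ->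
  (forall n, `|z n| <= c * `|x n|) -> tn tau z <= c * tn tau x.
Proof.
move=> c0 hx h; have := @tn_comb tau c 0 x x z m c0 (lexx 0) hx hx.
by rewrite mul0r addr0; apply => n; rewrite mul0r addr0.
Qed.

Lemma tn_mono tau x z m : vanishes_from m x ->
  (forall n, `|z n| <= `|x n|) -> tn tau z <= tn tau x.
Proof.
by move=> hx h; rewrite -[leRHS]mul1r; apply: tn_dom hx _ => // n; rewrite mul1r.
Qed.

Lemma tn_triangle tau x y z m : vanishes_from m x -> vanishes_from m y ->
  (forall n, `|z n| <= `|x n| + `|y n|) -> tn tau z <= tn tau x + tn tau y.
Proof.
move=> hx hy h; have := @tn_comb tau 1 1 x y z m ler01 ler01 hx hy.
by rewrite !mul1r; apply => n; rewrite !mul1r.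
Qed.

Lemma tn_eq0 tau x : (forall n, x n = 0) -> tn tau x = 0.
Proof.
move=> h; apply/eqP; rewrite eq_le tn_ge0 andbT.
by apply: (le_trans (@tn_l1 tau x 0 _)) => [n _|]; rewrite ?h // big_ord0.
Qed.

(** Breakpoints form a list here because the comparison of the two norms concatenates the
    breakpoints found for successive windows. *)
Fixpoint windowsum (M : (nat -> R) -> R) x (a : nat) (us : seq nat) : R :=
  if us is b :: us' then M (window a b x) + windowsum M x b us' else 0.

Lemma windowsumE M x a us (c : nat) :
  windowsum M x a us = \sum_(i < size us) M (window (nth c (a :: us) i) (nth c us i) x).
Proof.
elim: us a => [|b us IH] a /=; first by rewrite big_ord0.
by rewrite big_ord_recl /= IH.
Qed.

Lemma tn_windowsum tau x m a us : vanishes_from m x -> path leq a us ->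
  (size us <= tau a)%N -> 2^-1 * windowsum (tn tau) x a us <= tn tau x.
Proof.
move=> hx hp hk; set c := last a us.
rewrite (windowsumE _ _ _ _ c).
(* The default value [c] is the last breakpoint, so [s] stays constant past the end of the list and
   remains monotone. *)
pose s i := nth c (a :: us) i.
apply: (tn_adm (s := s) hx) => //= i.
rewrite /s /=; case: (ltnP i (size us)) => hi; first exact: (pathP c hp).
rewrite [X in (_ <= X)%N]nth_default //.
case: i hi => [|i] /=; first by rewrite leqn0 /c => /nilP ->.
rewrite leq_eqVlt => /orP[/eqP hi|hi]; last by rewrite nth_default.
by rewrite (set_nth_default a) ?hi // /c (last_nth a) hi.
Qed.

(** Cutting right after each point of [ps] gives windows that contain one chosen point each; far
    enough out the family is admissible and the norm is an l_1-norm up to the factor 2. *)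
Lemma tn_l1_lower tau x m a ps : vanishes_from m x -> sorted ltn ps ->
  (forall p, p \in ps -> (a <= p)%N) -> (size ps <= tau a)%N ->
  2^-1 * \sum_(p <- ps) `|x p| <= tn tau x.
Proof.
move=> hx hps ha hk.
have hpath : path leq a [seq p.+1 | p <- ps].
  case: ps hps ha {hk} => [//|p ps] /= hp ha.
  rewrite (leq_trans (ha p _)) ?mem_head //=.
  by elim: ps p hp {ha} => [//|q ps IH] p /= /andP[h1 h2]; rewrite IH // andbT ltnS ltnW.
have h := @tn_windowsum tau x m a [seq p.+1 | p <- ps] hx hpath.
rewrite size_map in h; move: (h hk); apply: le_trans.
rewrite ler_wpM2l // ?invr_ge0 //.
elim: ps a {hpath hk h} hps ha => [|p ps IH] a hps ha /=; first by rewrite big_nil.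
rewrite big_cons; apply: lerD.
  have -> : `|x p| = `|window a p.+1 x p| by rewrite /window ltnSn andbT ha ?mem_head.
  exact: (tn_coord _ _ (@vanishes_from_window_end a p.+1 x)).
apply: IH; first by move: hps => /= /path_sorted.
move=> q hq; have := order_path_min ltn_trans hps.
by move=> /allP /(_ q hq).
Qed.

End TsirelsonType.

(** * Existence and uniqueness of Tsirelson's norm *)

Section TsirelsonNorm.
Variable R : realType.
Implicit Types (x y z : nat -> R) (s : nat -> nat).
Local Notation N := (tn (R := R) succn).

Lemma c00P x : c00 x <-> exists m, vanishes_from m x.
Proof.
split=> [/finite_fsetP[A hA]|[m hm]].
  exists (\max_(n <- A) n).+1 => n hn; apply/eqP/negPn/negP => hx.
  have : n \in A by have : [set n | x n != 0] n by []; rewrite hA.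
  by move=> h; have := @leq_bigmax_seq _ (enum_fset A) xpredT (fun i => i) n h isT; rewrite leqNgt hn.
apply: (@sub_finite_set _ _ `I_m); last exact: finite_II.
by move=> n /= hn; rewrite ltnNge; apply: contra hn => /hm ->.
Qed.

(** Admissible sets must be nonempty, so empty windows are discarded. This moves the starting point
    only to the right, which relaxes admissibility; a kept window is extended to the next kept
    one. *)
Lemma strict_windows k s x m : vanishes_from m x -> (forall i, (s i <= s i.+1)%N) ->
  exists k' s', [/\ (k' <= k)%N, (s 0%N <= s' 0%N)%N,
    forall i, (i < k')%N -> (s' i < s' i.+1)%N &
    \sum_(i < k) N (window (s i) (s i.+1) x) <= \sum_(i < k') N (window (s' i) (s' i.+1) x)].
Proof.
move=> hx; elim: k s => [|k IH] s hs.
  by exists 0%N, s; split => //; rewrite !big_ord0.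
have [k' [s' [h1 h2 h3 h4]]] := IH (fun i => s i.+1) (fun i => hs i.+1).
rewrite big_ord_recl; case: (ltnP (s 0%N) (s 1%N)) => h.
  exists k'.+1, (fun i => if i is j.+1 then s' j else s 0%N); split => //.
    by case=> [|i] //= hi; [exact: leq_trans h h2|exact: h3].
  rewrite big_ord_recl /=; apply: lerD; last exact: h4.
  apply: (@tn_mono _ _ _ _ m); first exact: vanishes_from_window.
  move=> n; rewrite /window; case: (ltnP n (s 1%N)) => hn; last by rewrite andbF normr0.
  by rewrite (leq_trans hn h2).
exists k', s'; split => //; first exact: leqW.
  exact: leq_trans (hs 0%N) h2.
rewrite tn_eq0 ?add0r //= => n; rewrite /window; case: ifP => // /andP[a b].
by move: (leq_ltn_trans a b); rewrite ltnNge h.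
Qed.

Lemma admissible_lt k E : admissible k E -> forall i j m n, (i < j)%N -> (j < k)%N ->
  m \in E i -> n \in E j -> (m < n)%N.
Proof.
case=> _ hne hlt _ i j; elim: j => [//|j IH] m n hij hj hm hn.
move: hij; rewrite ltnS leq_eqVlt => /orP[/eqP ?|hij]; first by subst i; exact: hlt hm hn.
have /fset0Pn[p hp] := hne j (ltnW hj).
by apply: (@ltn_trans p); [apply: IH hp => //; exact: ltnW|exact: hlt hp hn].
Qed.

Lemma fset_min (A : {fset nat}) : A != fset0 ->
  exists2 a, a \in A & forall b, b \in A -> (a <= b)%N.
Proof.
move=> /fset0Pn h; exists (ex_minn h); first by case: ex_minnP.
by case: ex_minnP => m hm hmin b /hmin.
Qed.

Lemma tn_admissible k E x m : vanishes_from m x -> admissible k E ->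
  \sum_(i < k) N (restr (E i) x) <= 2 * N x.
Proof.
move=> hx hE; case: (hE) => k0 hne _ hk.
have [a ha] : exists a, forall i, (i < k)%N -> a i \in E i /\ forall b, b \in E i -> (a i <= b)%N.
  have h i : exists c, (i < k)%N -> c \in E i /\ forall b, b \in E i -> (c <= b)%N.
    case: (ltnP i k) => hi; last by exists 0%N.
    by have [c h1 h2] := fset_min (hne i hi); exists c.
  by have [a ha] := boolp.choice h; exists a.
have aE i j : (i < j)%N -> (j < k)%N -> (a i < a j)%N.
  move=> hij hj; apply: (admissible_lt hE hij hj); last by case: (ha j hj).
  by case: (ha i (ltn_trans hij hj)).
(* Each set is widened to the interval between consecutive minima; the last interval reaches past
   the support, and the maximum keeps [s] monotone. *)
pose s i := if (i < k)%N then a i else maxn m (a k.-1).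
have hs i : (s i <= s i.+1)%N.
  rewrite /s; case: (ltnP i.+1 k) => h1; first by rewrite (ltnW h1); exact: ltnW (aE _ _ _ h1).
  case: (ltnP i k) => // h2; have -> : i = k.-1 by lia.
  exact: leq_maxr.
have h := @tn_adm _ succn x m k s hx hs.
suff h' : \sum_(i < k) N (restr (E i) x) <= \sum_(i < k) N (window (s i) (s i.+1) x).
  have : (k <= (s 0%N).+1)%N by rewrite /s k0; apply: hk; case: (ha 0%N k0).
  move=> /h; lra.
apply: ler_sum => i _; apply: (@tn_mono _ _ _ _ m); first exact: vanishes_from_window.
move=> n; rewrite /restr /window; case: ifP => hn; last by rewrite normr0.
rewrite /s ltn_ord; have [_ h1] := ha i (ltn_ord i); rewrite h1 //=.
case: (ltnP i.+1 k) => h2.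
  by case: (ha _ h2) => /(admissible_lt hE (ltnSn i) h2 hn) -> _.
case: (ltnP n m) => hm; first by rewrite leq_max hm.
by rewrite hx // if_same.
Qed.

Lemma vanishes_from_restr m A x : vanishes_from m x -> vanishes_from m (restr A x).
Proof. by move=> h n hn; rewrite /restr h // if_same. Qed.

Lemma admissible_singleton : admissible 1 (fun _ => [fset 0%N]%fset).
Proof.
split => // i _.
by apply/fset0Pn; exists 0%N; rewrite inE.
Qed.

Definition adm_sums (M : (nat -> R) -> R) x :=
  [set s | exists k E, admissible k E /\ s = \sum_(i < k) M (restr (E i) x)].

Lemma adm_sums_nonempty M x : adm_sums M x !=set0.
Proof.
exists (\sum_(i < 1) M (restr [fset 0%N]%fset x)).
by exists 1%N, (fun _ => [fset 0%N]%fset); split => //; exact: admissible_singleton.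
Qed.

Lemma abs_has_sup x m : vanishes_from m x -> has_sup [set `|x n| | n in [set: nat]].
Proof.
move=> hx; split; first by exists `|x 0%N|, 0%N.
by exists (N x) => _ [n _ <-]; exact: tn_coord hx.
Qed.

Lemma tn_tsirelson_equation : tsirelson_equation N.
Proof.
move=> x /c00P[m hx]; apply/eqP; rewrite eq_le; apply/andP; split.
  apply: tn_le => v hv; rewrite le_max.
  case: hv hx => {x v} [x n|x k s v hs hk hv] hx.
    apply/orP; left; apply: sup_upper_bound; first exact: abs_has_sup hx.
    by exists n.
  apply/orP; right; rewrite ler_pM2l ?invr_gt0 //.
  apply: (@le_trans _ _ (\sum_(i < k) N (window (s i) (s i.+1) x))).
    apply: ler_sum => i _; apply: tval_le_tn; last exact: hv.
    exact: (vanishes_from_window _ _ hx).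
  have [k' [s' [h1 h2 h3 h4]]] := strict_windows k hx hs.
  apply: (le_trans h4).
  have hub : has_ubound (adm_sums N x).
    by exists (2 * N x) => _ [k0 [E [hE ->]]]; exact: (tn_admissible hx hE).
  (* If no window survives, the sum is 0, but an admissible family has at least one member; a
     singleton provides one with a nonnegative value. *)
  case: (posnP k') => hk'.
    rewrite hk' big_ord0.
    apply: (@le_trans _ _ (\sum_(i < 1) N (restr [fset 0%N]%fset x))).
      by rewrite sumr_ge0 // => i _; exact: tn_ge0.
    apply: sup_upper_bound; first by split => //; exact: adm_sums_nonempty.
    exists 1%N, (fun _ => [fset 0%N]%fset); split => //; exact: admissible_singleton.
  pose E i := [fset n in iota (s' i) (s' i.+1 - s' i)]%fset.
  have memE i n : (i < k')%N -> (n \in E i) = (s' i <= n < s' i.+1)%N.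
    by move=> hi; rewrite !inE /= mem_iota subnKC // ltnW // h3.
  apply: sup_upper_bound; first by split => //; exact: adm_sums_nonempty.
  exists k', E; split; last first.
    apply: eq_bigr => i _; congr (N _); apply/funext => n.
    by rewrite /restr memE.
  split => //.
  - move=> i hi; apply/fset0Pn; exists (s' i); rewrite memE //.
    by rewrite leqnn h3.
  - move=> i hi a b; rewrite !memE //; last exact: ltnW.
    by move=> /andP[_ h5] /andP[h6 _]; exact: leq_trans h5 h6.
  - move=> n; rewrite memE // => /andP[h5 _].
    by rewrite (leq_trans h1) // (leq_trans hk) // ltnS (leq_trans h2).
rewrite ge_max; apply/andP; split.
  apply: ge_sup; first by exists `|x 0%N|, 0%N.
  by move=> _ [n _ <-]; exact: tn_coord hx.
have : sup (adm_sums N x) <= 2 * N x.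
  apply: ge_sup; first exact: adm_sums_nonempty.
  by move=> _ [k [E [hE ->]]]; exact: (tn_admissible hx hE).
rewrite /adm_sums; lra.
Qed.

Lemma tn_norm_on_c00 : norm_on_c00 N.
Proof.
have scale (t : R) x m : vanishes_from m x -> N (t *: x) <= `|t| * N x.
  move=> hx; apply: (tn_dom _ _ hx) => // n.
  by rewrite -normrM.
split.
- by move=> x _; exact: tn_ge0.
- move=> x /c00P[m hx] h n; apply/normr0_eq0/eqP.
  by rewrite eq_le normr_ge0 andbT -h; exact: tn_coord hx.
- move=> t x /c00P[m hx]; apply/eqP; rewrite eq_le (scale _ _ m) //=.
  case: (eqVneq t 0) => [->|t0]; first by rewrite normr0 mul0r tn_ge0.
  have h : vanishes_from m (t *: x) by move=> n hn; rewrite /= fctE hx // scaler0.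
  have := scale t^-1 _ _ h; rewrite scalerA mulVf // scale1r normfV.
  by rewrite ler_pdivlMl ?normr_gt0.
- move=> x y /c00P[m hx] /c00P[m' hy].
  apply: (@tn_triangle _ _ _ _ _ (maxn m m')).
  + by move=> n; rewrite geq_max => /andP[h _]; exact: hx.
  + by move=> n; rewrite geq_max => /andP[_ h]; exact: hy.
  + by move=> n; exact: ler_normD.
Qed.

Definition supp_size m x : nat := \sum_(n < m) (x n != 0%R).

Lemma supp_size_restr m A x : vanishes_from m x ->
  (forall n, x n != 0 -> n \in A) \/ (supp_size m (restr A x) < supp_size m x)%N.
Proof.
move=> hx; case: (pselect (forall n, x n != 0 -> n \in A)) => h; [by left|right].
move: h => /existsNP[n] /not_implyP[hn /negP hA].
have hnm : (n < m)%N by rewrite ltnNge; apply: contra hn => /hx ->.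
rewrite /supp_size (bigD1 (Ordinal hnm)) //= (bigD1 (Ordinal hnm) (F := fun i => (x i != 0)%R : nat)) //=.
rewrite /restr (negbTE hA) eqxx hn add0n add1n ltnS; apply: leq_sum => i _.
by case: ifP => // _; rewrite eqxx.
Qed.

(** Induction on the size of the support. If one set of the family contains the whole support, the
    other terms vanish and the sum is [N1 x], which the factor 1/2 renders harmless; otherwise every
    restriction has smaller support. The boundedness hypothesis prevents the supremum for [N2] from
    taking its default value. *)
Lemma tsirelson_unique_aux (N1 N2 : (nat -> R) -> R) :
  norm_on_c00 N1 -> tsirelson_equation N1 -> norm_on_c00 N2 -> tsirelson_equation N2 ->
  (forall x, c00 x -> has_ubound (adm_sums N2 x)) ->
  forall x, c00 x -> N1 x <= N2 x.
Proof.
move=> [p1 _ h1 _] e1 [p2 _ h2 _] e2 hub x /c00P[m hx].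
move: {2}(supp_size m x).+1 (ltnSn (supp_size m x)) => w.
elim: w x hx => [//|w IH] x hx hw.
have cx : c00 x by apply/c00P; exists m.
rewrite (e1 _ cx) ge_max; apply/andP; split.
  by rewrite (e2 _ cx) le_max lexx.
have adm2 k E : admissible k E -> \sum_(i < k) N2 (restr (E i) x) <= 2 * N2 x.
  move=> hE.
  have : \sum_(i < k) N2 (restr (E i) x) <= sup (adm_sums N2 x).
    apply: sup_upper_bound; last by exists k, E.
    by split; [exact: adm_sums_nonempty|exact: hub].
  have : 2^-1 * sup (adm_sums N2 x) <= N2 x.
    by rewrite (e2 _ cx) le_max /adm_sums lexx orbT.
  lra.
have : sup (adm_sums N1 x) <= Num.max (2 * N2 x) (N1 x).
  apply: ge_sup; first exact: adm_sums_nonempty.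
  move=> _ [k [E [hE ->]]]; rewrite le_max.
  case: (pselect (exists2 i : 'I_k, True & forall n, x n != 0 -> n \in E i)) => [[i _ hi]|hno].
    apply/orP; right; rewrite (bigD1 i) //= big1 ?addr0.
      suff -> : restr (E i) x = x by [].
      by apply/funext => n; rewrite /restr; case: (boolP (n \in E i)) => // /negP hn;
        apply/eqP; rewrite eq_sym; apply/negPn/negP => /hi.
    move=> j hj; have -> : restr (E j) x = 0 *: x.
      rewrite scale0r; apply/funext => n; rewrite /restr; case: ifP => // hn.
      apply/eqP/negPn/negP => /hi hn'.
      move: hj; rewrite -val_eqE /= neq_ltn => /orP[] hlt.
        by have := admissible_lt hE hlt (ltn_ord _) hn hn'; rewrite ltnn.
      by have := admissible_lt hE hlt (ltn_ord _) hn' hn; rewrite ltnn.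
    by rewrite h1 // normr0 mul0r.
  apply/orP; left; apply: le_trans (adm2 _ _ hE); apply: ler_sum => i _.
  apply: IH; first exact: vanishes_from_restr.
  case: (supp_size_restr (E i) hx) => h; first by exfalso; apply: hno; exists i.
  by apply: (leq_trans h).
rewrite le_max => /orP[]; rewrite /adm_sums => h; first lra.
have e := e1 _ cx.
have e' : N1 x <= 2^-1 * sup (adm_sums N1 x) \/ N1 x <= N2 x.
  move: e; rewrite maxEle; case: ifP => _ e; [left|right]; rewrite e.
    by rewrite /adm_sums lexx.
  by rewrite (e2 _ cx) le_max lexx.
rewrite /adm_sums in e'; have := p2 _ cx; case: e' => ? ?; lra.
Qed.

(** The order of the two inequalities matters: the one against [N], whose sums are known to be
    bounded, supplies the boundedness that the reverse one requires. *)
Lemma tsirelson_normE x : c00 x -> tsirelson_norm x = N x.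
Proof.
have ex : exists M : (nat -> R) -> R, [set M | norm_on_c00 M /\ tsirelson_equation M] M.
  by exists N; split; [exact: tn_norm_on_c00|exact: tn_tsirelson_equation].
have [hn he] := xgetPex (fun _ : nat -> R => 0 : R) ex.
rewrite -/(tsirelson_norm (R := R)) in hn he.
have ub y : c00 y -> has_ubound (adm_sums N y).
  move=> /c00P[m hy]; exists (2 * N y) => _ [k [E [hE ->]]]; exact: (tn_admissible hy hE).
have le1 y : c00 y -> tsirelson_norm y <= N y.
  by apply: tsirelson_unique_aux => //; [exact: tn_norm_on_c00|exact: tn_tsirelson_equation].
move=> cx; apply/eqP; rewrite eq_le le1 //=.
apply: tsirelson_unique_aux => //; [exact: tn_norm_on_c00|exact: tn_tsirelson_equation|].
move=> y /c00P[m hy]; exists (2 * N y) => _ [k [E [hE ->]]].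
apply: le_trans (tn_admissible hy hE); apply: ler_sum => i _; apply: le1.
by apply/c00P; exists m; exact: vanishes_from_restr.
Qed.

End TsirelsonNorm.

(** * Lacunary blocks *)

Section Blocks.
Variable R : realType.
Variables t e : nat -> nat.
Hypothesis te : forall j, (t j <= e j)%N.
Hypothesis tlen : forall j, (e j <= t j + (t j).+1)%N.
Hypothesis tlac : forall j, (4 * e j <= t j.+1)%N.
Hypothesis tid : forall j, (j <= t j)%N.
Implicit Types (x y z : nat -> R) (s : nat -> nat).
Local Notation N := (tn (R := R) succn).
Local Notation T := (tn (R := R) (fun j => (t j).+1)).

Definition blocksum x (j : nat) : R := \sum_(t j <= i < e j) `|x i|.

Definition from (a : nat) x : nat -> R := fun n => if (a <= n)%N then x n else 0.

Lemma t_mono : {homo t : i j / (i <= j)%N}.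
Proof. by apply: mono_windows => i; have := te i; have := tlac i; lia. Qed.

Lemma e_mono : {homo e : i j / (i <= j)%N}.
Proof. by apply: mono_windows => i; have := te i.+1; have := tlac i; lia. Qed.

Lemma e_le_t i j : (i < j)%N -> (e i <= t j)%N.
Proof. by move=> /t_mono; have := tlac i; lia. Qed.

Lemma block_unique i j n : (t i <= n < e i)%N -> (t j <= n < e j)%N -> i = j.
Proof.
move=> /andP[a b] /andP[c d]; case: (ltngtP i j) => // /e_le_t; lia.
Qed.

Lemma blocksum_ge0 x j : 0 <= blocksum x j.
Proof. by rewrite /blocksum sumr_ge0. Qed.

Lemma blocksum_le x y j : (forall n, (t j <= n < e j)%N -> `|x n| <= `|y n|) ->
  blocksum x j <= blocksum y j.
Proof. by move=> h; rewrite /blocksum; apply: ler_sum_nat => n /h. Qed.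

Lemma blocksum_eq0 x j : (forall n, (t j <= n < e j)%N -> x n = 0) -> blocksum x j = 0.
Proof.
move=> h; rewrite /blocksum big_nat_cond big1 // => n; rewrite andbT => /h ->.
exact: normr0.
Qed.

Lemma blocksum_add x y z j :
  (forall n, (t j <= n < e j)%N -> `|x n| + `|y n| <= `|z n|) ->
  blocksum x j + blocksum y j <= blocksum z j.
Proof. by move=> h; rewrite /blocksum -big_split /=; apply: ler_sum_nat => n /h. Qed.

Lemma le_blocksum x j n : (t j <= n < e j)%N -> `|x n| <= blocksum x j.
Proof.
move=> h; rewrite /blocksum (big_rem n) /=; last by rewrite mem_index_iota.
by rewrite lerDl sumr_ge0.
Qed.

Lemma vanishes_from_blocksum m x : vanishes_from m x -> vanishes_from m (blocksum x).
Proof.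
move=> hx j hj; apply: blocksum_eq0 => n /andP[h _]; apply: hx.
exact: leq_trans hj (leq_trans (tid j) h).
Qed.

Lemma vanishes_from_from m a x : vanishes_from m x -> vanishes_from m (from a x).
Proof. by move=> h n hn; rewrite /from h // if_same. Qed.

Lemma blocksum_le_tn y m j : vanishes_from m y -> blocksum y j <= 2 * N y.
Proof.
move=> hy.
have h := @tn_l1_lower _ succn y m (t j) (index_iota (t j) (e j)) hy.
have : 2^-1 * blocksum y j <= N y.
  apply: h; first exact: iota_ltn_sorted.
    by move=> p; rewrite mem_index_iota => /andP[].
  by rewrite size_iota; have := tlen j; lia.
lra.
Qed.

Lemma tn_block y j : N (window (t j) (e j) y) <= blocksum y j.
Proof.
apply: (le_trans (tn_l1 _ (@vanishes_from_window_end _ (t j) (e j) y))).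
rewrite -(big_mkord xpredT (fun n => `|window (t j) (e j) y n|)).
rewrite (big_cat_nat (n := t j)) //= big_nat_cond big1 ?add0r.
  by apply: ler_sum_nat => n hn; rewrite window_le.
by move=> n; rewrite andbT => /andP[_ h]; rewrite /window leqNgt h normr0.
Qed.

(** A window of block indices pulls back to the window of coordinates between the corresponding
    block starts, with the same admissibility condition; a single entry is a block sum, and a block
    is short enough for the l_1 lower estimate. *)
Lemma tn_contraction_le z y m : vanishes_from m y ->
  (forall j, `|z j| <= blocksum y j) -> T z <= 2 * N y.
Proof.
move=> hy hz; apply: tn_le => v hv; elim: hv y hy hz => {z v} [z n|z k s v hs hk _ IH] y hy hz.
  exact: le_trans (hz n) (blocksum_le_tn _ hy).
pose y' i := window (t (s i)) (t (s i.+1)) y.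
have h : \sum_(i < k) v i <= 2 * \sum_(i < k) N (y' i).
  rewrite mulr_sumr; apply: ler_sum => i _; apply: IH => //.
    exact: vanishes_from_window.
  move=> j; rewrite {1}/window; case: ifP => hj; last by rewrite normr0 blocksum_ge0.
  apply: (le_trans (hz j)); apply: blocksum_le => n /andP[h1 h2].
  move: hj => /andP[/t_mono h3 /e_le_t h4].
  by rewrite /y' /window (leq_trans h3 h1) (leq_trans h2 h4).
have hs' i : (t (s i) <= t (s i.+1))%N by apply: t_mono.
have := @tn_adm _ succn y m k (fun i => t (s i)) hy hs' hk.
rewrite -/(y' _); lra.
Qed.

Lemma windowsum_from (M : (nat -> R) -> R) z a c us : (c <= a)%N -> path leq a us ->
  windowsum M (from c z) a us = windowsum M z a us.
Proof.
elim: us a => [//|b us IH] a hc /= /andP[hab hp].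
rewrite IH ?(leq_trans hc) //; congr (M _ + _); apply/funext => n.
by rewrite /window /from; case: ifP => // /andP[/(leq_trans hc) ->].
Qed.

Definition in_blocks x (l h : nat) :=
  forall n, x n != 0 -> exists2 j, (l <= j < h)%N & (t j <= n < e j)%N.

(** The value l + w signals that no block of the range ends after a. *)
Lemma first_block (a l w : nat) : exists b, [/\ (l <= b <= l + w)%N,
  ((b < l + w) -> (a < e b))%N & forall j, (l <= j)%N -> (a < e j)%N -> (b <= j)%N].
Proof.
have ex : exists j, (l <= j)%N && ((l + w <= j)%N || (a < e j)%N).
  by exists (l + w)%N; rewrite leq_addr leqnn.
case: (ex_minnP ex) => b /andP[h1 h2] hmin; exists b; split.
- by rewrite h1; apply: hmin; rewrite leq_addr leqnn.
- by move=> hb; move: h2; rewrite leqNgt hb.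
- by move=> j hj ha; apply: hmin; rewrite hj ha orbT.
Qed.

Lemma exists_argmax (f : nat -> R) l w : (0 < w)%N ->
  exists2 J, (l <= J < l + w)%N & forall J', (l <= J' < l + w)%N -> f J' <= f J.
Proof.
case: w => // w _; elim: w => [|w [J hJ hmax]].
  by exists l => [|J' hJ']; [lia|have -> : J' = l by lia].
case: (leP (f (l + w.+1)%N) (f J)) => h.
  exists J => [|J' hJ']; first lia.
  case: (ltnP J' (l + w.+1)) => h'; first by apply: hmax; lia.
  by have -> : J' = (l + w.+1)%N by lia.
exists (l + w.+1)%N => [|J' hJ']; first lia.
case: (ltnP J' (l + w.+1)) => h'; last by have -> : J' = (l + w.+1)%N by lia.
by apply: (le_trans _ (ltW h)); apply: hmax; lia.
Qed.

(** This amounts to bounding [N x] by a maximum over J, written with an arbitrary upper bound [B] so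
    that an empty range is covered. Block J stands apart because a family starting inside it may be
    too large for the contracted norm at J, though not at J.+1. *)
Definition contraction_bound x w := forall l B, in_blocks x l (l + w) -> 0 <= B ->
  (forall J, (l <= J < l + w)%N -> blocksum x J + T (from J.+1 (blocksum x)) <= B) ->
  N x <= B.

Lemma window_split x m l w (IH : forall w' y, (w' < w)%N -> vanishes_from m y ->
    contraction_bound y w') (bl : nat -> nat) k s :
  vanishes_from m x -> in_blocks x l (l + w) ->
  (forall a, [/\ (l <= bl a <= l + w)%N,
     ((bl a < l + w) -> (a < e (bl a)))%N &
     forall j, (l <= j)%N -> (a < e j)%N -> (bl a <= j)%N]) ->
  (forall i, (s i <= s i.+1)%N) ->
  exists us, [/\ path leq (bl (s 0%N)).+1 us, (size us <= 4 * k)%N &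
    \sum_(i < k) N (window (s i) (s i.+1) x) <=
      blocksum (from (s 0%N) x) (bl (s 0%N))
      + windowsum T (blocksum x) (bl (s 0%N)).+1 us].
Proof.
move=> hx hin hbl; elim: k s => [|k IHk] s hs.
  by exists [::]; split => //=; rewrite big_ord0 addr0 blocksum_ge0.
have [us [hp hsz hsum]] := IHk (fun i => s i.+1) (fun i => hs i.+1).
have hz := vanishes_from_blocksum hx.
set b0 := bl (s 0%N); set b1 := bl (s 1%N) in hp hsum *.
have [/andP[hb0 hb0'] hb0e hb0min] := hbl (s 0%N).
have [/andP[hb1 hb1'] hb1e hb1min] := hbl (s 1%N).
rewrite -/b0 in hb0 hb0' hb0e hb0min; rewrite -/b1 in hb1 hb1' hb1e hb1min.
have hb01 : (b0 <= b1)%N.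
  case: (ltnP b1 (l + w)) => h; last exact: leq_trans hb0' h.
  by apply: hb0min => //; apply: leq_ltn_trans (hs 0%N) (hb1e h).
set y := window (s 0%N) (s 1%N) x.
have hy : vanishes_from m y by exact: vanishes_from_window.
have yblock n : y n != 0 -> exists2 j, (b0 <= j <= b1)%N & (t j <= n < e j)%N.
  rewrite /y /window; case: ifP => [/andP[h1 h2] hn|]; last by rewrite eqxx.
  have [j /andP[hj1 hj2] hjn] := hin _ hn; exists j => //; apply/andP; split.
    by apply: hb0min => //; move: hjn => /andP[_]; exact: leq_ltn_trans.
  rewrite leqNgt; apply/negP => h3; have := hb1e (ltn_trans h3 hj2).
  by have := e_le_t h3; lia.
(* The breakpoint s 1 may cut block b1; its pieces in this window and beyond are paid for together
   by one block sum. *)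
have sum_b1 : blocksum y b1 + blocksum (from (s 1%N) x) b1 <= blocksum x b1.
  apply: blocksum_add => n _; rewrite /y /window /from.
  by case: (ltnP n (s 1%N)) => h; rewrite ?andbF normr0 ?addr0 ?add0r //; case: ifP => // _; rewrite normr0.
rewrite big_ord_recl /= -/y.
have hus : path leq b1.+1 us by [].
case: (ltngtP b0 b1) hb01 => // hb _; last first.
  exists us; rewrite hb; split => //; first by lia.
  apply: (@le_trans _ _ (blocksum y b1 + (blocksum (from (s 1%N) x) b1 + windowsum T (blocksum x) b1.+1 us))).
    apply: lerD => //; apply: le_trans (tn_block y b1).
    apply: (@tn_mono _ _ _ _ m) => [|n]; first exact: vanishes_from_window.
    rewrite /window; case: ifP => // h; rewrite normr0 normr_le0; apply/negPn/negP => /yblock.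
    move=> [j hj hjn]; have hjb : j = b1 by lia.
    by rewrite hjb h in hjn.
  rewrite addrA lerD2r; apply: blocksum_add => n _; rewrite /y /window /from.
  have h01 := hs 0%N; case: (ltnP n (s 1%N)) => h; first by rewrite andbT normr0 addr0.
  by rewrite andbF normr0 add0r (leq_trans h01 h).
pose mid := window (e b0) (t b1) x.
have hmid : vanishes_from m mid by exact: vanishes_from_window.
have Ny : N y <= blocksum y b0 + N mid + blocksum y b1.
  apply: (@le_trans _ _ (N (window (t b0) (e b0) y) + N mid + N (window (t b1) (e b1) y)));
    last by rewrite lerD ?lerD ?tn_block.
  pose y' := fun n => `|window (t b0) (e b0) y n| + `|mid n|.
  apply: (@le_trans _ _ (N y' + N (window (t b1) (e b1) y))).
    apply: (@tn_triangle _ _ _ _ _ m).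
    - by move=> n hn; rewrite /y' /mid !(vanishes_from_window _ _ _ hn) // normr0 addr0.
    - exact: vanishes_from_window.
    move=> n; case: (eqVneq (y n) 0) => [->|hn]; first by rewrite normr0 addr_ge0.
    have [j /andP[hj1 hj2] hjn] := yblock _ hn.
    have y'0 : 0 <= y' n by rewrite addr_ge0.
    rewrite (ger0_norm y'0).
    case: (ltngtP b0 j) hj1 => // hj1 _; last first.
      by rewrite /y' /window hj1 hjn -addrA lerDl addr_ge0.
    case: (ltngtP j b1) hj2 => // hj2 _; last first.
      by rewrite /window -hj2 hjn lerDr.
    apply: (@le_trans _ _ `|mid n|); last by rewrite /y' -addrA addrCA lerDl addr_ge0.
    have -> : mid n = x n.
      have := e_le_t hj1; have := e_le_t hj2; rewrite /mid /window => h1 h2.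
      by case: ifP => //; lia.
    exact: window_le.
  rewrite lerD2r; apply: (@tn_triangle _ _ _ _ _ m); [exact: vanishes_from_window|by []|].
  by move=> n; rewrite ger0_norm /y' ?addr_ge0.
have y0 : blocksum y b0 <= blocksum (from (s 0%N) x) b0.
  apply: blocksum_le => n _; rewrite /y /window /from.
  by case: (leqP (s 0%N) n); rewrite //=; case: ifP; rewrite ?normr0.
have hzb1 : blocksum x b1 <= T (window b1 b1.+1 (blocksum x)).
  have -> : blocksum x b1 = `|window b1 b1.+1 (blocksum x) b1|.
    by rewrite /window leqnn ltnSn ger0_norm // blocksum_ge0.
  exact: (tn_coord _ _ (@vanishes_from_window_end _ b1 b1.+1 _)).
have hmidin : in_blocks mid b0.+1 (b0.+1 + (b1 - b0.+1)).
  move=> n; rewrite /mid /window; case: ifP => [/andP[h1 h2] hn|]; last by rewrite eqxx.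
  have [j hj hjn] := hin _ hn; exists j => //.
  case: (leqP j b0) => [/e_mono|hj0]; first by lia.
  case: (ltnP j b1) => [|/t_mono]; lia.
have hmidz J : `|from J.+1 (blocksum mid) J| = 0 by rewrite /from ltnn normr0.
have hmidle j : `|blocksum mid j| <= `|window b0.+1 b1 (blocksum x) j|.
  rewrite /window; case: ifP => hj.
    rewrite !ger0_norm ?blocksum_ge0 //; apply: blocksum_le => n _; exact: window_le.
  rewrite blocksum_eq0 // => n hn; rewrite /mid /window; case: ifP => // h.
  case: (leqP j b0) => [/e_mono|hj0]; first by lia.
  case: (ltnP j b1) => [|/t_mono]; lia.
have [us' [hp' hsz' hsum']] : exists us', [/\ path leq b0.+1 us',
    (size us' <= 4)%N /\ last b0.+1 us' = b1.+1 &
    N mid + blocksum x b1 <= windowsum T (blocksum x) b0.+1 us'].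
  case: (posnP (b1 - b0.+1)) => hw'.
    exists [:: b1; b1.+1]; split => //=; first by lia.
    rewrite addr0 lerD // tn_eq0 ?tn_ge0 // => n; apply/eqP/negPn/negP => /hmidin[j].
    by rewrite hw'; lia.
  pose f J := blocksum mid J + T (from J.+1 (blocksum mid)).
  have [J hJ hmax] := exists_argmax f b0.+1 hw'.
  exists [:: J; J.+1; b1; b1.+1]; split => //=; first by lia.
  have hNmid : N mid <= f J.
    apply: (IH _ _ _ hmid _ _ hmidin) => //; first by lia.
    by rewrite addr_ge0 ?blocksum_ge0 ?tn_ge0.
  have f1 : blocksum mid J <= T (window J J.+1 (blocksum x)).
    apply: (@le_trans _ _ `|window J J.+1 (blocksum x) J|).
      rewrite /window leqnn ltnSn ger0_norm ?blocksum_ge0 //.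
      by apply: blocksum_le => n _; exact: window_le.
    exact: (tn_coord _ _ (@vanishes_from_window_end _ J J.+1 _)).
  have f2 : T (from J.+1 (blocksum mid)) <= T (window J.+1 b1 (blocksum x)).
    apply: (@tn_mono _ _ _ _ m) => [|n]; first exact: vanishes_from_window.
    rewrite {1}/from; case: ifP => hn; last by rewrite normr0.
    apply: (le_trans (hmidle n)); rewrite /window hn.
    by case: (ltnP n b1); rewrite ?andbF ?andbT //; case: ifP; rewrite ?normr0.
  have f3 := tn_ge0 (fun j => (t j).+1) (window b0.+1 J (blocksum x)).
  rewrite /f in hNmid; lra.
exists (us' ++ us); split.
- by rewrite cat_path hp' (proj2 hsz').
- by rewrite size_cat; lia.
have -> : windowsum T (blocksum x) b0.+1 (us' ++ us) =
   windowsum T (blocksum x) b0.+1 us' + windowsum T (blocksum x) (last b0.+1 us') us.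
  elim: us' b0.+1 {hp' hsz' hsum'} => [|a us' IHus] b' /=; first by rewrite add0r.
  by rewrite IHus addrA.
rewrite (proj2 hsz') /= in hsum *; lra.
Qed.

Lemma contraction_boundP w x m : vanishes_from m x -> contraction_bound x w.
Proof.
elim/ltn_ind: w x => w IH x hx l B hin B0 hB.
have zero n : x n != 0 -> `|x n| <= B.
  move=> hn; have [j hj hjn] := hin _ hn.
  apply: le_trans (hB _ hj); apply: (@le_trans _ _ (blocksum x j)); first exact: le_blocksum.
  by rewrite lerDl tn_ge0.
apply: tn_le => v hv; case: hv hx hin hB zero => {x v} [x n|x k s v hs hk hv] hx hin hB zero.
  by case: (eqVneq (x n) 0) => [->|/zero //]; rewrite normr0.
have [bl hbl] := boolp.choice (fun a => first_block a l w).
have [us [hp hsz hsum]] := window_split (fun w1 y h hy => IH w1 h y hy) k hx hin hbl hs.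
have hv' : \sum_(i < k) v i <= \sum_(i < k) N (window (s i) (s i.+1) x).
  apply: ler_sum => i _; apply: tval_le_tn; last exact: hv.
  exact: (vanishes_from_window _ _ hx).
have [/andP[hb hb'] hbe hbmin] := hbl (s 0%N).
set b := bl (s 0%N) in hp hsum hb hb' hbe hbmin.
have hz := vanishes_from_blocksum hx.
case: (ltnP b (l + w)) => hbw; last first.
  suff h0 : \sum_(i < k) N (window (s i) (s i.+1) x) = 0 by lra.
  apply: big1 => i _; apply: tn_eq0 => n; rewrite /window; case: ifP => // /andP[h1 _].
  apply/eqP/negPn/negP => /hin[j /andP[hj1 hj2] /andP[_ hj3]].
  have h0 : (s 0%N <= s i)%N by apply: (mono_windows hs).
  have := hbmin _ hj1 (leq_ltn_trans (leq_trans h0 h1) hj3).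
  by rewrite leqNgt (leq_trans hj2 hbw).
have hbJ : (l <= b < l + w)%N by rewrite hb.
apply: le_trans (hB _ hbJ).
(* Here lacunarity enters: k <= s 0 + 1 <= e b, hence 4 k <= 4 e b <= t b.+1. *)
have hsize : (size us <= (t b.+1).+1)%N.
  by have := hbe hbw; have := tlac b; move: hk hsz; lia.
have := tn_windowsum (tau := fun j => (t j).+1) (vanishes_from_from b.+1 hz) hp hsize.
rewrite windowsum_from //.
have : blocksum (from (s 0%N) x) b <= blocksum x b.
  by apply: blocksum_le => n _; rewrite /from; case: ifP; rewrite ?normr0.
have := blocksum_ge0 x b.
have := blocksum_ge0 (from (s 0%N) x) b.
lra.
Qed.

Lemma tn_le_contraction x m : vanishes_from m x ->
  (forall n, x n != 0 -> exists j, (t j <= n < e j)%N) -> N x <= 2 * T (blocksum x).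
Proof.
move=> hx hin; have hz := vanishes_from_blocksum hx.
apply: (@contraction_boundP m x m hx 0%N).
- move=> n hn; have [j hj] := hin n hn; exists j => //=; rewrite add0n.
  have hnm : (n < m)%N by rewrite ltnNge; apply: contra hn => /hx ->.
  by have := tid j; lia.
- by rewrite mulr_ge0 // tn_ge0.
move=> J _.
have h1 : blocksum x J <= T (blocksum x).
  by rewrite -[leLHS]ger0_norm ?blocksum_ge0 //; exact: tn_coord hz.
have h2 : T (from J.+1 (blocksum x)) <= T (blocksum x).
  apply: (tn_mono _ hz) => n; rewrite /from; case: ifP => //; by rewrite normr0.
lra.
Qed.

(* The off-block part of x is dominated pointwise; the block parts of x and y
   are compared through their contractions to one coordinate per block. *)
Theorem tn_block_dom K x y m : 0 <= K -> vanishes_from m x -> vanishes_from m y ->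
  (forall n, (forall j, ~~ (t j <= n < e j)%N) -> `|x n| <= K * `|y n|) ->
  (forall j, blocksum x j <= K * blocksum y j) ->
  N x <= 5 * K * N y.
Proof.
move=> K0 hx hy hoff hon.
pose off n := `[< forall j, ~~ (t j <= n < e j)%N >].
pose x1 n := if off n then x n else 0.
pose x2 n := if off n then 0 else x n.
have v1 : vanishes_from m x1 by move=> n hn; rewrite /x1 hx // if_same.
have v2 : vanishes_from m x2 by move=> n hn; rewrite /x2 hx // if_same.
have h0 : N x <= N x1 + N x2.
  apply: (tn_triangle _ v1 v2) => n; rewrite /x1 /x2.
  by case: ifP => _; rewrite normr0 ?addr0 ?add0r.
have h1 : N x1 <= K * N y.
  apply: (tn_dom _ K0 hy) => n; rewrite /x1 /off; case: ifPn => [/asboolP/hoff //|_].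
  by rewrite normr0 mulr_ge0.
have h2 : N x2 <= 2 * T (blocksum x2).
  apply: (tn_le_contraction v2) => n; rewrite /x2 /off; case: asboolP; rewrite ?eqxx // => h _.
  by move: h => /existsNP[j /negP hj]; exists j; rewrite negbK in hj.
have h3 : T (blocksum x2) <= K * T (blocksum y).
  apply: (tn_dom _ K0 (vanishes_from_blocksum hy)) => j.
  rewrite !ger0_norm ?blocksum_ge0 //; apply: le_trans (hon j).
  by apply: blocksum_le => n _; rewrite /x2; case: ifP; rewrite ?normr0.
have h4 : T (blocksum y) <= 2 * N y.
  by apply: (tn_contraction_le hy) => j; rewrite ger0_norm // blocksum_ge0.
(* Each passage between [N] and [T] costs a factor 2 and the off-block part adds 1, so 5 = 2 * 2 +
   1. *)
have := ler_wpM2l K0 h4; lra.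
Qed.

End Blocks.

(** * Real powers *)

Section RealPowers.
Variable R : realType.
Implicit Types (a b p q r s t u x y : R).

Lemma le_powR r x y : 0 <= r -> 0 <= x -> x <= y -> x `^ r <= y `^ r.
Proof.
move=> r0 x0 xy; apply: ge0_ler_powR => //; rewrite nnegrE //; exact: le_trans xy.
Qed.

Lemma powRK r x : 0 < r -> 0 <= x -> (x `^ r) `^ r^-1 = x.
Proof. by move=> r0 x0; rewrite -powRrM mulfV ?gt_eqF // powRr1. Qed.

Lemma powRVK r x : 0 < r -> 0 <= x -> (x `^ r^-1) `^ r = x.
Proof. by move=> r0 x0; rewrite -powRrM mulVf ?gt_eqF // powRr1. Qed.

(** Young's inequality with 1 as the second factor. *)
Lemma powR_bernoulli r u : 0 < r <= 1 -> 0 <= u -> u `^ r <= r * u + (1 - r).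
Proof.
move=> /andP[r0]; rewrite le_eqVlt => /predU1P[->|r1] u0.
  by rewrite powRr1 // mul1r subrr addr0.
have h : 0 < 1 - r by rewrite subr_gt0.
have := @conjugate_powR R (u `^ r) 1 r^-1 (1 - r)^-1 (powR_ge0 _ _) ler01.
rewrite !invr_gt0 !invrK powRK // mulr1 powR1 mul1r => /(_ r0 h).
by rewrite addrC subrK mulrC; apply.
Qed.

(** Concavity without derivatives: the graph of the power lies below its tangent at l, by rescaling
    the case l = 1. *)
Lemma powR_tangent r l t : 0 < r <= 1 -> 0 < l -> 0 <= t ->
  t `^ r <= (1 - r) * l `^ r + r * (l `^ r / l) * t.
Proof.
move=> hr l0 t0; have := powR_bernoulli hr (divr_ge0 t0 (ltW l0)).
rewrite -(ler_pM2r (powR_gt0 r l0)) -powRM ?divr_ge0 ?(ltW l0) //.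
rewrite divfK ?gt_eqF //.
have -> : (r * (t / l) + (1 - r)) * l `^ r = (1 - r) * l `^ r + r * (l `^ r / l) * t by ring.
by [].
Qed.

Lemma powR_jensen (I : finType) (m f : I -> R) r : 0 < r <= 1 ->
  (forall i, 0 <= m i) -> \sum_i m i = 1 -> (forall i, 0 <= f i) ->
  \sum_i m i * f i `^ r <= (\sum_i m i * f i) `^ r.
Proof.
move=> hr m0 m1 f0; have /andP[r0 r1] := hr.
set l := \sum_i m i * f i.
have l0 : 0 <= l by rewrite sumr_ge0 // => i _; rewrite mulr_ge0.
case: (eqVneq l 0) => [l00|ln0].
  rewrite l00 powR0 ?gt_eqF // big1 // => i _.
  have /eqP : m i * f i = 0.
    by apply/eqP; have := psumr_eq0P (fun i _ => mulr_ge0 (m0 i) (f0 i)) l00 => ->.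
  rewrite mulf_eq0 => /orP[/eqP ->|/eqP ->]; first by rewrite mul0r.
  by rewrite powR0 ?gt_eqF // mulr0.
have lp : 0 < l by rewrite lt_def ln0.
apply: (@le_trans _ _ (\sum_i m i * ((1 - r) * l `^ r + r * (l `^ r / l) * f i))).
  by apply: ler_sum => i _; apply: ler_wpM2l => //; exact: powR_tangent.
under eq_bigr do rewrite mulrDr.
rewrite big_split /= -mulr_suml m1 mul1r.
under eq_bigr do rewrite mulrCA.
rewrite -mulr_sumr -/l -mulrA divfK //; nra.
Qed.

Lemma powR_mean r a b : 0 < r <= 1 -> 0 <= a -> 0 <= b ->
  (a `^ r + b `^ r) / 2 <= ((a + b) / 2) `^ r.
Proof.
move=> hr a0 b0; have /andP[r0 r1] := hr.
case: (eqVneq (a + b) 0) => [|ab].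
  move=> /eqP; rewrite paddr_eq0 // => /andP[/eqP -> /eqP ->].
  by rewrite powR0 ?gt_eqF // addr0 mul0r powR0 ?gt_eqF.
have l0 : 0 < (a + b) / 2 by rewrite divr_gt0 // lt_def ab addr_ge0.
have h1 := powR_tangent hr l0 a0; have h2 := powR_tangent hr l0 b0.
have h3 : r * (((a + b) / 2) `^ r / ((a + b) / 2)) * a + r * (((a + b) / 2) `^ r / ((a + b) / 2)) * b =
  2 * r * ((a + b) / 2) `^ r by field.
nra.
Qed.

Lemma powR_subadd r a b : 0 < r <= 1 -> 0 <= a -> 0 <= b ->
  (a + b) `^ r <= a `^ r + b `^ r.
Proof.
move=> hr a0 b0; have /andP[r0 r1] := hr.
case: (eqVneq (a + b) 0) => [->|ab]; first by rewrite powR0 ?gt_eqF // addr_ge0 ?powR_ge0.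
have l0 : 0 < a + b by rewrite lt_def ab addr_ge0.
have aux c : 0 <= c -> c <= a + b -> c / (a + b) * (a + b) `^ r <= c `^ r.
  move=> c0 cl; case: (eqVneq c 0) => [->|cn0]; first by rewrite !mul0r powR_ge0.
  have cp : 0 < c by rewrite lt_def cn0.
  have -> : c `^ r = (c / (a + b)) `^ r * (a + b) `^ r.
    by rewrite -powRM ?divfK ?divr_ge0 ?(ltW l0).
  apply: ler_wpM2r; first exact: powR_ge0.
  by apply: ger1_powR => //; rewrite divr_gt0 //= ler_pdivrMr // mul1r.
have h1 := aux a a0; have h2 := aux b b0.
have -> : (a + b) `^ r = a / (a + b) * (a + b) `^ r + b / (a + b) * (a + b) `^ r by field.
by apply: lerD; [apply: h1|apply: h2]; rewrite ?lerDl ?lerDr.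
Qed.

Lemma powR_quasi p a b : 0 <= p -> 0 <= a -> 0 <= b ->
  (a + b) `^ p <= 2 `^ p * (a `^ p + b `^ p).
Proof.
move=> p0; wlog ab : a b / a <= b.
  by move=> h a0 b0; case: (leP a b) => [/h|/ltW/h]; [|rewrite addrC [b `^ _ + _]addrC]; apply.
move=> a0 b0; apply: (@le_trans _ _ ((2 * b) `^ p)); first by apply: le_powR => //; lra.
by rewrite powRM // ler_wpM2l ?powR_ge0 // lerDr powR_ge0.
Qed.

Lemma powR_midpoint p s x : 1 <= p ->
  `|s| `^ p <= (`|s + x| `^ p + `|s - x| `^ p) / 2.
Proof.
move=> p1; have p0 : 0 < p by lra.
have hr : 0 < p^-1 <= 1 by rewrite invr_gt0 p0 invf_le1.
have := powR_mean hr (powR_ge0 `|s + x| p) (powR_ge0 `|s - x| p).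
rewrite !powRK // => h.
have h1 : `|s| <= (`|s + x| + `|s - x|) / 2.
  have := ler_normD (s + x) (s - x).
  have -> : s + x + (s - x) = 2 * s by ring.
  rewrite normrM ger0_norm //; lra.
have h0 : 0 <= (`|s + x| `^ p + `|s - x| `^ p) / 2 by rewrite divr_ge0 ?addr_ge0 ?powR_ge0.
rewrite -[leRHS](powRVK p0 h0); apply: le_powR => //; [exact: ltW|lra].
Qed.

Lemma powR_sqr p x : `|x| `^ p = (x ^+ 2) `^ (p / 2).
Proof. by rewrite -real_normK ?num_real // -powR_mulrn // -powRrM mulrCA mulfV ?mulr1. Qed.

(** The function u^(p/2) is concave and subadditive, and the mean of (s + x)^2 and (s - x)^2 is s^2
    + x^2. *)
Lemma clarkson_two_point p s x : 0 < p <= 2 ->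
  (`|s + x| `^ p + `|s - x| `^ p) / 2 <= `|s| `^ p + `|x| `^ p.
Proof.
move=> /andP[p0 p2]; rewrite !powR_sqr.
have hr : 0 < p / 2 <= 1 by rewrite divr_gt0 //= ler_pdivrMr // mul1r.
apply: le_trans (powR_mean hr (sqr_ge0 _) (sqr_ge0 _)) _.
have -> : ((s + x) ^+ 2 + (s - x) ^+ 2) / 2 = s ^+ 2 + x ^+ 2 by field.
by apply: powR_subadd => //; exact: sqr_ge0.
Qed.

(** The linear terms have opposite signs and cancel in the mean of the two powers; the constant 4^n
    is a crude bound that survives the induction. *)
Lemma exprn_taylor (n : nat) x : 0 <= x <= 1 ->
  (1 + x) ^+ n <= 1 + n%:R * x + 4 ^+ n * x ^+ 2 /\
  (1 - x) ^+ n <= 1 - n%:R * x + 4 ^+ n * x ^+ 2.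
Proof.
move=> /andP[x0 x1]; elim: n => [|n [IH1 IH2]]; first by rewrite !expr0; nra.
have hn : (n%:R : R) <= 4 ^+ n.
  elim: n {IH1 IH2} => [|n IH]; first by rewrite expr0.
  have h1 : 1 <= (4 : R) ^+ n by apply: exprn_ege1; lra.
  by rewrite exprS -natr1; lra.
have hx2 : 0 <= x ^+ 2 by exact: sqr_ge0.
have h4 : 0 <= (4 : R) ^+ n by apply: exprn_ge0.
have hx3 : 0 <= x ^+ 2 * x by rewrite mulr_ge0.
have hx4 : x ^+ 2 * x <= x ^+ 2 by rewrite ler_piMr.
rewrite !exprS -natr1; split.
- have := ler_wpM2l (addr_ge0 ler01 x0) IH1; move/le_trans; apply.
  have : 4 ^+ n * (x ^+ 2 * x) <= 4 ^+ n * x ^+ 2 by rewrite ler_wpM2l.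
  have := ler_wpM2r hx2 hn.
  rewrite expr2; nra.
- have h1x : 0 <= 1 - x by lra.
  have := ler_wpM2l h1x IH2; move/le_trans; apply.
  have := ler_wpM2r hx2 hn; have := mulr_ge0 h4 hx3; have := mulr_ge0 h4 hx2.
  rewrite expr2; nra.
Qed.

(** For |s| < |x| everything is at most a multiple of |x|^p. Otherwise scaling by |s| leaves a
    second-order estimate in h = |x|/|s| <= 1. Since p need not be an integer, the p-th powers are
    written as concave powers p/N of N-th powers with an integer N >= p, to which the expansion
    applies. *)
Lemma rosenthal_two_point p : 2 <= p -> exists2 C, 0 <= C & forall s x,
  (`|s + x| `^ p + `|s - x| `^ p) / 2 <=
  `|s| `^ p + C * (`|s| `^ (p - 2) * x ^+ 2 + `|x| `^ p).
Proof.
move=> p2; have p0 : 0 < p by lra.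
pose n := (Num.truncn p).+1.
have hn : p <= (2 * n)%N%:R.
  have := truncnS_gt (p : R); rewrite -/n natrM => /ltW; have : (0 : R) <= n%:R by []; nra.
pose N : R := (2 * n)%N%:R.
have N0 : 0 < N by lra.
have hr : 0 < p / N <= 1 by rewrite divr_gt0 //= ler_pdivrMr // mul1r.
pose D : R := 4 ^+ (2 * n).
have D0 : 0 <= D by apply: exprn_ge0.
exists (2 `^ p + D) => [|s x]; first by rewrite addr_ge0 ?powR_ge0.
have sp0 := powR_ge0 `|s| p; have sp2 := powR_ge0 `|s| (p - 2); have xp0 := powR_ge0 `|x| p.
have h2p := powR_ge0 (2 : R) p; have x20 := sqr_ge0 x.
case: (leP `|x| `|s|) => hxs; last first.
  have h : forall y, `|y| <= 2 * `|x| -> `|y| `^ p <= 2 `^ p * `|x| `^ p.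
    by move=> y hy; rewrite -powRM //; apply: le_powR => //; exact: ltW.
  have h1 : `|s + x| `^ p <= 2 `^ p * `|x| `^ p by apply: h; have := ler_normD s x; lra.
  have h2 : `|s - x| `^ p <= 2 `^ p * `|x| `^ p by apply: h; have := ler_normB s x; lra.
  have := mulr_ge0 h2p (mulr_ge0 sp2 x20); have := mulr_ge0 D0 (mulr_ge0 sp2 x20).
  have := mulr_ge0 D0 xp0; nra.
case: (eqVneq s 0) hxs => [->|s0] hxs.
  have -> : x = 0 by apply/eqP; rewrite -normr_eq0 eq_le normr_ge0 andbT -(@normr0 R R).
  by rewrite subr0 addr0 normr0 powR0 ?gt_eqF // expr0n /= !(mulr0, addr0, mul0r).
have s1 : 0 < `|s| by rewrite normr_gt0.
pose h := `|x| / `|s|.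
have h0 : 0 <= h by rewrite divr_ge0.
have h1 : h <= 1 by rewrite ler_pdivrMr // mul1r.
have key : (`|s + x| `^ p + `|s - x| `^ p) = `|s| `^ p * ((1 + h) `^ p + (1 - h) `^ p).
  have e y : `|s + y| `^ p = `|s| `^ p * `|1 + y / s| `^ p.
    rewrite -powRM // -normrM mulrDr mulr1; congr (`|_ + _| `^ _); by field.
  have -> : h = `|x / s| by rewrite normrM normfV.
  rewrite !e mulNr mulrDr.
  have hxs1 : `|x / s| <= 1 by rewrite normrM normfV.
  have n1 : `|1 + x / s| = 1 + x / s by rewrite ger0_norm //; have := ler_norm (- (x / s)); rewrite normrN; lra.
  have n2 : `|1 - x / s| = 1 - x / s by rewrite ger0_norm //; have := ler_norm (x / s); lra.
  rewrite n1 n2; case: (ger0P (x / s)) => _ //.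
  by rewrite opprK addrC.
rewrite key.
have h2 : ((1 + h) `^ p + (1 - h) `^ p) / 2 <= 1 + D * h ^+ 2.
  have e y : 0 <= y -> y `^ p = (y ^+ (2 * n)) `^ (p / N).
    by move=> y0; rewrite -powR_mulrn // -powRrM mulrCA mulfV ?mulr1 ?gt_eqF.
  rewrite !e; try lra.
  have g1 : 0 <= (1 + h) ^+ (2 * n) by apply: exprn_ge0; lra.
  have g2 : 0 <= (1 - h) ^+ (2 * n) by apply: exprn_ge0; lra.
  apply: le_trans (powR_mean hr g1 g2) _.
  have hh : 0 <= h <= 1 by rewrite h0.
  have [t1 t2] := exprn_taylor (2 * n) hh.
  have Dh : 0 <= D * h ^+ 2 by rewrite mulr_ge0 ?sqr_ge0.
  apply: (@le_trans _ _ ((1 + D * h ^+ 2) `^ (p / N))).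
    apply: le_powR; [by case/andP: hr => /ltW|lra|rewrite /D; lra].
  by apply: ler1_powR; [lra|case/andP: hr].
have e2 : `|s| `^ p * h ^+ 2 = `|s| `^ (p - 2) * x ^+ 2.
  have -> : p = (p - 2) + 2 by ring.
  rewrite powRD; last by apply/implyP => _; rewrite gt_eqF.
  rewrite addrK -mulrA; congr (_ * _).
  have s2 : `|s| ^+ 2 != 0 by rewrite expf_eq0 /= gt_eqF.
  by rewrite powR_mulrn // /h exprMn exprVn mulrC divfK // real_normK // num_real.
have h3 : `|s| `^ p * ((1 + h) `^ p + (1 - h) `^ p) / 2 <= `|s| `^ p + D * (`|s| `^ (p - 2) * x ^+ 2).
  have -> : `|s| `^ p + D * (`|s| `^ (p - 2) * x ^+ 2) = `|s| `^ p * (1 + D * h ^+ 2).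
    by rewrite -e2; ring.
  by rewrite -mulrA ler_wpM2l.
have := mulr_ge0 h2p (mulr_ge0 sp2 x20); have := mulr_ge0 h2p xp0; have := mulr_ge0 D0 xp0.
nra.
Qed.

End RealPowers.

(** * Tsirelson's space *)

Section SpaceFacts.
Variable R : realType.
Implicit Types (a b c : nat -> R).
Local Notation N := (tn (R := R) succn).

Lemma c00_vanish m a : vanishes_from m a -> c00 a.
Proof. by move=> h; apply/c00P; exists m. Qed.

Lemma trunc_window n a : trunc n a = window 0 n a.
Proof. by []. Qed.

Lemma tn_window_mono m n m' n' a : (m' <= m)%N -> (n <= n')%N ->
  N (window m n a) <= N (window m' n' a).
Proof.
move=> hm hn; apply: (tn_mono _ (@vanishes_from_window_end _ m' n' a)) => k.
rewrite /window; case: ifP => [/andP[h1 h2]|_]; last by rewrite normr0.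
by rewrite (leq_trans hm h1) (leq_trans h2 hn).
Qed.

Lemma tsirelson_norm_trunc m n a : (m <= n)%N ->
  tsirelson_norm (trunc m a - trunc n a) = N (window m n a) /\
  tsirelson_norm (trunc n a - trunc m a) = N (window m n a).
Proof.
move=> hmn.
have h k : (trunc m a - trunc n a) k = - window m n a k /\
           (trunc n a - trunc m a) k = window m n a k.
  rewrite /trunc /window /=; case: (ltnP k m) => h1.
    by rewrite !fctE h1 (leq_trans h1 hmn) /= !subrr oppr0.
  by rewrite !fctE ltnNge h1 /=; case: ifP => _; rewrite ?sub0r ?subr0 ?oppr0.
have v1 : vanishes_from n (trunc m a - trunc n a).
  by move=> k hk; case: (h k) => -> _; rewrite (@vanishes_from_window_end _ m n a) // oppr0.
have v2 : vanishes_from n (trunc n a - trunc m a).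
  by move=> k hk; case: (h k) => _ ->; rewrite (@vanishes_from_window_end _ m n a).
rewrite !tsirelson_normE; try exact: c00_vanish v1; try exact: c00_vanish v2.
split; last by congr N; apply/funext => k; case: (h k).
apply/eqP; rewrite eq_le; apply/andP; split.
  apply: (tn_mono _ (@vanishes_from_window_end _ m n a)) => k.
  by case: (h k) => -> _; rewrite normrN.
by apply: (tn_mono _ v1) => k; case: (h k) => -> _; rewrite normrN.
Qed.

Lemma tsirelson_spaceP a : tsirelson_space a <->
  forall e, 0 < e -> exists n0, forall m n, (n0 <= m <= n)%N -> N (window m n a) < e.
Proof.
split=> h e e0; have [n0 hn0] := h e e0; exists n0 => m n.
  move=> /andP[h1 h2]; have := hn0 m n h1 (leq_trans h1 h2).
  by have [-> _] := tsirelson_norm_trunc a h2.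
move=> hm hn; case: (leqP m n) => hmn.
  by have [-> _] := tsirelson_norm_trunc a hmn; apply: hn0; rewrite hm hmn.
by have [_ ->] := tsirelson_norm_trunc a (ltnW hmn); apply: hn0; rewrite hn ltnW.
Qed.

Local Notation tsn := (tsirelson_space_norm (R := R)).

Lemma tsn_lim a : tsirelson_space a ->
  (fun n => N (window 0 n a)) @ \oo --> tsn a.
Proof.
move=> ha; rewrite /tsirelson_space_norm.
have -> : (fun n => tsirelson_norm (trunc n a)) = (fun n => N (window 0 n a)).
  apply/funext => n; rewrite trunc_window tsirelson_normE //.
  exact: c00_vanish (@vanishes_from_window_end _ 0 n a).
suff : cvgn (fun n => N (window 0 n a)) by [].
apply: nondecreasing_is_cvgn.
  by move=> m n hmn; apply: tn_window_mono.
have [n0 hn0] := (tsirelson_spaceP a).1 ha 1 ltr01.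
exists (N (window 0 n0 a) + 1) => _ [n _ <-].
apply: (@le_trans _ _ (N (window 0 n0 a) + N (window n0 (maxn n0 n) a))); last first.
  by rewrite lerD2l ltW // hn0 // leqnn leq_maxl.
have v k : (k <= maxn n0 n)%N -> forall l, vanishes_from (maxn n0 n) (window l k a).
  by move=> hk l i hi; rewrite (@vanishes_from_window_end _ l k a) // (leq_trans hk).
apply: (tn_triangle _ (v _ (leq_maxl _ _) 0%N) (v _ (leqnn _) n0)) => k.
rewrite /window /= leq_max; case: (ltnP k n0) => h1 /=.
  by case: ifP => _; rewrite ?normr0 ?lerDl ?addr_ge0.
by case: ifP => _; rewrite ?normr0 ?add0r.
Qed.

Lemma window_le_tsn a n : tsirelson_space a -> N (window 0 n a) <= tsn a.
Proof.
move=> ha; have h := tsn_lim ha; rewrite -(cvg_lim _ h) //.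
apply: (nondecreasing_cvgn_le (u_ := fun n => N (window 0 n a))).
  by move=> i j hij; apply: tn_window_mono.
by apply/cvg_ex; exists (tsn a).
Qed.

Lemma tsn_le a B : tsirelson_space a -> (forall n, N (window 0 n a) <= B) -> tsn a <= B.
Proof.
move=> ha hB; have h := tsn_lim ha; rewrite -(cvg_lim _ h) //.
apply: limr_le; first by apply/cvg_ex; exists (tsn a).
by near=> n; exact: hB.
Unshelve. all: by end_near.
Qed.

Lemma tsn_ge0 a : tsirelson_space a -> 0 <= tsn a.
Proof. by move=> ha; apply: le_trans (window_le_tsn 0 ha); exact: tn_ge0. Qed.

Lemma tsn_comb u v a b c : 0 <= u -> 0 <= v -> tsirelson_space a -> tsirelson_space b ->
  (forall n, `|c n| <= u * `|a n| + v * `|b n|) ->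
  tsirelson_space c /\ tsn c <= u * tsn a + v * tsn b.
Proof.
move=> u0 v0 ha hb hc.
have key m n : N (window m n c) <= u * N (window m n a) + v * N (window m n b).
  apply: (tn_comb _ u0 v0 (@vanishes_from_window_end _ m n a) (@vanishes_from_window_end _ m n b)).
  by move=> k; rewrite /window; case: ifP => // _; rewrite normr0 !mulr0 addr0.
have hs : tsirelson_space c.
  apply/tsirelson_spaceP => e e0.
  have e1 : 0 < e / (2 * (u + v + 1)).
    by rewrite divr_gt0 // mulr_gt0 // ltr_wpDl ?addr_ge0.
  have [n1 h1] := (tsirelson_spaceP a).1 ha _ e1.
  have [n2 h2] := (tsirelson_spaceP b).1 hb _ e1.
  exists (maxn n1 n2) => m n /andP[]; rewrite geq_max => /andP[hm1 hm2] hmn.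
  have h3 := h1 m n _; have h4 := h2 m n _; rewrite hm1 hmn in h3; rewrite hm2 hmn in h4.
  have h5 := ler_wpM2l u0 (ltW (h3 isT)); have h6 := ler_wpM2l v0 (ltW (h4 isT)).
  apply: (le_lt_trans (key m n)); apply: (le_lt_trans (lerD h5 h6)).
  rewrite -mulrDl mulrA ltr_pdivrMr; last by rewrite mulr_gt0 // ltr_wpDl ?addr_ge0.
  have := mulr_ge0 (ltW e0) u0; have := mulr_ge0 (ltW e0) v0; lra.
split => //; apply: tsn_le => // n; apply: (le_trans (key 0%N n)).
by apply: lerD; apply: ler_wpM2l => //; exact: window_le_tsn.
Qed.

Lemma tsn_dom u a c : 0 <= u -> tsirelson_space a ->
  (forall n, `|c n| <= u * `|a n|) -> tsirelson_space c /\ tsn c <= u * tsn a.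
Proof.
move=> u0 ha hc; have := tsn_comb u0 (lexx 0) ha ha (c := c).
by rewrite mul0r addr0; apply => n; rewrite mul0r addr0.
Qed.

Lemma tsn_finite m a : vanishes_from m a -> tsirelson_space a /\ tsn a = N a.
Proof.
move=> hm.
have hs : tsirelson_space a.
  apply/tsirelson_spaceP => e e0; exists m => i n /andP[hi _].
  rewrite tn_eq0 // => k; rewrite /window; case: ifP => // /andP[hk _].
  by rewrite hm // (leq_trans hi hk).
split => //; apply/eqP; rewrite eq_le; apply/andP; split.
  apply: tsn_le => // n; apply: (tn_mono _ hm) => k; exact: window_le.
have -> : a = window 0 m a.
  by apply/funext => k; rewrite /window /=; case: ltnP => // /hm.
rewrite {2}(_ : window 0 m a = a); first exact: window_le_tsn.
by apply/funext => k; rewrite /window /=; case: ltnP => // /hm.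
Qed.

Lemma tsn_tail a e : tsirelson_space a -> 0 < e ->
  exists n0, forall m, (n0 <= m)%N -> tsirelson_space (from m a) /\ tsn (from m a) < e.
Proof.
move=> ha e0; have e1 : 0 < e / 2 by rewrite divr_gt0.
have [n0 hn0] := (tsirelson_spaceP a).1 ha _ e1.
exists n0 => m hm.
have [hs _] : tsirelson_space (from m a) /\ tsn (from m a) <= 1 * tsn a.
  apply: tsn_dom => // n; rewrite mul1r /from; case: ifP => // _; by rewrite normr0.
split => //; apply: (@le_lt_trans _ _ (e / 2)); last by lra.
apply: tsn_le => // n.
have -> : window 0 n (from m a) = window m n a.
  apply/funext => k; rewrite /window /from /=.
  by case: (ltnP k n); rewrite ?andbF ?andbT.
case: (leqP m n) => hmn; first by rewrite ltW // hn0 // hm hmn.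
rewrite tn_eq0 ?ltW // => k; rewrite /window; case: ifP => // /andP[h1 h2].
by move: (leq_ltn_trans h1 h2); rewrite ltnNge (ltnW hmn).
Qed.

(* Democracy of the unit vector basis: drop the smaller half of the support. *)
Lemma tn_indicator_lower m x (w : R) (ps : seq nat) : vanishes_from m x -> sorted ltn ps ->
  0 <= w -> (forall k, k \in ps -> w <= `|x k|) -> w * (size ps)%:R <= 4 * N x.
Proof.
move=> hx hs w0 hw; set n := size ps; pose qs := drop n./2 ps.
have hqs : sorted ltn qs by exact: drop_sorted.
have nthge i : (i < n)%N -> (i <= nth 0%N ps i)%N.
  elim: i => // i IH hi; apply: (leq_ltn_trans (IH (ltnW hi))).
  by apply: (sorted_ltn_nth ltn_trans) => //; rewrite inE // ltnW.
have hge k : k \in qs -> (n./2 <= k)%N.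
  move=> hk; have : (index k qs < size qs)%N by rewrite index_mem.
  rewrite -{2}(nth_index 0%N hk) size_drop -/n nth_drop => hi.
  have h : (n./2 + index k qs < n)%N by rewrite -ltn_subRL.
  by rewrite (leq_trans _ (nthge _ h)) // leq_addr.
have en := odd_double_half n.
have sq : size qs = (n - n./2)%N by rewrite size_drop.
have hsz : (size qs <= succn n./2)%N by rewrite sq; case: (odd n) en; lia.
have := tn_l1_lower (tau := succn) hx hqs hge hsz.
have h1 : w * (size qs)%:R <= \sum_(k <- qs) `|x k|.
  have : forall k, k \in qs -> w <= `|x k| by move=> k /mem_drop; exact: hw.
  elim: (qs) => [|k r IH] hr; first by rewrite mulr0 big_nil.
  rewrite big_cons /= -natr1 mulrDr mulr1 addrC; apply: lerD.
    by apply: hr; rewrite mem_head.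
  by apply: IH => l hl; apply: hr; rewrite inE hl orbT.
have h2 : n%:R <= 2 * (size qs)%:R :> R.
  by rewrite -natrM ler_nat sq; case: (odd n) en; lia.
have := ler_wpM2l w0 h2; lra.
Qed.

End SpaceFacts.

(** * Rosenthal's inequality for sparse signs *)

Section Rosenthal.
Variable R : realType.
Implicit Types (del x y a b : nat -> R) (p q : R).

(* Outcomes of d independent three-valued variables xi_0, ..., xi_(d-1), where
   xi_i is 0 with probability 1 - del i, and 1 or -1 with probability del i / 2. *)
Fixpoint outcome (d : nat) : finType :=
  if d is d'.+1 then (outcome d' * 'I_3)%type : finType else unit : finType.

Definition coin_val (c : 'I_3) : R :=
  if val c is k.+1 then (if k is 0%N then 1 else -1) else 0.

Definition coin_prob (e : R) (c : 'I_3) : R := if val c is k.+1 then e / 2 else 1 - e.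

Fixpoint prob del d : outcome d -> R :=
  if d is d'.+1 return outcome d -> R
  then fun w => prob del w.1 * coin_prob (del d') w.2 else fun _ => 1.

Fixpoint xi d : outcome d -> nat -> R :=
  if d is d'.+1 return outcome d -> nat -> R
  then fun w i => if i == d' then coin_val w.2 else xi w.1 i else fun _ _ => 0.

Definition rsum d x (w : outcome d) : R := \sum_(i < d) x i * xi w i.

Definition expect del d (F : outcome d -> R) : R := \sum_w prob del w * F w.

Lemma coin_sum (e : R) (G : R -> R) :
  \sum_c coin_prob e c * G (coin_val c) = (1 - e) * G 0 + e / 2 * (G 1 + G (-1)).
Proof.
rewrite !big_ord_recl big_ord0 /= /coin_prob /coin_val /=.
by rewrite addr0 mulrDr.
Qed.

Lemma rsumS d x (w : outcome d.+1) : rsum x w = rsum x w.1 + x d * coin_val w.2.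
Proof.
rewrite /rsum big_ord_recr /= eqxx; congr (_ + _); apply: eq_bigr => i _.
by rewrite ltn_eqF.
Qed.

(** Two sums are carried along because the covariance formula needs their product; one sum suffices
    for the moments. *)
Lemma expectS del d x y (G : R -> R -> R) :
  expect del (fun w : outcome d.+1 => G (rsum x w) (rsum y w)) =
  expect del (fun w : outcome d => (1 - del d) * G (rsum x w) (rsum y w) +
    del d / 2 * (G (rsum x w + x d) (rsum y w + y d) + G (rsum x w - x d) (rsum y w - y d))).
Proof.
rewrite /expect /=.
transitivity (\sum_(w : outcome d) \sum_(c : 'I_3) prob del w * coin_prob (del d) c *
   G (rsum x w + x d * coin_val c) (rsum y w + y d * coin_val c)).
  rewrite pair_bigA /=; apply: eq_bigr => -[w c] _ /=.
  by rewrite !rsumS.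
apply: eq_bigr => w _.
under eq_bigr do rewrite -mulrA.
rewrite -mulr_sumr; congr (_ * _).
rewrite (coin_sum (del d) (fun v => G (rsum x w + x d * v) (rsum y w + y d * v))).
by rewrite !mulr0 !addr0 !mulr1 !mulrN1.
Qed.

Lemma expectS1 del d x (G : R -> R) :
  expect del (fun w : outcome d.+1 => G (rsum x w)) =
  expect del (fun w : outcome d => (1 - del d) * G (rsum x w) +
    del d / 2 * (G (rsum x w + x d) + G (rsum x w - x d))).
Proof. exact: (expectS del _ x x (fun u _ => G u)). Qed.

Lemma expect0 del (F : outcome 0 -> R) : expect del F = F tt.
Proof.
rewrite /expect (bigD1 tt) //= mul1r big1 ?addr0 //; by case.
Qed.

Lemma rsum0 x (w : outcome 0) : rsum x w = 0.
Proof. by rewrite /rsum big_ord0. Qed.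

Lemma expectD del d (F G : outcome d -> R) :
  expect del (fun w => F w + G w) = expect del F + expect del G.
Proof. by rewrite /expect -big_split /=; apply: eq_bigr => w _; rewrite mulrDr. Qed.

Lemma expectZ del d c (F : outcome d -> R) :
  expect del (fun w => c * F w) = c * expect del F.
Proof. by rewrite /expect mulr_sumr; apply: eq_bigr => w _; rewrite mulrCA. Qed.

Lemma expect1 del d : expect del (fun _ : outcome d => 1) = 1.
Proof.
elim: d => [|d IH]; first by rewrite expect0.
rewrite (expectS1 del _ (fun _ => 0) (fun _ => 1)) -[RHS]IH; congr expect.
by apply/funext => w; field.
Qed.

Lemma expect_rsumM del d x y :
  expect del (fun w : outcome d => rsum x w * rsum y w) = \sum_(i < d) del i * (x i * y i).
Proof.
elim: d => [|d IH]; first by rewrite expect0 rsum0 mul0r big_ord0.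
rewrite (expectS del _ x y (fun u v => u * v)) big_ord_recr /= -IH.
have -> : del d * (x d * y d) = expect del (fun _ : outcome d => del d * (x d * y d) * 1).
  by rewrite expectZ expect1 mulr1.
rewrite -expectD; congr expect.
by apply/funext => w; field.
Qed.

Variable del : nat -> R.
Hypothesis del01 : forall i, 0 < del i <= 1.

Let del0 i : 0 <= del i. Proof. by case/andP: (del01 i) => /ltW. Qed.
Let del1 i : del i <= 1. Proof. by case/andP: (del01 i). Qed.

Lemma prob_ge0 d (w : outcome d) : 0 <= prob del w.
Proof.
elim: d w => [|d IH] w //=; apply: mulr_ge0 => //; rewrite /coin_prob.
by case: (val w.2) => [|k]; [rewrite subr_ge0|rewrite divr_ge0].
Qed.

Lemma expect_le d (F G : outcome d -> R) : (forall w, F w <= G w) -> expect del F <= expect del G.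
Proof. by move=> h; apply: ler_sum => w _; apply: ler_wpM2l => //; exact: prob_ge0. Qed.

Lemma expect_ge0 d (F : outcome d -> R) : (forall w, 0 <= F w) -> 0 <= expect del F.
Proof. by move=> h; apply: sumr_ge0 => w _; apply: mulr_ge0 => //; exact: prob_ge0. Qed.

Lemma expect_jensen d (F : outcome d -> R) r : 0 < r <= 1 -> (forall w, 0 <= F w) ->
  expect del (fun w => F w `^ r) <= expect del F `^ r.
Proof.
move=> hr F0; apply: powR_jensen => //; first by move=> w; exact: prob_ge0.
by have := expect1 del d; rewrite /expect; under eq_bigr do rewrite mulr1.
Qed.

Lemma moment_le2_lp d x p : 0 < p <= 2 ->
  expect del (fun w : outcome d => `|rsum x w| `^ p) <= \sum_(i < d) del i * `|x i| `^ p.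
Proof.
move=> hp; have p0 : p != 0 by case/andP: hp => h _; rewrite gt_eqF.
elim: d => [|d IH]; first by rewrite expect0 rsum0 big_ord0 normr0 powR0.
rewrite (expectS1 del _ x (fun u => `|u| `^ p)) big_ord_recr /=.
apply: (@le_trans _ _ (expect del (fun w : outcome d => `|rsum x w| `^ p + del d * `|x d| `^ p * 1))).
  apply: expect_le => w; have := clarkson_two_point (rsum x w) (x d) hp.
  move=> /(ler_wpM2l (del0 d)); lra.
by rewrite expectD expectZ expect1 mulr1 lerD2r.
Qed.

Lemma moment_le2_l2 d x p : 0 < p <= 2 ->
  expect del (fun w : outcome d => `|rsum x w| `^ p) <=
  (\sum_(i < d) del i * x i ^+ 2) `^ (p / 2).
Proof.
move=> /andP[p0 p2].
have hr : 0 < p / 2 <= 1 by rewrite divr_gt0 //= ler_pdivrMr // mul1r.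
have -> : \sum_(i < d) del i * x i ^+ 2 = expect del (fun w : outcome d => rsum x w ^+ 2).
  by rewrite (expect_rsumM del d x x).
apply: le_trans (expect_jensen hr _); last by move=> w; exact: sqr_ge0.
by apply: expect_le => w; rewrite powR_sqr.
Qed.

Lemma moment_mono d x p : 1 <= p ->
  expect del (fun w : outcome d => `|rsum x w| `^ p) <=
  expect del (fun w : outcome d.+1 => `|rsum x w| `^ p).
Proof.
move=> p1; rewrite (expectS1 del _ x (fun u => `|u| `^ p)).
apply: expect_le => w; have := powR_midpoint (rsum x w) (x d) p1.
move=> /(ler_wpM2l (del0 d)); lra.
Qed.

(* Telescoping over the variables bounds M = E|S|^p by C (A + B M^(1-2/p)),
   because M increases with the number of variables. *)
Lemma rosenthal_from_two_point p C d x : 2 < p -> 0 <= C ->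
  (forall s t, (`|s + t| `^ p + `|s - t| `^ p) / 2 <=
     `|s| `^ p + C * (`|s| `^ (p - 2) * t ^+ 2 + `|t| `^ p)) ->
  expect del (fun w : outcome d => `|rsum x w| `^ p) <=
  (2 * C + (2 * C) `^ (p / 2)) *
  (\sum_(i < d) del i * `|x i| `^ p + (\sum_(i < d) del i * x i ^+ 2) `^ (p / 2)).
Proof.
move=> p2 C0 hC; have p0 : 0 < p by lra.
pose M k := expect del (fun w : outcome k => `|rsum x w| `^ p).
have M0 k : 0 <= M k by apply: expect_ge0 => w; exact: powR_ge0.
pose r := (p - 2) / p.
have hr : 0 < r <= 1 by rewrite divr_gt0 ?subr_gt0 //= ler_pdivrMr // mul1r; lra.
pose L := M d `^ r.
have step k : (k <= d)%N ->
    M k <= C * (L * \sum_(i < k) del i * x i ^+ 2 + \sum_(i < k) del i * `|x i| `^ p).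
  elim: k => [|k IH] hk.
    by rewrite /M expect0 rsum0 !big_ord0 normr0 powR0 ?gt_eqF // mulr0 addr0 mulr0.
  have hL : expect del (fun w : outcome k => `|rsum x w| `^ (p - 2)) <= L.
    apply: (@le_trans _ _ (M k `^ r)).
      apply: le_trans (expect_jensen hr _); last by move=> w; exact: powR_ge0.
      by apply: expect_le => w; rewrite -powRrM /r mulrC divfK ?gt_eqF.
    apply: le_powR => //; first by case/andP: hr => /ltW.
    have hkd : (k <= d)%N by exact: ltnW.
    have p1 : 1 <= p by lra.
    have : {homo M : i j / (i <= j)%N >-> i <= j}.
      apply: homo_leq => //; [exact: le_trans|move=> i; exact: moment_mono].
    by apply.
  apply: (@le_trans _ _ (M k + C * (del k * x k ^+ 2) * L + C * (del k * `|x k| `^ p))).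
    rewrite {1}/M (expectS1 del _ x (fun u => `|u| `^ p)).
    apply: (@le_trans _ _ (expect del (fun w : outcome k => `|rsum x w| `^ p +
        (C * (del k * x k ^+ 2) * `|rsum x w| `^ (p - 2) + C * (del k * `|x k| `^ p) * 1)))).
      apply: expect_le => w; have := hC (rsum x w) (x k).
      move=> /(ler_wpM2l (del0 k)); lra.
    rewrite !expectD !expectZ expect1 mulr1 addrA !lerD2r lerD2l.
    apply: ler_wpM2l => //; rewrite mulr_ge0 // mulr_ge0 ?sqr_ge0 //.
  rewrite !big_ord_recr /=; have := IH (ltnW hk); lra.
set A := \sum_(i < d) del i * `|x i| `^ p; set B := \sum_(i < d) del i * x i ^+ 2.
have A0 : 0 <= A by rewrite sumr_ge0 // => i _; rewrite mulr_ge0 ?powR_ge0.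
have B0 : 0 <= B by rewrite sumr_ge0 // => i _; rewrite mulr_ge0 ?sqr_ge0.
have hM := step d (leqnn d); rewrite -/A -/B -/(M d) in hM *.
have Bp0 := powR_ge0 B (p / 2); have Cp0 := powR_ge0 (2 * C) (p / 2).
(* One of the two terms carries at least half of M. If it is the one with L = M^(1-2/p), division by
   L bounds M^(2/p) by 2 C B. *)
case: (leP (M d) (2 * (C * A))) => h.
  have := mulr_ge0 C0 Bp0; have := mulr_ge0 Cp0 A0; have := mulr_ge0 Cp0 Bp0; lra.
have h1 : M d <= 2 * C * B * L by lra.
have Mp : 0 < M d by have := mulr_ge0 C0 A0; lra.
have e1 : M d = M d `^ (2 / p) * L.
  rewrite /L -powRD; last by apply/implyP => _; rewrite gt_eqF.
  have -> : 2 / p + r = 1 by rewrite /r; field; rewrite gt_eqF.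
  by rewrite powRr1 // ltW.
have Lp : 0 < L by exact: powR_gt0.
have h2 : M d `^ (2 / p) <= 2 * C * B by rewrite -(ler_pM2r Lp) -e1.
have h3 : M d <= (2 * C) `^ (p / 2) * B `^ (p / 2).
  rewrite -powRM //; last by rewrite mulr_ge0.
  have -> : M d = (M d `^ (2 / p)) `^ (p / 2).
    rewrite -powRrM; have -> : 2 / p * (p / 2) = 1 by field; rewrite gt_eqF.
    by rewrite powRr1 // ltW.
  apply: le_powR => //; [lra|exact: powR_ge0].
have := mulr_ge0 Cp0 A0; have := mulr_ge0 C0 A0; have := mulr_ge0 C0 Bp0; lra.
Qed.

End Rosenthal.

Lemma rosenthal (R : realType) (p : R) : 2 < p -> exists2 C, 0 <= C &
  forall del, (forall i, 0 < del i <= 1) -> forall d x,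
  expect del (fun w : outcome d => `|rsum x w| `^ p) <=
  C * (\sum_(i < d) del i * `|x i| `^ p + (\sum_(i < d) del i * x i ^+ 2) `^ (p / 2)).
Proof.
move=> p2; have [C C0 hC] := rosenthal_two_point (ltW p2).
exists (2 * C + (2 * C) `^ (p / 2)); first by rewrite addr_ge0 ?powR_ge0 // mulr_ge0.
by move=> del hdel d x; exact: rosenthal_from_two_point.
Qed.

(** * Hölder's inequality and duality of l_p-norms *)

Section Holder.
Variable R : realType.
Implicit Types p q : R.

Definition powsum p (I : finType) (f : I -> R) : R := \sum_i `|f i| `^ p.

Definition conjugate p q := [/\ 1 < p, 1 < q & p^-1 + q^-1 = 1].

Lemma conjugate_sym p q : conjugate p q -> conjugate q p.
Proof. by case=> h1 h2 h3; split => //; rewrite addrC. Qed.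

Lemma conjugate_mul p q : conjugate p q -> (p - 1) * q = p.
Proof.
move=> [h1 h2 h3]; have : p * q * (p^-1 + q^-1) = p * q by rewrite h3 mulr1.
have -> : p * q * (p^-1 + q^-1) = q + p by field; rewrite !gt_eqF //; lra.
lra.
Qed.

Lemma powsum_ge0 p (I : finType) (f : I -> R) : 0 <= powsum p f.
Proof. by apply: sumr_ge0 => i _; exact: powR_ge0. Qed.

Lemma powsum_eq0 p (I : finType) (f : I -> R) : p != 0 -> powsum p f = 0 -> forall i, f i = 0.
Proof.
move=> p0 h i; have := psumr_eq0P (fun i _ => powR_ge0 `|f i| p) h.
move=> /(_ i isT) /eqP; rewrite powR_eq0 => /andP[]; rewrite normr_eq0 => /eqP //.
Qed.

Lemma holder p q (I : finType) (f g : I -> R) : conjugate p q ->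
  \sum_i f i * g i <= powsum p f `^ p^-1 * powsum q g `^ q^-1.
Proof.
move=> [p1 q1 pq]; have p0 : 0 < p by lra.
have q0 : 0 < q by lra.
have := powsum_ge0 p f; have := powsum_ge0 q g.
have := @powsum_eq0 p I f; have := @powsum_eq0 q I g.
move eA : (powsum p f) => A; move eB : (powsum q g) => B zB zA B0 A0.
case: (eqVneq A 0) => [hA|hA].
  rewrite big1 ?mulr_ge0 ?powR_ge0 // => i _.
  by rewrite zA ?mul0r // gt_eqF.
case: (eqVneq B 0) => [hB|hB].
  rewrite big1 ?mulr_ge0 ?powR_ge0 // => i _.
  by rewrite zB ?mulr0 // gt_eqF.
have Ap : 0 < A `^ p^-1 by rewrite powR_gt0 // lt_def hA.
have Bp : 0 < B `^ q^-1 by rewrite powR_gt0 // lt_def hB.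
have key i : f i * g i / (A `^ p^-1 * B `^ q^-1) <= `|f i| `^ p / A / p + `|g i| `^ q / B / q.
  have a0 : 0 <= `|f i| / A `^ p^-1 by rewrite divr_ge0 // ltW.
  have b0 : 0 <= `|g i| / B `^ q^-1 by rewrite divr_ge0 // ltW.
  have := conjugate_powR a0 b0 p0 q0 pq.
  have Ai : 0 <= (A `^ p^-1)^-1 by rewrite invr_ge0 ltW.
  have Bi : 0 <= (B `^ q^-1)^-1 by rewrite invr_ge0 ltW.
  rewrite (powRM p (normr_ge0 (f i)) Ai) (powRM q (normr_ge0 (g i)) Bi).
  have e r C : 0 < r -> 0 <= C -> ((C `^ r^-1)^-1) `^ r = C^-1.
    move=> r0 C0; rewrite -powR_inv1 ?powR_ge0 // -powRrM mulN1r powRN.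
    by rewrite powRVK.
  rewrite !e //; apply: le_trans.
  have -> : `|f i| / A `^ p^-1 * (`|g i| / B `^ q^-1) = `|f i * g i| / (A `^ p^-1 * B `^ q^-1).
    by rewrite normrM; field; rewrite !gt_eqF.
  by rewrite ler_pM2r ?ler_norm // invr_gt0 mulr_gt0.
rewrite -[leRHS]mul1r -ler_pdivrMr ?mulr_gt0 // mulr_suml.
apply: (le_trans (ler_sum _ (fun i _ => key i))).
rewrite big_split /= -!mulr_suml -/(powsum p f) -/(powsum q g) eA eB.
by rewrite !mulfV // !mul1r pq.
Qed.

(** The functional at which Hölder's inequality for f is an equality. *)
Definition dualv p (I : Type) (f : I -> R) (i : I) : R := Num.sg (f i) * `|f i| `^ (p - 1).

Lemma dualvE p I (f : I -> R) i : 0 < p -> f i * dualv p f i = `|f i| `^ p.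
Proof.
move=> p0; rewrite /dualv mulrA mulrC; case: (eqVneq (f i) 0) => [->|h].
  by rewrite sgr0 !(mulr0, mul0r) normr0 powR0 // gt_eqF.
by rewrite [f i * _]mulrC -normrEsg mulrC mulr_powRB1.
Qed.

Lemma norm_dualv p q I (f : I -> R) i : conjugate p q -> `|dualv p f i| `^ q = `|f i| `^ p.
Proof.
move=> hpq; have [p1 q1 _] := hpq; rewrite /dualv normrM normr_sg.
case: (eqVneq (f i) 0) => [->|h]; first by rewrite mul0r normr0 !powR0 // gt_eqF //; lra.
by rewrite mul1r ger0_norm ?powR_ge0 // -powRrM conjugate_mul.
Qed.

(** Duality arguments bound a p-th power X by a product that contains X^(1/q) again; cancelling this
    factor leaves X^(1/p), and p/q = p - 1 gives the exponent of K. *)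
Lemma self_bound p q X G K : conjugate p q -> 0 <= X -> 0 <= G -> 0 <= K ->
  X <= G `^ p^-1 * (K * X) `^ q^-1 -> X <= G * K `^ (p - 1).
Proof.
move=> hpq X0 G0 K0; have [p1 q1 pq] := hpq; have p0 : 0 < p by lra.
case: (eqVneq X 0) => [->|hX] h; first by rewrite mulr_ge0 ?powR_ge0.
have Xp : 0 < X by rewrite lt_def hX.
have Xq : 0 < X `^ q^-1 by exact: powR_gt0.
have h1 : X `^ p^-1 <= G `^ p^-1 * K `^ q^-1.
  rewrite -(ler_pM2r Xq) -powRD ?pq ?powRr1 //; last by rewrite hX implybT.
  by move: h; rewrite powRM // mulrA.
have := le_powR (ltW p0) (powR_ge0 _ _) h1.
rewrite powRM ?powR_ge0 // !powRVK // -powRrM.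
have -> // : q^-1 * p = p - 1.
by rewrite -[X in q^-1 * X](conjugate_mul hpq) mulrC mulfK // gt_eqF //; lra.
Qed.

End Holder.

(** * The span of sparse signs inside l_p and its projections *)

Section RosenthalOperators.
Variable R : realType.
Variable del : nat -> R.
Hypothesis del01 : forall i, 0 < del i <= 1.
Variable d : nat.
Implicit Types (a b : nat -> R) (p q : R) (g : outcome d -> R) (D : pred nat).

Let del_gt0 i : 0 < del i. Proof. by case/andP: (del01 i). Qed.

(** The factor prob^(1/p) identifies L_p of the outcomes with l_p on the outcomes, and del_i^(-1/p)
    normalizes the i-th variable, since E|xi_i|^p = del_i. *)
Definition rosJ p a (w : outcome d) : R :=
  prob del w `^ p^-1 * rsum (fun i => a i * del i `^ (- p^-1)) w.

(** The adjoint of [rosJ p]. Taken with the conjugate exponent it is a left inverse of [rosJ],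
    because the variables are orthogonal with E xi_i^2 = del_i; so [rosJ p] after [rosQ q] projects
    onto the span of the variables. *)
Definition rosQ p g (i : nat) : R :=
  \sum_w g w * (prob del w `^ p^-1 * (del i `^ (- p^-1) * xi R w i)).

Definition seqsum p a : R := \sum_(i < d) `|a i| `^ p.

Definition seqdot a b : R := \sum_(i < d) a i * b i.

Lemma rosQ_dual p g b : \sum_w g w * rosJ p b w = seqdot (rosQ p g) b.
Proof.
rewrite /seqdot /rosQ.
under [RHS]eq_bigr do rewrite mulr_suml.
rewrite exchange_big /=; apply: eq_bigr => w _.
rewrite /rosJ /rsum !mulr_sumr; apply: eq_bigr => i _; ring.
Qed.

Lemma prob_pow_conj p q (w : outcome d) : conjugate p q ->
  prob del w `^ p^-1 * prob del w `^ q^-1 = prob del w.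
Proof.
move=> [p1 q1 pq]; have w0 := prob_ge0 del01 w.
case: (eqVneq (prob del w) 0) => [->|h]; first by rewrite powR0 ?mul0r // invr_eq0 gt_eqF //; lra.
by rewrite -powRD ?pq ?powRr1 // h implybT.
Qed.

Lemma rosJ_dot p q a b : conjugate p q ->
  \sum_w rosJ p a w * rosJ q b w = seqdot a b.
Proof.
move=> hpq; have [p1 q1 pq] := hpq.
transitivity (expect del (fun w : outcome d => rsum (fun i => a i * del i `^ (- p^-1)) w
   * rsum (fun i => b i * del i `^ (- q^-1)) w)).
  apply: eq_bigr => w _; rewrite /rosJ mulrACA; congr (_ * _).
  exact: prob_pow_conj.
rewrite expect_rsumM; apply: eq_bigr => i _.
rewrite mulrACA -powRD; last by rewrite (gt_eqF (del_gt0 _)) implybT.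
by rewrite -opprD pq powR_inv1 ?(ltW (del_gt0 i)) // mulrCA mulfV ?mulr1 ?(gt_eqF (del_gt0 i)).
Qed.

Lemma rosQJ p q a i : conjugate p q -> (i < d)%N -> rosQ q (rosJ p a) i = a i.
Proof.
move=> hpq hi.
have e b : seqdot b (fun j => (j == i)%:R) = b i.
  rewrite /seqdot (bigD1 (Ordinal hi)) //= eqxx mulr1 big1 ?addr0 // => j.
  by rewrite -val_eqE /= => /negbTE ->; rewrite mulr0.
by rewrite -[LHS]e -rosQ_dual (rosJ_dot _ _ hpq) e.
Qed.

Lemma powsum_rosJ p a : 0 < p ->
  powsum p (rosJ p a) =
  expect del (fun w : outcome d => `|rsum (fun i => a i * del i `^ (- p^-1)) w| `^ p).
Proof.
move=> p0; apply: eq_bigr => w _; rewrite /rosJ normrM powRM //.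
by rewrite (ger0_norm (powR_ge0 _ _)) powRVK // prob_ge0.
Qed.

Lemma rosJ_lp_term p a i : 0 < p -> del i * `|a i * del i `^ (- p^-1)| `^ p = `|a i| `^ p.
Proof.
move=> p0; rewrite normrM powRM // (ger0_norm (powR_ge0 _ _)) -powRrM.
by rewrite mulNr mulVf ?gt_eqF // powR_inv1 ?(ltW (del_gt0 i)) // mulrCA mulfV ?mulr1 ?(gt_eqF (del_gt0 i)).
Qed.

Lemma rosJ_l2_term p a i : 
  del i * (a i * del i `^ (- p^-1)) ^+ 2 = a i ^+ 2 * del i `^ (1 - 2 / p).
Proof.
rewrite exprMn -(powR_mulrn 2 (powR_ge0 _ _)) -powRrM.
rewrite mulrCA; congr (_ * _).
rewrite -{1}(powRr1 (ltW (del_gt0 i))) -powRD; last by rewrite (gt_eqF (del_gt0 _)) implybT.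
by congr (_ `^ _); ring.
Qed.

(** The second moment of the normalized sum: del_i times the square of del_i^(-1/p). *)
Definition l2weight p a : R := \sum_(i < d) a i ^+ 2 * del i `^ (1 - 2 / p).

Lemma l2weight_ge0 p a : 0 <= l2weight p a.
Proof. by apply: sumr_ge0 => i _; rewrite mulr_ge0 ?sqr_ge0 ?powR_ge0. Qed.

Lemma seqsum_ge0 p a : 0 <= seqsum p a.
Proof. by apply: sumr_ge0 => i _; exact: powR_ge0. Qed.

Lemma rosJ_small_lp p a : 0 < p <= 2 -> powsum p (rosJ p a) <= seqsum p a.
Proof.
move=> hp; have /andP[p0 _] := hp; rewrite powsum_rosJ //.
apply: le_trans (moment_le2_lp del01 _ _ hp) _.
by rewrite /seqsum; under eq_bigr do rewrite rosJ_lp_term //.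
Qed.

Lemma rosJ_small_l2 p a : 0 < p <= 2 -> powsum p (rosJ p a) <= l2weight p a `^ (p / 2).
Proof.
move=> hp; have /andP[p0 _] := hp; rewrite powsum_rosJ //.
apply: le_trans (moment_le2_l2 del01 _ _ hp) _.
by under eq_bigr do rewrite rosJ_l2_term //.
Qed.

Definition rosenthal_const p C := forall x,
  expect del (fun w : outcome d => `|rsum x w| `^ p) <=
  C * (\sum_(i < d) del i * `|x i| `^ p + (\sum_(i < d) del i * x i ^+ 2) `^ (p / 2)).

Lemma rosJ_large p C a : 0 < p -> rosenthal_const p C ->
  powsum p (rosJ p a) <= C * (seqsum p a + l2weight p a `^ (p / 2)).
Proof.
move=> p0 hC; rewrite powsum_rosJ //; apply: (le_trans (hC _)).
under eq_bigr do rewrite rosJ_lp_term //.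
by under [X in _ + X `^ _]eq_bigr do rewrite rosJ_l2_term //.
Qed.

Lemma conjugate_small p q : conjugate p q -> 2 <= p -> 0 < q <= 2.
Proof.
move=> hpq p2; have [p1 q1 _] := hpq; have := conjugate_mul hpq.
rewrite (lt_trans ltr01 q1) /=; nra.
Qed.

(* Both bounds for rosQ are dual to the bounds for rosJ with the conjugate exponent. *)
Lemma rosQ_lp p q g : conjugate p q -> 2 <= p -> seqsum p (rosQ q g) <= powsum p g.
Proof.
move=> hpq p2; have [p1 q1 pq] := hpq; have p0 : 0 < p by lra.
set X := seqsum p _.
suff : X <= powsum p g * 1 `^ (p - 1) by rewrite powR1 mulr1.
apply: (self_bound hpq); rewrite ?seqsum_ge0 ?powsum_ge0 // mul1r.
have eX : X = \sum_w g w * rosJ q (dualv p (rosQ q g)) w.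
  by rewrite rosQ_dual; apply: eq_bigr => i _; rewrite dualvE.
rewrite {1}eX.
apply: (le_trans (holder _ _ hpq)); apply: ler_wpM2l; first exact: powR_ge0.
apply: le_powR; rewrite ?powsum_ge0 // ?invr_ge0; first lra.
apply: (le_trans (rosJ_small_lp _ (conjugate_small hpq p2))).
rewrite le_eqVlt; apply/orP; left; apply/eqP; rewrite /X /seqsum; apply: eq_bigr => i _.
exact: norm_dualv.
Qed.

Lemma rosQ_l2 p q g : conjugate p q -> 2 <= p ->
  l2weight p (rosQ q g) `^ (p / 2) <= powsum p g.
Proof.
move=> hpq p2; have [p1 q1 pq] := hpq; have p0 : 0 < p by lra.
have q0 : 0 < q by lra.
set X := l2weight p _; have X0 : 0 <= X := l2weight_ge0 _ _.
have c22 : conjugate (2 : R) 2 by split; lra.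
(* The dual vector for the weighted l_2-norm: its pairing with [rosQ q g] is X, and since 1 - 2/q =
   -(1 - 2/p) its own weighted sum for q is X again. *)
pose b i := rosQ q g i * del i `^ (1 - 2 / p).
have eX : X = \sum_w g w * rosJ q b w.
  by rewrite rosQ_dual; apply: eq_bigr => i _; rewrite /b mulrA.
have hb : l2weight q b = X.
  apply: eq_bigr => i _; rewrite /b exprMn -mulrA; congr (_ * _).
  rewrite -(powR_mulrn 2 (powR_ge0 _ _)) -powRrM -powRD; last by rewrite (gt_eqF (del_gt0 _)) implybT.
  congr (_ `^ _); have -> : q^-1 = 1 - p^-1 by lra.
  by ring.
have h : X <= powsum p g `^ p^-1 * X `^ 2^-1.
  rewrite {1}eX; apply: (le_trans (holder _ _ hpq)); apply: ler_wpM2l; first exact: powR_ge0.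
  have := rosJ_small_l2 b (conjugate_small hpq p2); rewrite hb => h.
  have iq0 : 0 <= q^-1 by rewrite invr_ge0 ltW.
  have := le_powR iq0 (powsum_ge0 _ _) h; rewrite -powRrM.
  by have -> : q / 2 / q = 2^-1 by field; rewrite gt_eqF.
have h2 : X <= powsum p g `^ (2 / p).
  have := @self_bound R 2 2 X (powsum p g `^ (2 / p)) 1 c22 X0 (powR_ge0 _ _) ler01.
  rewrite powR1 mulr1 mul1r -powRrM; have -> : 2 / p / 2 = p^-1 by field; rewrite gt_eqF.
  exact.
have := @le_powR R (p / 2) _ _ _ X0 h2; rewrite -powRrM.
have -> : 2 / p * (p / 2) = 1 by field; rewrite gt_eqF.
by rewrite powRr1 ?powsum_ge0 //; apply; rewrite divr_ge0 // ltW.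
Qed.

Definition keep D a : nat -> R := fun i => if D i then a i else 0.

Lemma seqsum_keep D p a : 0 < p -> seqsum p (keep D a) <= seqsum p a.
Proof.
move=> p0; apply: ler_sum => i _; rewrite /keep; case: ifP => // _.
by rewrite normr0 powR0 ?gt_eqF // powR_ge0.
Qed.

Lemma l2weight_keep D p a : l2weight p (keep D a) <= l2weight p a.
Proof.
apply: ler_sum => i _; rewrite /keep; case: ifP => // _.
by rewrite expr0n /= mul0r mulr_ge0 ?sqr_ge0 ?powR_ge0.
Qed.

Lemma ros_proj_large p q C D g : conjugate p q -> 2 < p -> 0 <= C -> rosenthal_const p C ->
  powsum p (rosJ p (keep D (rosQ q g))) <= 2 * C * powsum p g.
Proof.
move=> hpq p2 C0 hC; have p0 : 0 < p by lra.
apply: (le_trans (rosJ_large _ p0 hC)).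
have h1 := le_trans (seqsum_keep D (rosQ q g) p0) (rosQ_lp g hpq (ltW p2)).
have h2 : l2weight p (keep D (rosQ q g)) `^ (p / 2) <= powsum p g.
  apply: le_trans (rosQ_l2 g hpq (ltW p2)); apply: le_powR.
  - by rewrite divr_ge0 // ltW.
  - exact: l2weight_ge0.
  - exact: l2weight_keep.
have := ler_wpM2l C0 (lerD h1 h2); lra.
Qed.

Lemma seqdot_keep D a b : seqdot (keep D a) b = seqdot a (keep D b).
Proof.
by apply: eq_bigr => i _; rewrite /keep; case: ifP; rewrite ?mulr0 ?mul0r.
Qed.

Lemma seqdotC a b : seqdot a b = seqdot b a.
Proof. by apply: eq_bigr => i _; rewrite mulrC. Qed.

(** The adjoint of this projection is the one with p and q exchanged, which falls under the case of
    a large exponent; [self_bound] turns the constant 2C into its power p - 1. *)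
Lemma ros_proj_small p q C D g : conjugate p q -> 2 < q -> 0 <= C -> rosenthal_const q C ->
  powsum p (rosJ p (keep D (rosQ q g))) <= (2 * C) `^ (p - 1) * powsum p g.
Proof.
move=> hpq q2 C0 hC; have [p1 q1 pq] := hpq; have p0 : 0 < p by lra.
rewrite mulrC; apply: (self_bound hpq); rewrite ?powsum_ge0 ?mulr_ge0 //.
set u := rosJ p _; set X := powsum p u.
have eX : X = \sum_w u w * dualv p u w by apply: eq_bigr => w _; rewrite dualvE.
pose h := dualv p u.
rewrite {1}eX; have -> : \sum_w u w * dualv p u w = \sum_w g w * rosJ q (keep D (rosQ p h)) w.
  rewrite rosQ_dual -seqdot_keep seqdotC -rosQ_dual.
  by apply: eq_bigr => w _; rewrite mulrC.
apply: (le_trans (holder _ _ hpq)); apply: ler_wpM2l; first exact: powR_ge0.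
apply: le_powR; rewrite ?powsum_ge0 // ?invr_ge0; first lra.
apply: (le_trans (ros_proj_large _ _ (conjugate_sym hpq) q2 C0 hC)).
apply: ler_wpM2l; first by rewrite mulr_ge0.
rewrite le_eqVlt; apply/orP; left; apply/eqP; rewrite /X /powsum; apply: eq_bigr => i _.
exact: norm_dualv.
Qed.

End RosenthalOperators.

(** * Democracy and distortion of the Rosenthal norm *)

Section RosenthalSpace.
Variable R : realType.
Implicit Types (del a b : nat -> R) (p q t h : R) (D : pred nat) (d : nat).

Definition count_lt d D : nat := \sum_(i < d) D i.

Definition rosnorm del d p a : R := powsum p (@rosJ R del d p a).

(** When index d joins m earlier members of D, then m <= d, so its weight is at most 1/(m+1). The
    increment (m+1)^(-r) is controlled by the tangent of the concave power 1 - r at m + 1. With r =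
    1 - 2/p this makes the l_2 part democratic. *)
Lemma power_sum_le del d D r : (forall i, 0 < del i <= 1) ->
  (forall i, del i <= i.+1%:R^-1) -> 0 < r < 1 ->
  \sum_(i < d) (D i)%:R * del i `^ r <= (1 - r)^-1 * (count_lt d D)%:R `^ (1 - r).
Proof.
move=> hdel hdel2 /andP[r0 r1]; have s0 : 0 < 1 - r by lra.
have si : 0 < (1 - r)^-1 by rewrite invr_gt0.
elim: d => [|d IH].
  by rewrite big_ord0 mulr_ge0 ?powR_ge0 // ltW.
rewrite big_ord_recr /= /count_lt big_ord_recr /= -/(count_lt d D).
case: (D d) => /=; last by rewrite mul0r addr0 addn0.
rewrite mul1r addn1; set m := count_lt d D in IH *.
have hm : (m <= d)%N.
  rewrite /m /count_lt -[X in (_ <= X)%N](card_ord d) -sum1_card.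
  by apply: leq_sum => i _; case: (D i).
apply: (le_trans (lerD IH (lexx _))).
have M0 : 0 < m.+1%:R :> R by [].
have h1 : del d `^ r <= m.+1%:R `^ (- r).
  rewrite powRN -powR_inv1 ?powR_ge0 // -powRrM mulrC powRrM powR_inv1 //.
  apply: le_powR; [exact: ltW|by case/andP: (hdel d) => /ltW|].
  by apply: (le_trans (hdel2 d)); rewrite lef_pV2 ?posrE // ler_nat.
have h2 : m%:R `^ (1 - r) + (1 - r) * m.+1%:R `^ (- r) <= m.+1%:R `^ (1 - r) :> R.
  have hr : 0 < 1 - r <= 1 by lra.
  have := powR_tangent hr M0 (ler0n R m).
  have -> : m.+1%:R `^ (1 - r) / m.+1%:R = m.+1%:R `^ (- r) :> R.
    rewrite -[X in _ / X](powRr1 (ltW M0)) -powRN -powRD; last by rewrite (gt_eqF M0) implybT.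
    by congr (_ `^ _); ring.
  have -> : m.+1%:R `^ (1 - r) = m.+1%:R `^ (- r) * m.+1%:R :> R.
    rewrite -[X in _ * X](powRr1 (ltW M0)) -powRD; last by rewrite (gt_eqF M0) implybT.
    by congr (_ `^ _); ring.
  by rewrite -[m.+1%:R]natr1; lra.
have h3 : (1 - r)^-1 * (m%:R `^ (1 - r) + (1 - r) * m.+1%:R `^ (- r)) =
  (1 - r)^-1 * m%:R `^ (1 - r) + m.+1%:R `^ (- r) by field; rewrite gt_eqF.
have := ler_wpM2l (ltW si) h2; rewrite h3; lra.
Qed.

Lemma count_ltE d D : \sum_(i < d) (D i)%:R = (count_lt d D)%:R :> R.
Proof. by rewrite /count_lt natr_sum. Qed.

Definition bounded_on D t a := forall i, `|a i| <= t * (D i)%:R.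

Lemma seqsum_bounded_on d p D t a : 0 < p -> 0 <= t -> bounded_on D t a ->
  seqsum d p a <= t `^ p * (count_lt d D)%:R.
Proof.
move=> p0 t0 ha; rewrite -count_ltE mulr_sumr; apply: ler_sum => i _.
have := le_powR (ltW p0) (normr_ge0 _) (ha i); rewrite powRM //.
by case: (D i) => /=; rewrite ?powR1 ?powR0 // gt_eqF.
Qed.

Section Large.
Variables (p q C : R) (hpq : conjugate p q) (p2 : 2 < p) (C0 : 0 <= C).
Variables (del : nat -> R) (d : nat).
Hypothesis del01 : forall i, 0 < del i <= 1.
Hypothesis hC : rosenthal_const del d p C.

Let p0 : 0 < p. Proof. exact: lt_trans p2. Qed.

Lemma rosnorm_ge_seqsum a : seqsum d p a <= rosnorm del d p a.
Proof.
apply: le_trans (rosQ_lp del01 (rosJ del p a) hpq (ltW p2)).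
rewrite le_eqVlt; apply/orP; left; apply/eqP; apply: eq_bigr => i _.
by rewrite (rosQJ del01 a hpq).
Qed.

Lemma rosnorm_ge_l2weight a : l2weight del d p a `^ (p / 2) <= rosnorm del d p a.
Proof.
apply: le_trans (rosQ_l2 del01 (rosJ del p a) hpq (ltW p2)).
rewrite le_eqVlt; apply/orP; left; apply/eqP; congr (_ `^ _); apply: eq_bigr => i _.
by rewrite (rosQJ del01 a hpq).
Qed.

Lemma rosnorm_upper_large a D t : (forall i, del i <= i.+1%:R^-1) -> 0 <= t ->
  bounded_on D t a ->
  rosnorm del d p a <= C * (1 + (p / 2) `^ (p / 2)) * (t `^ p * (count_lt d D)%:R).
Proof.
move=> hdel2 t0 ha; apply: (le_trans (rosJ_large del01 _ p0 hC)).
rewrite -mulrA; apply: ler_wpM2l => //; rewrite mulrDl mul1r; apply: lerD.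
  exact: seqsum_bounded_on.
have hr : 0 < 1 - 2 / p < 1.
  by rewrite subr_gt0 ltr_pdivrMr // mul1r p2 ltrBlDr ltrDl divr_gt0.
have h : l2weight del d p a <= t ^+ 2 * (p / 2 * (count_lt d D)%:R `^ (2 / p)).
  have e : 1 - (1 - 2 / p) = 2 / p by ring.
  have := power_sum_le d D del01 hdel2 hr; rewrite e invf_div => h.
  apply: le_trans (ler_wpM2l (sqr_ge0 t) h); rewrite mulr_sumr; apply: ler_sum => i _.
  rewrite mulrA; apply: ler_wpM2r; first exact: powR_ge0.
  have := ha i; case: (D i) => /=; rewrite ?mulr1 ?mulr0 => h1.
    by rewrite -real_normK ?num_real // ler_sqr ?nnegrE.
  by move: h1; rewrite normr_le0 => /eqP ->; rewrite expr0n.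
have p20 : 0 <= p / 2 by rewrite divr_ge0 // ltW.
apply: (le_trans (le_powR p20 (l2weight_ge0 _ _ _ _) h)).
have c0 : 0 <= (count_lt d D)%:R `^ (2 / p) :> R by exact: powR_ge0.
rewrite (powRM (p / 2) (sqr_ge0 t) (mulr_ge0 p20 c0)) (powRM (p / 2) p20 c0).
rewrite -[(_ `^ (2 / p)) `^ _]powRrM; have -> : 2 / p * (p / 2) = 1 by field; rewrite gt_eqF.
rewrite powRr1 //; have -> : (t ^+ 2) `^ (p / 2) = t `^ p.
  by rewrite -powR_sqr ger0_norm.
by rewrite mulrCA.
Qed.

(** Hölder with exponents p/2 and p/(p-2): the latter turns the weights del_i^(1-2/p) into del_i, so
    only their total on D matters. *)
Lemma l2weight_supp a D h : (forall i, ~~ D i -> a i = 0) ->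
  \sum_(i < d) (D i)%:R * del i <= h ->
  l2weight del d p a `^ (p / 2) <= h `^ (p / 2 - 1) * seqsum d p a.
Proof.
move=> hD hh.
pose P := p / 2; pose Q := p / (p - 2).
have c : conjugate P Q.
  rewrite /P /Q; split.
  - by rewrite ltr_pdivlMr // mul1r.
  - by rewrite ltr_pdivlMr ?subr_gt0 // mul1r; (have := p2; lra).
  - by field; rewrite !gt_eqF //; (have := p2; lra).
have [P1 Q1 _] := c.
have sum0 : 0 <= \sum_(i < d) (D i)%:R * del i.
  by apply: sumr_ge0 => i _; rewrite mulr_ge0 //; case/andP: (del01 i) => /ltW.
have h1 : l2weight del d p a <=
    seqsum d p a `^ P^-1 * (\sum_(i < d) (D i)%:R * del i) `^ Q^-1.
  pose f (i : 'I_d) := a i ^+ 2; pose g (i : 'I_d) := (D i)%:R * del i `^ (1 - 2 / p).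
  apply: (@le_trans _ _ (\sum_i f i * g i)).
    apply: ler_sum => i _; rewrite /f /g; case: (boolP (D i)) => [|/hD ->] /=.
      by rewrite mul1r.
    by rewrite expr0n /= !mul0r.
  apply: (le_trans (holder f g c)).
  have -> : powsum P f = seqsum d p a.
    apply: eq_bigr => i _; rewrite /f normrX -powR_mulrn // -powRrM.
    by have -> : 2%:R * P = p by rewrite /P; field.
  have -> // : powsum Q g = \sum_(i < d) (D i)%:R * del i.
  apply: eq_bigr => i _.
  rewrite /g; case: (D i) => /=; last by rewrite !mul0r normr0 powR0 // gt_eqF //; (have := Q1; lra).
  rewrite !mul1r ger0_norm ?powR_ge0 // -powRrM.
  have -> : (1 - 2 / p) * Q = 1 by rewrite /Q; field; rewrite !gt_eqF //; (have := p2; lra).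
  by rewrite powRr1 //; case/andP: (del01 i) => /ltW.
have P0 : 0 <= P by (have := p2; lra).
apply: (le_trans (le_powR P0 (l2weight_ge0 _ _ _ _) h1)).
rewrite powRM ?powR_ge0 // powRVK ?seqsum_ge0 //; last by (have := p2; lra).
rewrite mulrC; apply: ler_wpM2r; first exact: seqsum_ge0.
rewrite -powRrM; have -> : Q^-1 * P = p / 2 - 1 by rewrite /P /Q; field; rewrite !gt_eqF //; (have := p2; lra).
by apply: le_powR => //; (have := p2; lra).
Qed.

Lemma rosnorm_supp_large a D h : (forall i, ~~ D i -> a i = 0) ->
  \sum_(i < d) (D i)%:R * del i <= h ->
  rosnorm del d p a <= C * (1 + h `^ (p / 2 - 1)) * seqsum d p a.
Proof.
move=> hD hh; apply: (le_trans (rosJ_large del01 _ p0 hC)).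
rewrite -mulrA; apply: ler_wpM2l => //; rewrite mulrDl mul1r lerD2l.
exact: l2weight_supp hD hh.
Qed.

End Large.

(** With these coefficients the normalized sum is the plain sum of the variables. Its p-sum and its
    weighted l_2-sum both equal the total of the del_i, the equality case in [l2weight_supp]. *)
Definition extremal del p (i : nat) : R := del i `^ p^-1.

Lemma seqsum_extremal del d p : 0 < p -> (forall i, 0 < del i <= 1) ->
  seqsum d p (extremal del p) = \sum_(i < d) del i.
Proof.
move=> p0 h; apply: eq_bigr => i _; rewrite /extremal ger0_norm ?powR_ge0 // powRVK //.
by case/andP: (h i) => /ltW.
Qed.

Lemma l2weight_extremal del d p : 0 < p -> (forall i, 0 < del i <= 1) ->
  l2weight del d p (extremal del p) = \sum_(i < d) del i.
Proof.
move=> p0 h; apply: eq_bigr => i _; have /andP[d0 _] := h i.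
rewrite /extremal -(powR_mulrn 2 (powR_ge0 _ _)) -powRrM -powRD; last by rewrite (gt_eqF d0) implybT.
have -> : p^-1 * 2%:R + (1 - 2 / p) = 1 by field; rewrite gt_eqF.
by rewrite powRr1 // ltW.
Qed.

(** A common interface for p > 2 and p < 2. The final alternative remains because the Rosenthal norm
    of the extremal vector exceeds its l_p-norm in the first case and falls short of it in the
    second. *)
Definition ros_estimates p q K th del d :=
 [/\ forall D (g : outcome d -> R),
       powsum p (rosJ del p (keep D (rosQ del q g)) : outcome d -> R) <= K * powsum p g,
     forall a D t, 0 <= t -> bounded_on D t a ->
       rosnorm del d p a <= K * (t `^ p * (count_lt d D)%:R),
     forall a D t, 0 <= t -> (forall i, D i -> t <= `|a i|) ->
       t `^ p * (count_lt d D)%:R <= K * rosnorm del d p a,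
     forall a D h, (forall i, ~~ D i -> a i = 0) -> \sum_(i < d) (D i)%:R * del i <= h ->
       rosnorm del d p a <= K * (1 + h `^ th) * seqsum d p a /\
       seqsum d p a <= K * (1 + h `^ th) * rosnorm del d p a &
     let H := \sum_(i < d) del i in
     H `^ th * seqsum d p (extremal del p) <= K * rosnorm del d p (extremal del p) \/
     H `^ th * rosnorm del d p (extremal del p) <= K * seqsum d p (extremal del p)].

Lemma seqsum_lower d p D t a : 0 < p -> 0 <= t -> (forall i, D i -> t <= `|a i|) ->
  t `^ p * (count_lt d D)%:R <= seqsum d p a.
Proof.
move=> p0 t0 ha; rewrite -count_ltE mulr_sumr; apply: ler_sum => i _.
case: (boolP (D i)) => [/ha h|_] /=; last by rewrite mulr0 powR_ge0.
by rewrite mulr1; apply: le_powR => //; exact: ltW.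
Qed.

Lemma rosnorm_ge0 del d p a : 0 <= rosnorm del d p a.
Proof. exact: powsum_ge0. Qed.

Lemma ros_estimates_large p q : conjugate p q -> 2 < p ->
  exists K th, [/\ 1 <= K, 0 < th & forall del d, (forall i, 0 < del i <= 1) ->
    (forall i, del i <= i.+1%:R^-1) -> ros_estimates p q K th del d].
Proof.
move=> hpq p2; have [C C0 hC] := rosenthal p2; have p0 : 0 < p by lra.
have e0 := powR_ge0 (p / 2) (p / 2).
pose K := 1 + 2 * C + C * (1 + (p / 2) `^ (p / 2)).
have e1 := mulr_ge0 C0 e0.
have K1 : 1 <= K by rewrite /K; lra.
exists K, (p / 2 - 1); split => //; first by rewrite subr_gt0 ltr_pdivlMr // mul1r.
move=> del d h1 h2; have hCd := hC _ h1 d.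
split.
- move=> D g; apply: (le_trans (ros_proj_large h1 _ _ hpq p2 C0 hCd)).
  by apply: ler_wpM2r; [exact: powsum_ge0|rewrite /K; lra].
- move=> a D t t0 ha; apply: (le_trans (rosnorm_upper_large p2 C0 h1 hCd h2 t0 ha)).
  by apply: ler_wpM2r; [rewrite mulr_ge0 ?powR_ge0|rewrite /K; lra].
- move=> a D t t0 ha; apply: (le_trans (seqsum_lower d p0 t0 ha)).
  apply: (le_trans (rosnorm_ge_seqsum hpq p2 _ h1 _)).
  by rewrite ler_peMl // rosnorm_ge0.
- move=> a D h hD hh; have hp := powR_ge0 h (p / 2 - 1); split.
    apply: (le_trans (rosnorm_supp_large p2 C0 h1 hCd hD hh)).
    apply: ler_wpM2r; first exact: seqsum_ge0.
    by apply: ler_wpM2r; [lra|rewrite /K; lra].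
  apply: (le_trans (rosnorm_ge_seqsum hpq p2 _ h1 _)).
  rewrite ler_peMl ?rosnorm_ge0 //; have := mulr_ge0 (le_trans ler01 K1) hp; lra.
- move=> H; left; have := rosnorm_ge_l2weight hpq p2 d h1 (extremal del p).
  rewrite l2weight_extremal // seqsum_extremal // -/H => h.
  have H0 : 0 <= H by apply: sumr_ge0 => i _; case/andP: (h1 i) => /ltW.
  have -> : H `^ (p / 2 - 1) * H = H `^ (p / 2).
    by rewrite mulrC mulr_powRB1 // divr_gt0.
  by apply: (le_trans h); rewrite ler_peMl // rosnorm_ge0.
Qed.

Lemma rosnorm_small_le del d p a : (forall i, 0 < del i <= 1) -> 0 < p <= 2 ->
  rosnorm del d p a <= seqsum d p a.
Proof. by move=> h1 hp; exact: rosJ_small_lp. Qed.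

(** For p < 2 there is no direct lower bound; it comes from testing against a vector b whose norm
    for the conjugate exponent is already bounded above. *)
Lemma rosnorm_dual p q del d a b X K : conjugate p q -> (forall i, 0 < del i <= 1) ->
  0 <= X -> 0 <= K -> X <= seqdot d a b -> rosnorm del d q b <= K * X ->
  X <= rosnorm del d p a * K `^ (p - 1).
Proof.
move=> hpq h1 X0 K0 hX hb; have [p1 q1 _] := hpq.
apply: (self_bound hpq) => //; first exact: rosnorm_ge0.
apply: (le_trans hX); rewrite -(rosJ_dot h1 d a b hpq).
apply: (le_trans (holder _ _ hpq)); apply: ler_wpM2l; first exact: powR_ge0.
by apply: le_powR => //; [rewrite invr_ge0; lra|exact: rosnorm_ge0].
Qed.

Lemma ros_estimates_small p q : conjugate p q -> p < 2 -> 2 < q ->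
  exists K th, [/\ 1 <= K, 0 < th & forall del d, (forall i, 0 < del i <= 1) ->
    (forall i, del i <= i.+1%:R^-1) -> ros_estimates p q K th del d].
Proof.
move=> hpq p2 q2; have [C C0 hC] := rosenthal q2; have [p1 q1 pq] := hpq.
have p0 : 0 < p by lra.
have hp : 0 < p <= 2 by rewrite p0 ltW.
have e0 := powR_ge0 (q / 2) (q / 2).
pose C' := C * (1 + (q / 2) `^ (q / 2)).
have C'0 : 0 <= C' by rewrite mulr_ge0 // addr_ge0.
have g1 := powR_ge0 (2 * C) (p - 1); have g2 := powR_ge0 C' (p - 1); have g3 := powR_ge0 C (p - 1).
pose K := 1 + (2 * C) `^ (p - 1) + C' `^ (p - 1) + C `^ (p - 1).
have K1 : 1 <= K by rewrite /K; lra.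
exists K, (1 - p / 2); split => //; first by rewrite subr_gt0 ltr_pdivrMr // mul1r.
move=> del d h1 h2; have hCd := hC _ h1 d.
split.
- move=> D g; apply: (le_trans (ros_proj_small h1 _ _ hpq q2 C0 hCd)).
  by apply: ler_wpM2r; [exact: powsum_ge0|rewrite /K; lra].
- move=> a D t t0 ha; apply: (le_trans (rosnorm_small_le d a h1 hp)).
  apply: (le_trans (seqsum_bounded_on d p0 t0 ha)).
  by rewrite ler_peMl // mulr_ge0 // powR_ge0.
- move=> a D t t0 ha; set X := _ * _.
  have X0 : 0 <= X by rewrite mulr_ge0 ?powR_ge0.
  (* The norming functional of a vector of constant modulus t on D, with the signs of a; as it is
     bounded on D, upper democracy for q applies to it. *)
  pose b i := Num.sg (a i) * t `^ (p - 1) * (D i)%:R.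
  have hX : X <= seqdot d a b.
    rewrite /X -count_ltE mulr_sumr; apply: ler_sum => i _.
    rewrite /b; case: (boolP (D i)) => [/ha h|_] /=; last by rewrite !mulr0.
    have -> : a i * (Num.sg (a i) * t `^ (p - 1) * 1) = `|a i| * t `^ (p - 1).
      by rewrite mulr1 mulrA [a i * _]mulrC -normrEsg.
    rewrite mulr1 -(mulr_powRB1 t0 p0).
    by apply: ler_wpM2r => //; exact: powR_ge0.
  have hb : bounded_on D (t `^ (p - 1)) b.
    move=> i; rewrite /b !normrM normr_sg normr_nat (ger0_norm (powR_ge0 _ _)).
    by apply: ler_wpM2r => //; case: (a i == 0) => /=; rewrite ?mul0r ?mul1r // powR_ge0.
  have := rosnorm_upper_large q2 C0 h1 hCd h2 (powR_ge0 _ _) hb.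
  rewrite -powRrM (conjugate_mul hpq) -/C' -/X => hb2.
  have := rosnorm_dual hpq h1 X0 C'0 hX hb2; move/le_trans; apply.
  by rewrite mulrC; apply: ler_wpM2r; [exact: rosnorm_ge0|rewrite /K; lra].
- move=> a D h hD hh.
  have hp0 := powR_ge0 h (1 - p / 2); split.
    apply: (le_trans (rosnorm_small_le d a h1 hp)).
    rewrite ler_peMl ?seqsum_ge0 //; have := mulr_ge0 (le_trans ler01 K1) hp0; lra.
  set X := seqsum d p a.
  have X0 : 0 <= X := seqsum_ge0 _ _ _.
  have hX : X <= seqdot d a (dualv p a).
    by rewrite /X le_eqVlt; apply/orP; left; apply/eqP; apply: eq_bigr => i _; rewrite dualvE.
  have hD' i : ~~ D i -> dualv p a i = 0.
    by move=> /hD; rewrite /dualv => ->; rewrite sgr0 mul0r.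
  have := rosnorm_supp_large q2 C0 h1 hCd hD' hh.
  have -> : seqsum d q (dualv p a) = X by apply: eq_bigr => i _; exact: norm_dualv.
  have hq0 := powR_ge0 h (q / 2 - 1).
  have K'0 : 0 <= C * (1 + h `^ (q / 2 - 1)) by rewrite mulr_ge0 // addr_ge0.
  move=> /(rosnorm_dual hpq h1 X0 K'0 hX) /le_trans; apply.
  rewrite mulrC; apply: ler_wpM2r; first exact: rosnorm_ge0.
  rewrite powRM ?addr_ge0 //.
  have hp1 : 0 < p - 1 <= 1 by lra.
  have := powR_subadd hp1 ler01 hq0; rewrite powR1 -powRrM.
  have -> : (q / 2 - 1) * (p - 1) = 1 - p / 2 by have := conjugate_mul hpq; lra.
  move=> h3; have := ler_wpM2l g3 h3; move/le_trans; apply.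
  by apply: ler_wpM2r; [lra|rewrite /K; lra].
- move=> H; right; have := rosJ_small_l2 h1 d (extremal del p) hp.
  rewrite l2weight_extremal // seqsum_extremal // -/H -/(rosnorm del d p _) => h.
  have H0 : 0 <= H by apply: sumr_ge0 => i _; case/andP: (h1 i) => /ltW.
  apply: (@le_trans _ _ (H `^ (1 - p / 2) * H `^ (p / 2))).
    by apply: ler_wpM2l => //; exact: powR_ge0.
  rewrite -powRD; last by apply/implyP; rewrite subrK oner_eq0.
  by rewrite subrK powRr1 // ler_peMl.
Qed.

Theorem ros_estimatesP p : 1 < p -> p != 2 ->
  exists q K th, [/\ conjugate p q, 1 <= K, 0 < th & forall del d,
    (forall i, 0 < del i <= 1) -> (forall i, del i <= i.+1%:R^-1) ->
    ros_estimates p q K th del d].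
Proof.
move=> p1 p2; pose q := p / (p - 1).
have hpq : conjugate p q.
  split => //; first by rewrite /q ltr_pdivlMr ?subr_gt0 // mul1r; lra.
  by rewrite /q; field; rewrite !gt_eqF //; lra.
exists q; case: (ltgtP p 2) p2 => // h _.
  have q2 : 2 < q by rewrite /q ltr_pdivlMr ?subr_gt0 //; lra.
  by have [K [th [h1 h2 h3]]] := ros_estimates_small hpq h q2; exists K, th.
by have [K [th [h1 h2 h3]]] := ros_estimates_large hpq h; exists K, th.
Qed.

End RosenthalSpace.

(** * Linear forms and matrices on a finite set *)

Section LinearForms.
Variables (R : realType) (S : finType).
Implicit Types (f g : S -> R) (F : (S -> R) -> R).

Definition linform F := forall c f g, F (fun s => c * f s + g s) = c * F f + F g.

Definition unitv (t : S) : S -> R := fun s => (s == t)%:R.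

Lemma linform_sum F f : linform F -> F f = \sum_t F (unitv t) * f t.
Proof.
move=> hF.
have F0 : F (fun _ => 0) = 0.
  have := hF (-1) (fun _ => 0) (fun _ => 0).
  have -> : (fun _ : S => -1 * (0 : R) + 0) = (fun _ => 0) by apply/funext => s; rewrite mulr0 addr0.
  lra.
have key r : uniq r -> F (fun s => (s \in r)%:R * f s) = \sum_(t <- r) F (unitv t) * f t.
  elim: r => [_|t r IH /= /andP[ht hr]].
    by rewrite big_nil -[RHS]F0; congr F; apply/funext => s; rewrite mul0r.
  rewrite big_cons -IH // mulrC -hF; congr F; apply/funext => s.
  rewrite inE /unitv; case: (eqVneq s t) => [->|_] /=; last by rewrite mulr0 add0r.
  by rewrite (negbTE ht) mul1r mulr1 mul0r addr0.
rewrite -(key (index_enum S)) ?index_enum_uniq //; congr F; apply/funext => s.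
by rewrite mem_index_enum mul1r.
Qed.

Lemma linform_add F G : linform F -> linform G -> linform (fun f => F f + G f).
Proof. by move=> hF hG c f g; rewrite hF hG; ring. Qed.

Lemma linform_sub F G : linform F -> linform G -> linform (fun f => F f - G f).
Proof. by move=> hF hG c f g; rewrite hF hG; ring. Qed.

Lemma linform_mulr F c0 : linform F -> linform (fun f => F f * c0).
Proof. by move=> hF c f g; rewrite hF; ring. Qed.

Lemma linform_bigsum (I : finType) (F : I -> (S -> R) -> R) :
  (forall i, linform (F i)) -> linform (fun f => \sum_i F i f).
Proof.
move=> hF c f g; rewrite mulr_sumr -big_split /=; apply: eq_bigr => i _; exact: hF.
Qed.

Lemma linform_if (b : bool) F G : linform F -> linform G ->
  linform (fun f => if b then F f else G f).
Proof. by case: b. Qed.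

Lemma linform0 : linform (fun _ => 0).
Proof. by move=> c f g; rewrite mulr0 addr0. Qed.

(** A one-sided inverse of a square matrix is two-sided, so only one composition of the swindle with
    its inverse has to be computed. *)
Lemma finmx_inv_comm (A B : S -> S -> R) :
  (forall s u, \sum_t B s t * A t u = (s == u)%:R) ->
  forall s u, \sum_t A s t * B t u = (s == u)%:R.
Proof.
move=> h s u.
pose MA : 'M[R]_#|S| := \matrix_(i, j) A (enum_val i) (enum_val j).
pose MB : 'M[R]_#|S| := \matrix_(i, j) B (enum_val i) (enum_val j).
have e : MB *m MA = 1%:M.
  apply/matrixP => i j; rewrite !mxE.
  rewrite -(inj_eq enum_val_inj) -h (reindex (@enum_val S predT)) /=.
    by apply: eq_bigr => k _; rewrite !mxE.
  by apply: onW_bij; exact: enum_val_bij.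
have := congr1 (fun M : 'M[R]_#|S| => M (enum_rank s) (enum_rank u)) (mulmx1C e).
rewrite !mxE (inj_eq enum_rank_inj) => <-.
rewrite (reindex (@enum_val S predT)) /=.
  by apply: eq_bigr => k _; rewrite !mxE !enum_rankK.
by apply: onW_bij; exact: enum_val_bij.
Qed.

End LinearForms.

(** * A finite swindle *)

Section Swindle.
Variables (R : realType) (p q K th : R) (del : nat -> R) (d : nat).
Hypothesis hpq : conjugate p q.
Hypothesis K1 : 1 <= K.
Hypothesis del01 : forall i, 0 < del i <= 1.
Hypothesis est : ros_estimates p q K th del d.

Local Notation Om := (outcome d).
Local Notation coords := ('I_d + 'I_d * Om)%type.
Implicit Types (f : coords -> R) (v w : Om -> R) (a b : nat -> R).
Local Notation J := (rosJ del p).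
Local Notation Q := (rosQ del q).

Let p0 : 0 < p. Proof. by case: hpq => h _ _; apply: lt_trans h. Qed.

Lemma rosJ_ext a b : (forall i, (i < d)%N -> a i = b i) -> J a = J b :> (Om -> R).
Proof.
move=> h; apply/funext => w; rewrite /rosJ /rsum; congr (_ * _).
by apply: eq_bigr => i _; rewrite h.
Qed.

Lemma rosJD a b (o : Om) : J (fun i => a i + b i) o = J a o + J b o :> R.
Proof.
rewrite /rosJ /rsum -mulrDr -big_split; congr (_ * _).
by apply: eq_bigr => i _ /=; ring.
Qed.

Lemma rosJB a b (o : Om) : J (fun i => a i - b i) o = J a o - J b o :> R.
Proof.
rewrite /rosJ /rsum -mulrBr -sumrB; congr (_ * _).
by apply: eq_bigr => i _ /=; ring.
Qed.

Lemma rosQB v w i : Q (fun o => v o - w o) i = Q v i - Q w i.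
Proof. by rewrite /rosQ -sumrB; apply: eq_bigr => o _; ring. Qed.

(** The ranges lose one dimension with each step, and the range of [tailproj d] is zero; hence the
    chain of slots closes up after d steps without remainder. *)
Definition tailproj (i : nat) v : Om -> R := J (keep (fun l => (i <= l)%N) (Q v)).

Lemma rosQ_tailproj i v l : (l < d)%N ->
  Q (tailproj i v) l = if (i <= l)%N then Q v l else 0.
Proof. by move=> hl; rewrite /tailproj (rosQJ del01 _ hpq hl). Qed.

(** Both parts are extended by 0 beyond d, since the formulas for the last slot refer to index d. *)
Definition zpart f (i : nat) : R := if insub i is Some j then f (inl j) else 0.
Definition gpart f (k : nat) : Om -> R :=
  fun o => if insub k is Some j then f (inr (j, o)) else 0.
Definition chain f (i : nat) : Om -> R := if i is k.+1 then gpart f k else J (zpart f).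

(* Eilenberg's swindle along the finite chain of tail projections: the i-th
   slot hands the range of tailproj i to the next slot, and each step frees one
   scalar coordinate. *)
Definition swindle f (s : coords) : R :=
  match s with
  | inl i => Q (chain f i) i
  | inr (k, o) => chain f k.+1 o
      - tailproj k.+1 (fun o' => chain f k.+1 o' - chain f k o') o
  end.

Definition unswindle f (s : coords) : R :=
  match s with
  | inl i => if i == 0%N :> nat then zpart f 0 else Q (gpart f 0) i
  | inr (k, o) => gpart f k o - tailproj k.+1 (gpart f k) o
      + J (fun l => zpart f k.+1 * (l == k.+1)%:R) o + tailproj k.+2 (gpart f k.+1) o
  end.

Lemma zpart_ord f (i : 'I_d) : zpart f i = f (inl i).
Proof. by rewrite /zpart valK. Qed.

Lemma gpart_ord f (k : 'I_d) o : gpart f k o = f (inr (k, o)).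
Proof. by rewrite /gpart valK. Qed.

Lemma zpart_ge f i : (d <= i)%N -> zpart f i = 0.
Proof. by move=> hi; rewrite /zpart insubF // ltnNge hi. Qed.

Lemma gpart_ge f k o : (d <= k)%N -> gpart f k o = 0.
Proof. by move=> hi; rewrite /gpart insubF // ltnNge hi. Qed.

Lemma zpart_swindle f i : (i < d)%N -> zpart (swindle f) i = Q (chain f i) i.
Proof. by move=> hi; exact: (zpart_ord _ (Ordinal hi)). Qed.

Lemma gpart_swindle f k o : (k < d)%N -> gpart (swindle f) k o =
  chain f k.+1 o - tailproj k.+1 (fun o' => chain f k.+1 o' - chain f k o') o.
Proof. by move=> hi; exact: (gpart_ord _ (Ordinal hi)). Qed.

Lemma rosQ_gpart_swindle f k l : (k < d)%N -> (k < l < d)%N ->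
  Q (gpart (swindle f) k) l = Q (chain f k) l.
Proof.
move=> hk /andP[hkl hl].
have -> : gpart (swindle f) k = fun o => chain f k.+1 o -
    tailproj k.+1 (fun o' => chain f k.+1 o' - chain f k o') o.
  by apply/funext => o; rewrite gpart_swindle.
by rewrite rosQB rosQ_tailproj // hkl rosQB; ring.
Qed.

Lemma swindleK f s : unswindle (swindle f) s = f s.
Proof.
case: s => [i|[k o]] /=.
  case: (eqVneq (i : nat) 0%N) => hi.
    have hd : (0 < d)%N by rewrite -hi ltn_ord.
    rewrite zpart_swindle //= (rosQJ del01 _ hpq) // -zpart_ord.
    by rewrite hi.
  have hd : (0 < d)%N by exact: leq_ltn_trans (ltn_ord i).
  rewrite rosQ_gpart_swindle //=; last by rewrite lt0n hi ltn_ord.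
  by rewrite (rosQJ del01 _ hpq) // zpart_ord.
have hk := ltn_ord k.
rewrite gpart_swindle // -[RHS](gpart_ord f k o) -/(chain f k.+1 o).
have e1 : tailproj k.+1 (gpart (swindle f) k) = tailproj k.+1 (chain f k).
  apply: rosJ_ext => l hl; rewrite /keep; case: ifP => // hkl.
  by rewrite rosQ_gpart_swindle // hkl.
have e2 : tailproj k.+1 (fun o' => chain f k.+1 o' - chain f k o') o =
    tailproj k.+1 (chain f k.+1) o - tailproj k.+1 (chain f k) o.
  rewrite /tailproj -rosJB; apply: (congr1 (fun G : Om -> R => G o)); apply: rosJ_ext => l hl.
  by rewrite /keep; case: ifP => _; rewrite ?subrr // rosQB.
(* The tail of the next chain element was given away in two parts: its leading coordinate became a
   scalar, the rest moved to slot k.+1. For k.+1 = d there is nothing to recover. *)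
have e3 : J (fun l => zpart (swindle f) k.+1 * (l == k.+1)%:R) o +
    tailproj k.+2 (gpart (swindle f) k.+1) o = tailproj k.+1 (chain f k.+1) o.
  rewrite /tailproj -rosJD; apply: (congr1 (fun G : Om -> R => G o)); apply: rosJ_ext => l hl.
  rewrite /keep; case: (ltngtP k.+1 l) => hkl.
  - rewrite mulr0 add0r rosQ_gpart_swindle //; first exact: ltn_trans hkl hl.
    by rewrite hkl hl.
  - by rewrite mulr0 addr0.
  - by rewrite -hkl in hl *; rewrite mulr1 addr0 zpart_swindle.
rewrite e1 e2 -addrA e3; ring.
Qed.

Lemma linform_rosJ (Z : (coords -> R) -> nat -> R) (o : Om) :
  (forall i, linform (fun f => Z f i)) -> linform (fun f => J (Z f) o).
Proof.
move=> hZ.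
have -> : (fun f => J (Z f) o) = fun f =>
    (\sum_(i < d) Z f i * del i `^ (- p^-1) * xi R o i) * prob del o `^ p^-1.
  by apply/funext => f; rewrite /rosJ mulrC.
apply: linform_mulr; apply: linform_bigsum => i; do 2 apply: linform_mulr.
exact: hZ.
Qed.

Lemma linform_rosQ (V : (coords -> R) -> Om -> R) i :
  (forall o, linform (fun f => V f o)) -> linform (fun f => Q (V f) i).
Proof. by move=> hV; apply: linform_bigsum => o; apply: linform_mulr; exact: hV. Qed.

Lemma linform_tailproj i (V : (coords -> R) -> Om -> R) (o : Om) :
  (forall o, linform (fun f => V f o)) -> linform (fun f => tailproj i (V f) o).
Proof.
move=> hV; apply: linform_rosJ => l; rewrite /keep.
by apply: linform_if; [exact: linform_rosQ|exact: linform0].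
Qed.

Lemma linform_zpart i : linform (fun f => zpart f i).
Proof. by rewrite /zpart; case: (insub i) => [j|] c f g //; rewrite mulr0 addr0. Qed.

Lemma linform_gpart k o : linform (fun f => gpart f k o).
Proof. by rewrite /gpart; case: (insub k) => [j|] c f g //; rewrite mulr0 addr0. Qed.

Lemma linform_chain i o : linform (fun f => chain f i o).
Proof.
case: i => [|k] /=; last exact: linform_gpart.
by apply: linform_rosJ => i; exact: linform_zpart.
Qed.

Lemma linform_swindle s : linform (fun f => swindle f s).
Proof.
case: s => [i|[k o]] /=.
  by apply: linform_rosQ => o; exact: linform_chain.
apply: linform_sub; first exact: linform_gpart.
by apply: linform_tailproj => o'; apply: linform_sub; [exact: linform_gpart|exact: linform_chain].
Qed.

Lemma linform_unswindle s : linform (fun f => unswindle f s).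
Proof.
case: s => [i|[k o]] /=.
  apply: linform_if; first exact: linform_zpart.
  by apply: linform_rosQ => o; exact: linform_gpart.
apply: linform_add; last by apply: linform_tailproj => o'; exact: linform_gpart.
apply: linform_add.
  apply: linform_sub; first exact: linform_gpart.
  by apply: linform_tailproj => o'; exact: linform_gpart.
by apply: linform_rosJ => l; apply: linform_mulr; exact: linform_zpart.
Qed.

Definition swindle_mx (s t : coords) : R := swindle (unitv R t) s.
Definition unswindle_mx (s t : coords) : R := unswindle (unitv R t) s.

Lemma swindleE f s : swindle f s = \sum_t swindle_mx s t * f t.
Proof. exact: (linform_sum f (linform_swindle s)). Qed.

Lemma unswindleE f s : unswindle f s = \sum_t unswindle_mx s t * f t.
Proof. exact: (linform_sum f (linform_unswindle s)). Qed.

Lemma unswindle_swindle_mx (s u : coords) : \sum_t unswindle_mx s t * swindle_mx t u = (s == u)%:R.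
Proof. by rewrite -(unswindleE (fun t => swindle_mx t u)) swindleK. Qed.

Lemma swindle_unswindle_mx (s u : coords) : \sum_t swindle_mx s t * unswindle_mx t u = (s == u)%:R.
Proof. exact: (finmx_inv_comm unswindle_swindle_mx). Qed.

Lemma powsumD v w : powsum p (fun o => v o + w o) <= 2 `^ p * (powsum p v + powsum p w).
Proof.
rewrite -big_split mulr_sumr; apply: ler_sum => o _ /=.
apply: (le_trans (le_powR (ltW p0) (normr_ge0 _) (ler_normD _ _))).
by apply: powR_quasi => //; exact: ltW.
Qed.

Lemma powsumN v : powsum p (fun o => - v o) = powsum p v.
Proof. by apply: eq_bigr => o _; rewrite normrN. Qed.

Lemma powsumB v w : powsum p (fun o => v o - w o) <= 2 `^ p * (powsum p v + powsum p w).
Proof. by rewrite -[powsum p w]powsumN; exact: powsumD. Qed.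

Lemma tailproj_le i v : powsum p (tailproj i v) <= K * powsum p v.
Proof. by case: est => h _ _ _ _; exact: h. Qed.

Lemma single_count i : (i < d)%N -> count_lt d (fun l => l == i) = 1%N.
Proof.
move=> hi; rewrite /count_lt (bigD1 (Ordinal hi)) //= eqxx big1 ?addn0 // => j.
by rewrite -val_eqE /= => /negbTE ->.
Qed.

Lemma rosQ_coord_le v i : (i < d)%N -> `|Q v i| `^ p <= K * K * powsum p v.
Proof.
move=> hi; case: est => h1 _ h3 _ _.
have hD l : l == i -> `|Q v i| <= `|keep (fun l => l == i) (Q v) l|.
  by move=> /eqP ->; rewrite /keep eqxx.
have := h3 _ (fun l => l == i) _ (normr_ge0 _) hD.
rewrite single_count // mulr1 => h; apply: (le_trans h).
by rewrite -mulrA; apply: ler_wpM2l; [exact: le_trans K1|exact: h1].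
Qed.

Lemma rosJ_single_le c i : (i < d)%N ->
  powsum p (J (fun l => c * (l == i)%:R) : Om -> R) <= K * `|c| `^ p.
Proof.
move=> hi; case: est => _ h2 _ _ _.
have := h2 (fun l => c * (l == i)%:R) (fun l => l == i) `|c| (normr_ge0 _).
rewrite single_count // mulr1; apply => l.
by rewrite normrM normr_nat.
Qed.

(** The norm (to the power p) on the domain of the swindle: the span of the variables plus d full
    copies of l_p. The target carries the plain l_p-norm on the same index set. *)
Definition coordnorm f : R := rosnorm del d p (zpart f) + \sum_(k < d) powsum p (gpart f k).

Lemma powsum_coords f : powsum p f =
  \sum_(i < d) `|zpart f i| `^ p + \sum_(k < d) powsum p (gpart f k).
Proof.
rewrite /powsum big_sumType /=; congr (_ + _).
  by apply: eq_bigr => i _; rewrite zpart_ord.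
rewrite pair_bigA /=; apply: eq_bigr => -[k o] _ /=.
by rewrite gpart_ord.
Qed.

Lemma sum_chain_le f (n : nat) : (n <= d)%N ->
  \sum_(i < n) powsum p (chain f i) <= coordnorm f.
Proof.
case: n => [|n] hn.
  by rewrite big_ord0 addr_ge0 ?sumr_ge0 ?rosnorm_ge0 // => k _; exact: powsum_ge0.
rewrite big_ord_recl /= /coordnorm lerD2l.
rewrite -(big_mkord xpredT (fun i => powsum p (gpart f i))).
rewrite -(big_mkord xpredT (fun k => powsum p (gpart f k))).
rewrite [leRHS](big_cat_nat (n := n)) //=; last exact: ltnW.
by rewrite lerDl sumr_ge0 // => i _; exact: powsum_ge0.
Qed.

(** A crude common bound: every sum of two vectors costs 2^p and every projection costs K. *)
Definition swindle_const : R := 4 * K * K * (2 `^ p * 2 `^ p + 2 `^ p + 1).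

Lemma swindle_le f : powsum p (swindle f) <= swindle_const * coordnorm f.
Proof.
set N := coordnorm f; set c := 2 `^ p : R.
have c0 : 0 <= c by exact: powR_ge0.
have K0 : 0 <= K by exact: le_trans K1.
have hs : \sum_(i < d) `|zpart (swindle f) i| `^ p <= K * K * N.
  apply: (@le_trans _ _ (\sum_(i < d) K * K * powsum p (chain f i))).
    by apply: ler_sum => i _; rewrite zpart_swindle //; exact: rosQ_coord_le.
  by rewrite -mulr_sumr; apply: ler_wpM2l; [exact: mulr_ge0|exact: sum_chain_le].
have g_le : \sum_(k < d) powsum p (gpart f k) <= N.
  by rewrite /N /coordnorm lerDr rosnorm_ge0.
have hg : \sum_(k < d) powsum p (gpart (swindle f) k) <=
    (c + c * K * c + c * K * c) * N.
  apply: (@le_trans _ _ (\sum_(k < d) ((c + c * K * c) * powsum p (gpart f k)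
      + c * K * c * powsum p (chain f k)))).
    apply: ler_sum => k _.
    have -> : gpart (swindle f) k = fun o => chain f k.+1 o -
        tailproj k.+1 (fun o' => chain f k.+1 o' - chain f k o') o.
      by apply/funext => o; rewrite gpart_swindle.
    apply: (le_trans (powsumB _ _)); rewrite -/c.
    have h1 := tailproj_le k.+1 (fun o' => chain f k.+1 o' - chain f k o').
    have h2 := powsumB (chain f k.+1) (chain f k); rewrite -/c in h2.
    have := ler_wpM2l c0 (le_trans h1 (ler_wpM2l K0 h2)); rewrite /=; lra.
  rewrite big_split /= -!mulr_sumr.
  have cK : 0 <= c * K * c by rewrite !mulr_ge0.
  have := ler_wpM2l (addr_ge0 c0 cK) g_le.
  have := ler_wpM2l cK (sum_chain_le f (leqnn d)); rewrite -/N; lra.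
have N0 : 0 <= N.
  by rewrite /N addr_ge0 ?rosnorm_ge0 // sumr_ge0 // => k _; exact: powsum_ge0.
rewrite powsum_coords; apply: (le_trans (lerD hs hg)).
rewrite -mulrDl; apply: ler_wpM2r => //; rewrite /swindle_const -/c.
have KK : K <= K * K by rewrite ler_peMl.
have k1 : 1 <= K := K1.
have h1 := ler_wpM2l (mulr_ge0 c0 c0) KK; have h2 := ler_wpM2l c0 KK.
have h3 := ler_wpM2l c0 k1; have h4 := mulr_ge0 (mulr_ge0 c0 c0) K0.
have h5 := mulr_ge0 c0 K0; have h6 := mulr_ge0 K0 K0.
nra.
Qed.

Lemma unswindle_le f : coordnorm (unswindle f) <= swindle_const * 4 * 2 `^ p * powsum p f.
Proof.
set c := 2 `^ p : R.
have c1 : 1 <= c by rewrite -(powRr0 2); apply: ler_powR; [lra|exact: ltW].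
have c0 : 0 <= c by exact: powR_ge0.
have K0 : 0 <= K by exact: le_trans K1.
pose Z := \sum_(i < d) `|zpart f i| `^ p; pose G := \sum_(k < d) powsum p (gpart f k).
have eN : powsum p f = Z + G by exact: powsum_coords.
have Z0 : 0 <= Z by apply: sumr_ge0 => i _; exact: powR_ge0.
have G0 : 0 <= G by apply: sumr_ge0 => i _; exact: powsum_ge0.
have hz : rosnorm del d p (zpart (unswindle f)) <= c * (K * Z + K * G).
  case: (posnP d) => hd.
    have -> : rosnorm del d p (zpart (unswindle f)) = 0.
      rewrite /rosnorm /powsum big1 // => o _; rewrite /rosJ /rsum big1 ?mulr0 ?normr0 ?powR0 ?gt_eqF //.
      by move=> i; have := ltn_ord i; rewrite [X in (_ < X)%N]hd.
    by rewrite mulr_ge0 // addr_ge0 // mulr_ge0.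
  have e : J (zpart (unswindle f)) = fun o => J (fun l => zpart f 0 * (l == 0%N)%:R) o
      + tailproj 1 (gpart f 0) o.
    apply/funext => o; rewrite /tailproj -rosJD; apply: (congr1 (fun G : Om -> R => G o)); apply: rosJ_ext => l hl.
    rewrite (zpart_ord _ (Ordinal hl) : zpart (unswindle f) l = _) /= /keep.
    by case: l hl => [|l] hl /=; rewrite ?mulr1 ?addr0 // mulr0 add0r.
  rewrite /rosnorm e; apply: (le_trans (powsumD _ _)); apply: ler_wpM2l => //.
  apply: lerD.
    apply: (le_trans (rosJ_single_le _ hd)); apply: ler_wpM2l => //.
    by rewrite /Z (bigD1 (Ordinal hd)) //= lerDl sumr_ge0 // => i _; exact: powR_ge0.
  apply: (le_trans (tailproj_le _ _)); apply: ler_wpM2l => //.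
  by rewrite /G (bigD1 (Ordinal hd)) //= lerDl sumr_ge0 // => i _; exact: powsum_ge0.
(* Each slot borrows from its successor; the shifted sum loses its first term, and the new last term
   is 0. *)
have shift (F : nat -> R) : (forall i, 0 <= F i) -> (forall i, (d <= i)%N -> F i = 0) ->
    \sum_(k < d) F k.+1 <= \sum_(k < d) F k.
  move=> F0 Fd; case: (posnP d) => hd.
    by rewrite -(big_mkord xpredT F) -(big_mkord xpredT (fun k => F k.+1)) hd !big_geq.
  have -> : d = d.-1.+1 by rewrite prednK.
  rewrite big_ord_recr big_ord_recl /= prednK // Fd // addr0 lerDr; exact: F0.
have hg : \sum_(k < d) powsum p (gpart (unswindle f) k) <=
   c * c * (c * (1 + K) * G + K * Z) + c * (K * G).
  pose g1 k o := gpart f k o - tailproj k.+1 (gpart f k) o.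
  pose g2 k := J (fun l => zpart f k.+1 * (l == k.+1)%:R) : Om -> R.
  pose g3 k := tailproj k.+2 (gpart f k.+1).
  have h3 k : powsum p (g3 k) <= K * powsum p (gpart f k.+1) by exact: tailproj_le.
  have h2 k : powsum p (g2 k) <= K * `|zpart f k.+1| `^ p.
    case: (ltnP k.+1 d) => hk; first exact: rosJ_single_le.
    rewrite /powsum big1 ?mulr_ge0 ?powR_ge0 // => o _.
    rewrite /g2 /rosJ /rsum big1 ?mulr0 ?normr0 ?powR0 ?gt_eqF // => i _.
    by rewrite zpart_ge // !mul0r.
  have h1 k : powsum p (g1 k) <= c * (1 + K) * powsum p (gpart f k).
    apply: (le_trans (powsumB _ _)); rewrite -mulrA; apply: ler_wpM2l => //.
    by rewrite mulrDl mul1r lerD2l; exact: tailproj_le.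
  apply: (@le_trans _ _ (\sum_(k < d) (c * c * (c * (1 + K) * powsum p (gpart f k) +
      K * `|zpart f k.+1| `^ p) + c * (K * powsum p (gpart f k.+1))))).
    apply: ler_sum => k _.
    have -> : gpart (unswindle f) k = fun o => (g1 k o + g2 k o) + g3 k o.
      by apply/funext => o; rewrite gpart_ord.
    apply: (le_trans (powsumD _ _)); rewrite -/c mulrDr; apply: lerD.
      rewrite -mulrA; apply: ler_wpM2l => //; apply: (le_trans (powsumD _ _)).
      by apply: ler_wpM2l => //; exact: lerD.
    exact: ler_wpM2l.
  rewrite big_split /= -!mulr_sumr big_split /= -!mulr_sumr.
  apply: lerD; last first.
    apply: ler_wpM2l => //; apply: ler_wpM2l => //.
    apply: (shift (fun k => powsum p (gpart f k))) => [i|i hi]; first exact: powsum_ge0.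
    rewrite /powsum big1 // => o _; by rewrite gpart_ge // normr0 powR0 ?gt_eqF.
  apply: ler_wpM2l; first exact: mulr_ge0.
  apply: lerD => //; apply: ler_wpM2l => //.
  apply: (shift (fun k => `|zpart f k| `^ p)) => [i|i hi]; first exact: powR_ge0.
  by rewrite zpart_ge // normr0 powR0 ?gt_eqF.
rewrite eN; apply: (le_trans (lerD hz hg)); rewrite /swindle_const -/c.
have k1 : 1 <= K := K1.
have KK : K <= K * K by rewrite ler_peMl.
have cc : c <= c * c by rewrite ler_peMl.
have ccc : c * c <= c * c * c by rewrite ler_peMr // mulr_ge0.
have q1 : 0 <= c * c * c by rewrite !mulr_ge0.
have KK1 : 1 <= K * K by lra.
have b1 : c * K + c * c * c * (1 + K) + c * K <= 16 * (K * K) * (c * c * c) by nra.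
have b2 : c * K + c * c * K <= 16 * (K * K) * (c * c * c) by nra.
have := ler_wpM2r G0 b1; have := ler_wpM2r Z0 b2.
have : 0 <= K * K * (c * c + c) * (Z + G) by rewrite !mulr_ge0 ?addr_ge0 ?mulr_ge0.
have : 0 <= c by []. 
lra.
Qed.

End Swindle.

(** * Democratic bases of l_p^m as pairs of matrices *)

Section BlockSystems.
Variable R : realType.
Implicit Types (p q K th : R) (del a : nat -> R) (A B : nat -> nat -> R) (D : pred nat) (m d : nat).

Definition mxapp m A a (i : nat) : R := \sum_(c < m) A i c * a c.

(* Matrices A and B of order m, inverse to each other, such that the columns of
   A form an unconditional democratic basis of l_p^m, with constant K. *)
Definition block_system p K m A B :=
  [/\ forall i l, (i < m)%N -> (l < m)%N -> \sum_(c < m) A i c * B c l = (i == l)%:R,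
      forall i l, (i < m)%N -> (l < m)%N -> \sum_(c < m) B i c * A c l = (i == l)%:R,
      forall D f, seqsum m p (mxapp m A (keep D (mxapp m B f))) <= K * seqsum m p f,
      forall a D t, 0 <= t -> bounded_on D t a ->
        seqsum m p (mxapp m A a) <= K * (t `^ p * (count_lt m D)%:R) &
      forall a D t, 0 <= t -> (forall i, D i -> t <= `|a i|) ->
        t `^ p * (count_lt m D)%:R <= K * seqsum m p (mxapp m A a)].

(* Up to K, the columns of A span l_p^m, except for the ones with index pos i,
   i < d, which are only (1 + h^th)-equivalent to the unit vectors of l_p if
   their weights del i sum up to at most h; for h = sum del this is sharp. *)
Definition distorted p K th del d (pos : nat -> nat) m A :=
  [/\ forall i, (i < d)%N -> (pos i < m)%N,
      forall i l, (i < d)%N -> (l < d)%N -> pos i = pos l -> i = l,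
      forall a D h, (forall i, ~~ D i -> a i = 0) ->
        \sum_(i < d) (D (pos i))%:R * del i <= h ->
        seqsum m p (mxapp m A a) <= K * (1 + h `^ th) * seqsum m p a /\
        seqsum m p a <= K * (1 + h `^ th) * seqsum m p (mxapp m A a) &
      exists a, [/\ forall c, (forall i, (i < d)%N -> c <> pos i) -> a c = 0,
        (0 < d)%N -> 0 < seqsum m p a &
        let H := \sum_(i < d) del i in
        H `^ th * seqsum m p a <= K * seqsum m p (mxapp m A a) \/
        H `^ th * seqsum m p (mxapp m A a) <= K * seqsum m p a]].

Section Construction.
Variables (p q K th : R) (del : nat -> R) (d : nat).
Hypothesis hpq : conjugate p q.
Hypothesis K1 : 1 <= K.
Hypothesis del01 : forall i, 0 < del i <= 1.
Hypothesis est : ros_estimates p q K th del d.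

Local Notation Om := (outcome d).
Local Notation coords := ('I_d + 'I_d * Om)%type.
Local Notation m := #|{: coords}|.

Let p0 : 0 < p. Proof. by case: hpq => h _ _; apply: lt_trans h. Qed.

(** Indices are natural numbers so that blocks of different sizes share one type; entries outside
    the enumeration are 0. *)
Definition nat_mx (M : coords -> coords -> R) (i c : nat) : R :=
  if insub i is Some i' then
    if insub c is Some c' then M (enum_val (i' : 'I_m)) (enum_val (c' : 'I_m)) else 0
  else 0.

Definition on_coords a (s : coords) : R := a (enum_rank s).

Lemma sum_coords (F : nat -> R) : \sum_(i < m) F i = \sum_(s : coords) F (enum_rank s).
Proof.
rewrite (reindex (@enum_rank coords)) //=.
by apply: onW_bij; exact: enum_rank_bij.
Qed.

Lemma nat_mxE M s t : nat_mx M (enum_rank s) (enum_rank t) = M s t.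
Proof. by rewrite /nat_mx !valK !enum_rankK. Qed.

Lemma mxapp_coords M a s : mxapp m (nat_mx M) a (enum_rank s) = \sum_t M s t * on_coords a t.
Proof.
rewrite /mxapp (sum_coords (fun c => nat_mx M (enum_rank s) c * a c)).
by apply: eq_bigr => t _; rewrite nat_mxE.
Qed.

Lemma seqsum_coords a : seqsum m p a = powsum p (on_coords a).
Proof. by rewrite /seqsum (sum_coords (fun i => `|a i| `^ p)). Qed.

Let A := nat_mx (swindle_mx p q del (d := d)).
Let B := nat_mx (unswindle_mx p q del (d := d)).

Lemma seqsum_A a : seqsum m p (mxapp m A a) = powsum p (swindle p q del (on_coords a)).
Proof.
rewrite seqsum_coords; apply: eq_bigr => s _; rewrite /on_coords mxapp_coords.
by rewrite swindleE.
Qed.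

Lemma on_coords_B a : on_coords (mxapp m B a) = unswindle p q del (on_coords a).
Proof. by apply/funext => s; rewrite /on_coords mxapp_coords unswindleE. Qed.

Definition zpos (i : nat) : nat :=
  if insub i is Some j then enum_rank (inl j : coords) : nat else 0.

Lemma zpos_ord (i : 'I_d) : zpos i = enum_rank (inl i : coords).
Proof. by rewrite /zpos valK. Qed.

Definition zpred D (i : nat) := (i < d)%N && D (zpos i).

Lemma count_zpred D : (count_lt d (zpred D))%:R + \sum_(k < d) \sum_(o : Om) (D (enum_rank (inr (k, o) : coords)))%:R
  = (count_lt m D)%:R :> R.
Proof.
rewrite -!count_ltE (sum_coords (fun i => (D i)%:R)) big_sumType /=; congr (_ + _).
  by apply: eq_bigr => i _; rewrite /zpred ltn_ord zpos_ord.
by rewrite pair_bigA /=; apply: eq_bigr => -[k o] _.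
Qed.

Lemma zpart_on_coords a i : (i < d)%N -> zpart (on_coords a) i = a (zpos i).
Proof. by move=> hi; rewrite (zpart_ord _ (Ordinal hi)) /on_coords (zpos_ord (Ordinal hi) : zpos i = _). Qed.

Let C1 := swindle_const p K.
Let C2 := swindle_const p K * 4 * 2 `^ p.

Definition block_const : R := K * (1 + swindle_const p K) * (1 + swindle_const p K * 4 * 2 `^ p).

Let K0 : 0 <= K. Proof. exact: le_trans K1. Qed.
Let C10 : 0 <= C1.
Proof. by rewrite /C1 /swindle_const !mulr_ge0 ?addr_ge0 ?mulr_ge0 ?powR_ge0. Qed.
Let C20 : 0 <= C2. Proof. by rewrite /C2 !mulr_ge0 ?powR_ge0. Qed.

Lemma coordnorm_le_swindle (f : coords -> R) :
  coordnorm p del f <= C2 * powsum p (swindle p q del f).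
Proof.
have := unswindle_le hpq K1 est (swindle p q del f).
have -> : unswindle p q del (swindle p q del f) = f.
  by apply/funext => s; rewrite (swindleK hpq del01).
by [].
Qed.

Lemma swindle_le_coordnorm (f : coords -> R) :
  powsum p (swindle p q del f) <= C1 * coordnorm p del f.
Proof. exact: (swindle_le hpq K1 est). Qed.

Lemma rosnorm_ext a b : (forall i, (i < d)%N -> a i = b i) -> rosnorm del d p a = rosnorm del d p b.
Proof. by move=> h; rewrite /rosnorm (rosJ_ext p del h). Qed.

Lemma rosnorm_keep D a : rosnorm del d p (keep D a) <= K * rosnorm del d p a.
Proof.
case: est => h _ _ _ _; apply: le_trans (h D (rosJ del p a)); rewrite le_eqVlt; apply/orP; left.
apply/eqP/rosnorm_ext => i hi; rewrite /keep; case: ifP => // _.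
by rewrite (rosQJ del01 a hpq hi).
Qed.

Lemma coordnorm_keep D a :
  coordnorm p del (on_coords (keep D a)) <= K * coordnorm p del (on_coords a).
Proof.
rewrite /coordnorm mulrDr; apply: lerD.
  have -> : rosnorm del d p (zpart (on_coords (keep D a))) =
      rosnorm del d p (keep (zpred D) (zpart (on_coords a))).
    by apply: rosnorm_ext => i hi; rewrite /keep /zpred hi /= !zpart_on_coords.
  exact: rosnorm_keep.
rewrite mulr_sumr; apply: ler_sum => k _; rewrite mulr_sumr; apply: ler_sum => o _.
rewrite !gpart_ord /on_coords /keep; case: ifP => _.
  by rewrite ler_peMl // powR_ge0.
by rewrite normr0 powR0 ?gt_eqF // mulr_ge0 ?powR_ge0.
Qed.

Let block_constE : block_const = K * ((1 + C1) * (1 + C2)).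
Proof. by rewrite mulrA. Qed.

Let K_le1 : C1 * K <= block_const.
Proof.
rewrite block_constE mulrC; apply: ler_wpM2l => //.
by move: C1 C2 C10 C20 => c1 c2 h1 h2; have := mulr_ge0 h1 h2; lra.
Qed.

Let K_le2 : K * C2 <= block_const.
Proof.
rewrite block_constE; apply: ler_wpM2l => //.
by move: C1 C2 C10 C20 => c1 c2 h1 h2; have := mulr_ge0 h1 h2; lra.
Qed.

Let K_le3 : K * C1 * C2 <= block_const.
Proof.
rewrite block_constE -mulrA; apply: ler_wpM2l => //.
by move: C1 C2 C10 C20 => c1 c2 h1 h2; have := mulr_ge0 h1 h2; lra.
Qed.

Lemma block_systemP : block_system p block_const m A B.
Proof.
have unrank (i : nat) : (i < m)%N -> exists s : coords, i = enum_rank s.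
  by move=> hi; exists (enum_val (Ordinal hi)); rewrite enum_valK.
split.
- move=> i l /unrank[s ->] /unrank[u ->]; rewrite (inj_eq val_inj) (inj_eq enum_rank_inj).
  rewrite -(swindle_unswindle_mx hpq del01 s u).
  rewrite (sum_coords (fun c => A (enum_rank s) c * B c (enum_rank u))).
  by apply: eq_bigr => t _; rewrite /A /B !nat_mxE.
- move=> i l /unrank[s ->] /unrank[u ->]; rewrite (inj_eq val_inj) (inj_eq enum_rank_inj).
  rewrite -(unswindle_swindle_mx hpq del01 s u).
  rewrite (sum_coords (fun c => B (enum_rank s) c * A c (enum_rank u))).
  by apply: eq_bigr => t _; rewrite /A /B !nat_mxE.
- move=> D f; rewrite seqsum_A seqsum_coords.
  apply: (le_trans (swindle_le_coordnorm _)).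
  have h1 := ler_wpM2l C10 (coordnorm_keep D (mxapp m B f)).
  apply: (le_trans h1); rewrite on_coords_B.
  have h2 := unswindle_le hpq K1 est (on_coords f).
  rewrite mulrA; apply: (le_trans (ler_wpM2l (mulr_ge0 C10 K0) h2)).
  rewrite mulrA [C1 * K]mulrC; apply: ler_wpM2r; [exact: powsum_ge0|exact: K_le3].
- move=> a D t t0 ha; rewrite seqsum_A.
  apply: (le_trans (swindle_le_coordnorm _)).
  suff h : coordnorm p del (on_coords a) <= K * (t `^ p * (count_lt m D)%:R).
    apply: (le_trans (ler_wpM2l C10 h)); rewrite [C1 * _]mulrA; apply: ler_wpM2r.
      by rewrite mulr_ge0 ?powR_ge0.
    exact: K_le1.
  case: est => _ h2 _ _ _; rewrite -count_zpred mulrDr mulrDr; apply: lerD.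
    apply: h2 => // i; case: (ltnP i d) => hi.
      by rewrite zpart_on_coords // /zpred hi /=; exact: ha.
    by rewrite zpart_ge // normr0 mulr_ge0 ?ler0n.
  rewrite !mulr_sumr; apply: ler_sum => k _; rewrite !mulr_sumr; apply: ler_sum => o _.
  rewrite gpart_ord /on_coords; have := le_powR (ltW p0) (normr_ge0 _) (ha (enum_rank (inr (k, o) : coords))).
  rewrite powRM //; move/le_trans; apply.
  case: (D _) => /=; last by rewrite powR0 ?gt_eqF // !mulr0.
  by rewrite powR1 !mulr1 ler_peMl // powR_ge0.
- move=> a D t t0 ha; rewrite seqsum_A.
  suff h : t `^ p * (count_lt m D)%:R <= K * coordnorm p del (on_coords a).
    apply: (le_trans h); apply: (le_trans (ler_wpM2l K0 (coordnorm_le_swindle _))).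
    by rewrite mulrA; apply: ler_wpM2r; [exact: powsum_ge0|exact: K_le2].
  case: est => _ _ h3 _ _; rewrite -count_zpred mulrDr mulrDr; apply: lerD.
    apply: h3 => // i /andP[hi hD]; rewrite zpart_on_coords //; exact: ha.
  rewrite !mulr_sumr; apply: ler_sum => k _; rewrite !mulr_sumr; apply: ler_sum => o _.
  rewrite gpart_ord /on_coords; set i := enum_rank _.
  case: (boolP (D i)) => [/ha h|_] /=; last by rewrite mulr0 mulr_ge0 ?powR_ge0.
  rewrite mulr1; apply: (le_trans (le_powR (ltW p0) t0 h)).
  by rewrite ler_peMl // powR_ge0.
Qed.

Lemma seqsum_zpart a : powsum p (on_coords a) =
  seqsum d p (zpart (on_coords a)) + \sum_(k < d) powsum p (gpart (on_coords a) k).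
Proof. exact: powsum_coords. Qed.

Lemma distortedP : distorted p block_const th del d zpos m A.
Proof.
split.
- by move=> i hi; rewrite (zpos_ord (Ordinal hi) : zpos i = _) ltn_ord.
- move=> i l hi hl; rewrite (zpos_ord (Ordinal hi) : zpos i = _) (zpos_ord (Ordinal hl) : zpos l = _).
  by move=> /val_inj /enum_rank_inj [].
- move=> a D h hD hh; rewrite seqsum_A seqsum_coords.
  have hp := powR_ge0 h th.
  have hh' : \sum_(i < d) (zpred D i)%:R * del i <= h.
    apply: le_trans hh; apply: ler_sum => i _.
    by rewrite /zpred ltn_ord.
  have hD' i : ~~ zpred D i -> zpart (on_coords a) i = 0.
    rewrite /zpred; case: (ltnP i d) => hi /=; last by rewrite zpart_ge.
    by rewrite zpart_on_coords //; exact: hD.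
  case: est => _ _ _ h4 _; have [h5 h6] := h4 _ _ _ hD' hh'.
  have g0 : 0 <= \sum_(k < d) powsum p (gpart (on_coords a) k).
    by apply: sumr_ge0 => k _; exact: powsum_ge0.
  have KH : 1 <= K * (1 + h `^ th).
    by rewrite -[leLHS]mulr1 ler_pM // lerDl.
  have gK := ler_wpM2r g0 KH; rewrite mul1r in gK.
  have H0 : 0 <= 1 + h `^ th by lra.
  split.
    have h7 : coordnorm p del (on_coords a) <= K * (1 + h `^ th) * powsum p (on_coords a).
      by rewrite seqsum_zpart mulrDr; exact: lerD.
    apply: (le_trans (swindle_le_coordnorm _)); apply: (le_trans (ler_wpM2l C10 h7)).
    rewrite mulrA; apply: ler_wpM2r; first exact: powsum_ge0.
    rewrite mulrA; apply: ler_wpM2r => //.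
  have h7 : powsum p (on_coords a) <= K * (1 + h `^ th) * coordnorm p del (on_coords a).
    by rewrite seqsum_zpart mulrDr; exact: lerD.
  apply: (le_trans h7); apply: (le_trans (ler_wpM2l _ (coordnorm_le_swindle _))).
    by rewrite mulr_ge0.
  rewrite mulrA; apply: ler_wpM2r; first exact: powsum_ge0.
  by rewrite mulrAC; apply: ler_wpM2r => //; exact: K_le2.
(* The witness of sharp distortion is the extremal vector on the scalar coordinates, zero on the
   copies of l_p. *)
pose f (s : coords) : R := if s is inl i then extremal del p i else 0.
pose a (c : nat) : R := if insub c is Some c' then f (enum_val (c' : 'I_m)) else 0.
have fa : on_coords a = f by apply/funext => s; rewrite /on_coords /a valK enum_rankK.
have zf i : (i < d)%N -> zpart f i = extremal del p i.
  by move=> hi; rewrite (zpart_ord _ (Ordinal hi)).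
have g0 : \sum_(k < d) powsum p (gpart f k) = 0.
  apply: big1 => k _; apply: big1 => o _; by rewrite gpart_ord /f normr0 powR0 ?gt_eqF.
have es : seqsum m p a = seqsum d p (extremal del p).
  rewrite seqsum_coords seqsum_zpart fa g0 addr0.
  by apply: eq_bigr => i _; rewrite zf.
have ec : coordnorm p del f = rosnorm del d p (extremal del p).
  by rewrite /coordnorm g0 addr0; exact: rosnorm_ext.
have s0 := seqsum_ge0 d p (extremal del p).
exists a; split.
- move=> c hc; rewrite /a; case: insubP => // c' _ hc'.
  rewrite /f; case e : (enum_val c') => [i|//].
  case: (hc i) => //; rewrite zpos_ord -e enum_valK //.
- move=> hd; rewrite es seqsum_extremal // (bigD1 (Ordinal hd)) //=.
  apply: ltr_wpDr; last by case/andP: (del01 0).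
  by apply: sumr_ge0 => i _; case/andP: (del01 i) => /ltW.
move=> H; rewrite es seqsum_A fa.
have H0 : 0 <= H `^ th by exact: powR_ge0.
case: est => _ _ _ _ /=; rewrite -/H => -[h|h]; [left|right].
  apply: (le_trans h); rewrite -ec; apply: (le_trans (ler_wpM2l K0 (coordnorm_le_swindle _))).
  by rewrite mulrA; apply: ler_wpM2r; [exact: powsum_ge0|exact: K_le2].
apply: (le_trans (ler_wpM2l H0 (swindle_le_coordnorm _))); rewrite ec mulrCA.
apply: (le_trans (ler_wpM2l C10 h)); rewrite [C1 * _]mulrA; apply: ler_wpM2r => //.
Qed.

End Construction.

Definition id_mx (i c : nat) : R := (i == c)%:R.

Lemma mxapp_id m a i : (i < m)%N -> mxapp m id_mx a i = a i.
Proof.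
move=> hi; rewrite /mxapp (bigD1 (Ordinal hi)) //= /id_mx eqxx mul1r big1 ?addr0 // => c.
by rewrite -val_eqE /= eq_sym => /negbTE ->; rewrite mul0r.
Qed.

Lemma seqsum_id p m a : seqsum m p (mxapp m id_mx a) = seqsum m p a.
Proof. by apply: eq_bigr => i _; rewrite mxapp_id. Qed.

Lemma id_block_system p K m : 0 < p -> 1 <= K -> block_system p K m id_mx id_mx.
Proof.
move=> p0 K1.
have inv i l : (i < m)%N -> \sum_(c < m) id_mx i c * id_mx c l = (i == l)%:R.
  by move=> hi; rewrite -/(mxapp m id_mx (fun c => id_mx c l) i) mxapp_id.
split; [by move=> i l /inv|by move=> i l /inv| | |].
- move=> D f; rewrite seqsum_id; apply: (@le_trans _ _ (seqsum m p f)).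
    rewrite -[leRHS](seqsum_id p m f); exact: seqsum_keep.
  by rewrite ler_peMl // seqsum_ge0.
- move=> a D t t0 ha; rewrite seqsum_id.
  apply: (le_trans (seqsum_bounded_on m p0 t0 ha)).
  by rewrite ler_peMl // mulr_ge0 ?powR_ge0.
- move=> a D t t0 ha; rewrite seqsum_id.
  apply: (le_trans (seqsum_lower m p0 t0 ha)).
  by rewrite ler_peMl // seqsum_ge0.
Qed.

Theorem block_systems_exist p : 1 < p -> p != 2 ->
  exists K th, [/\ 1 <= K, 0 < th & forall del d, (forall i, 0 < del i <= 1) ->
    (forall i, del i <= i.+1%:R^-1) ->
    exists m A B pos, block_system p K m A B /\ distorted p K th del d pos m A].
Proof.
move=> p1 p2; have [q [K [th [hpq K1 th0 est]]]] := ros_estimatesP p1 p2.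
exists (block_const p K), th; split => //.
  have c0 : 0 <= swindle_const p K.
    by rewrite /swindle_const !mulr_ge0 ?addr_ge0 ?mulr_ge0 ?powR_ge0 // (le_trans _ K1).
  rewrite /block_const -[leLHS]mulr1 ler_pM //.
    by rewrite -[leLHS]mulr1 ler_pM // lerDl.
  by rewrite lerDl; apply: mulr_ge0; [apply: mulr_ge0|exact: powR_ge0].
move=> del d h1 h2.
have e := est _ d h1 h2.
exists #|{: 'I_d + 'I_d * outcome d}|, (nat_mx (swindle_mx p q del (d := d))),
  (nat_mx (unswindle_mx p q del (d := d))), (zpos d).
split; first exact: (block_systemP hpq K1 h1 e).
exact: (distortedP hpq K1 h1 e).
Qed.

End BlockSystems.

(** * Block bases of T^(p) *)

Section Scalars.
Variables (R : realType) (F : scalars).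
Local Notation K := (scalar_field R F).
Local Notation abs := (@modulus R F).
Implicit Types (z w : K) (r s : R).

Definition sc_re : K -> R :=
  match F return scalar_field R F -> R with
  | RealScalars => fun x : R => x
  | ComplexScalars => fun z : R[i] => complex.Re z
  end.

Definition sc_im : K -> R :=
  match F return scalar_field R F -> R with
  | RealScalars => fun _ => 0
  | ComplexScalars => fun z : R[i] => complex.Im z
  end.

Definition sc_inj : R -> K :=
  match F return R -> scalar_field R F with
  | RealScalars => fun r : R => r
  | ComplexScalars => fun r : R => (r%:C)%C
  end.

Lemma sc_reD z w : sc_re (z + w) = sc_re z + sc_re w.
Proof. by rewrite /sc_re; case: F z w => //= -[a b] [c d]. Qed.
Lemma sc_imD z w : sc_im (z + w) = sc_im z + sc_im w.
Proof. by rewrite /sc_im; case: F z w => [|[a b] [c d]] //=; rewrite addr0. Qed.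
Lemma sc_re_inj r z : sc_re (sc_inj r * z) = r * sc_re z.
Proof. by rewrite /sc_re /sc_inj; case: F z => // -[a b] /=; rewrite mul0r subr0. Qed.
Lemma sc_im_inj r z : sc_im (sc_inj r * z) = r * sc_im z.
Proof. by rewrite /sc_im /sc_inj; case: F z => [x|[a b]] /=; rewrite ?mulr0 // mul0r addr0. Qed.
Lemma sc_re0 : sc_re 0 = 0.
Proof. by rewrite /sc_re; case: F. Qed.
Lemma sc_im0 : sc_im 0 = 0.
Proof. by rewrite /sc_im; case: F. Qed.
Lemma sc_injM r s : sc_inj (r * s) = sc_inj r * sc_inj s.
Proof. by rewrite /sc_inj; case: F => //; rewrite rmorphM. Qed.
Lemma sc_injD r s : sc_inj (r + s) = sc_inj r + sc_inj s.
Proof. by rewrite /sc_inj; case: F => //; rewrite rmorphD. Qed.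
Lemma sc_inj0 : sc_inj 0 = 0.
Proof. by rewrite /sc_inj; case: F. Qed.
Lemma sc_inj1 : sc_inj 1 = 1.
Proof. by rewrite /sc_inj; case: F. Qed.
Lemma abs_re_le z : `|sc_re z| <= abs z.
Proof.
rewrite /sc_re /modulus; case: F z => [x|[a b]] /=; first exact: lexx.
by rewrite -sqrtr_sqr ler_wsqrtr // lerDl sqr_ge0.
Qed.
Lemma abs_im_le z : `|sc_im z| <= abs z.
Proof.
rewrite /sc_im /modulus; case: F z => [x|[a b]] /=; first by rewrite normr0.
by rewrite -sqrtr_sqr ler_wsqrtr // lerDr sqr_ge0.
Qed.
Lemma abs_le_parts z : abs z <= `|sc_re z| + `|sc_im z|.
Proof.
rewrite /sc_re /sc_im /modulus; case: F z => [x|[a b]] /=; first by rewrite normr0 addr0.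
have h : 0 <= `|a| + `|b| by rewrite addr_ge0.
rewrite -[leRHS](ger0_norm h) -[leRHS]sqrtr_sqr ler_wsqrtr // sqrrD -!normrX !(ger0_norm (sqr_ge0 _)).
by rewrite lerD2r lerDl mulrn_wge0 // mulr_ge0.
Qed.
Lemma abs_ge0 z : 0 <= abs z.
Proof. by apply: le_trans (abs_re_le z). Qed.
Lemma abs0 : abs 0 = 0.
Proof.
apply/eqP; rewrite eq_le abs_ge0 andbT; apply: (le_trans (abs_le_parts 0)).
by rewrite sc_re0 sc_im0 normr0 addr0.
Qed.
Lemma absD z w : abs (z + w) <= abs z + abs w.
Proof.
by rewrite /modulus; case: F z w => [x y|x y] /=; [exact: ler_normD|exact: le_normcD].
Qed.
Lemma absM z w : abs (z * w) = abs z * abs w.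
Proof.
by rewrite /modulus; case: F z w => [x y|x y] /=; [exact: normrM|exact: ComplexField.Normc.normcM].
Qed.
Lemma abs_inj r : abs (sc_inj r) = `|r|.
Proof.
rewrite /modulus /sc_inj; case: F => //=.
by rewrite expr0n /= addr0 sqrtr_sqr.
Qed.
Lemma abs1 : abs 1 = 1.
Proof. by rewrite -sc_inj1 abs_inj normr1. Qed.
Lemma absN z : abs (- z) = abs z.
Proof.
have h : abs (-1) = 1.
  have -> : -1 = sc_inj (-1) :> K.
    by apply/eqP; rewrite eq_sym -addr_eq0 -sc_inj1 -sc_injD addNr sc_inj0.
  by rewrite abs_inj normrN normr1.
by rewrite -mulN1r absM h mul1r.
Qed.
Lemma abs_eq0 z : abs z = 0 -> z = 0.
Proof.
rewrite /modulus; case: F z => [x|x] /=; first exact: normr0_eq0.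
exact: ComplexField.Normc.eq0_normc.
Qed.
Lemma absB z w : abs (z - w) <= abs z + abs w.
Proof. by rewrite -(absN w); exact: absD. Qed.

End Scalars.

(** * Existence of greedy orderings *)

Section GreedyOrdering.
Variables (R : realType) (K : numFieldType) (abs : K -> R).
Hypothesis abs_ge0' : forall z, 0 <= abs z.
Hypothesis abs_eq0' : forall z, abs z = 0 -> z = 0.
Variable a : nat -> K.
Hypothesis level_bounded : forall w, 0 < w -> exists n : nat,
  forall S : {fset nat}, (forall i, i \in S -> w <= abs (a i)) -> (#|` S| <= n)%N.

Definition precedes (i n : nat) : Prop :=
  abs (a n) < abs (a i) \/ abs (a i) = abs (a n) /\ (i <= n)%N.

Lemma precedes_trans i n k : precedes i n -> precedes n k -> precedes i k.
Proof.
move=> [h1|[h1 h2]] [h3|[h3 h4]].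
- by left; exact: lt_trans h3 h1.
- by left; rewrite -h3.
- by left; rewrite h1.
- by right; rewrite h1 h3; split => //; exact: leq_trans h2 h4.
Qed.

Lemma precedes_total i n : precedes i n \/ precedes n i.
Proof.
case: (ltgtP (abs (a i)) (abs (a n))) => h; [by right; left|by left; left|].
by case: (leqP i n) => h'; [left|right]; right; split => //; exact: ltnW.
Qed.

Lemma precedes_min (r : seq nat) : r != [::] ->
  exists2 n, n \in r & forall i, i \in r -> precedes n i.
Proof.
elim: r => // k r IH _; case: (eqVneq r [::]) => [->|/IH[n hn hmin]].
  by exists k => [|i]; rewrite ?mem_head // inE => /eqP ->; right.
case: (precedes_total k n) => h.
  exists k => [|i]; rewrite ?mem_head // inE => /orP[/eqP ->|hi]; first by right.
  exact: precedes_trans h (hmin _ hi).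
by exists n => [|i]; rewrite ?inE ?hn ?orbT // => /orP[/eqP ->|/hmin].
Qed.

Lemma level_finite w : 0 < w -> exists r : seq nat, forall i, w <= abs (a i) -> i \in r.
Proof.
move=> /level_bounded[n hn].
case: (pselect (finite_set [set i | w <= abs (a i)])) => [/finite_fsetP[S hS]|h].
  exists (enum_fset S) => i hi.
  by have : [set j | w <= abs (a j)] i by []; rewrite hS.
have [S hS1 hS2] := infinite_set_fset n.+1 h.
by have := hn S (fun i hi => hS1 i hi); rewrite leqNgt hS2.
Qed.

(** While a nonzero coefficient remains, the maximum is taken over a finite level set; once all
    remaining coefficients vanish, the least index comes next, which keeps the ordering defined on
    all of the natural numbers. *)
Lemma next_exists (S : {fset nat}) :
  exists2 n, n \notin S & forall i, i \notin S -> precedes n i.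
Proof.
case: (pselect (exists2 i0, i0 \notin S & 0 < abs (a i0))) => [[i0 hi0 h0]|h].
  have [r hr] := level_finite h0.
  pose r' := [seq i <- r | i \notin S].
  have hi0r : i0 \in r' by rewrite mem_filter hi0 hr.
  have hne : r' != [::] by apply/eqP => e; rewrite e in hi0r.
  have [n hn hmin] := precedes_min hne; exists n.
    by move: hn; rewrite mem_filter => /andP[].
  move=> i hi; case: (leP (abs (a i0)) (abs (a i))) => hle.
    by apply: hmin; rewrite mem_filter hi hr.
  apply: precedes_trans (hmin _ hi0r) _; by left.
have ex : exists n, n \notin S.
  exists (\max_(n <- S) n).+1; apply/negP => hn.
  by have := @leq_bigmax_seq _ (enum_fset S) xpredT (fun i => i) _ hn isT; rewrite ltnn.
case: (ex_minnP ex) => n hn hmin; exists n => // i hi; right; split; last exact: hmin.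
have z k : k \notin S -> abs (a k) = 0.
  move=> hk; apply/eqP; rewrite eq_le abs_ge0' andbT leNgt; apply/negP => hk'.
  by apply: h; exists k.
by rewrite !z.
Qed.

(** [sel k] is the set of the first k choices. An index with nonzero coefficient that is never
    chosen would be preceded by every chosen one, which would put infinitely many indices into a
    single level set. *)
Lemma greedy_ordering_exists : exists rho, is_greedy_ordering abs a rho.
Proof.
have ex (S : {fset nat}) : exists n, n \notin S /\ forall i, i \notin S -> precedes n i.
  by have [n h1 h2] := next_exists S; exists n.
have [next hnext] := boolp.choice ex.
pose sel := fix sel k : {fset nat} := if k is k'.+1 then (next (sel k') |` sel k')%fset else fset0.
pose rho k := next (sel k).
have notin k : rho k \notin sel k by case: (hnext (sel k)).
have prec k i : i \notin sel k -> precedes (rho k) i by case: (hnext (sel k)) => _; apply.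
have selS k : sel k.+1 = (rho k |` sel k)%fset by [].
have sub j k : (j <= k)%N -> (sel j `<=` sel k)%fset.
  elim: k => [|k IH]; first by rewrite leqn0 => /eqP ->.
  rewrite leq_eqVlt => /orP[/eqP -> //|]; rewrite ltnS => /IH h.
  by apply: (fsubset_trans h); rewrite selS fsubsetU1.
have rho_in j k : (j < k)%N -> rho j \in sel k.
  by move=> hjk; apply: (fsubsetP (sub _ _ hjk)); rewrite selS fset1U1.
have neq j k : (j < k)%N -> rho j != rho k.
  by move=> /rho_in h; apply: contraNneq (notin k) => <-.
have card k : #|` sel k| = k.
  by elim: k => [|k IH]; [rewrite cardfs0|rewrite selS cardfsU1 notin IH].
exists rho; split.
- move=> j k; apply: contra_eq; rewrite neq_ltn => /orP[/neq //|/neq].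
  by rewrite eq_sym.
- move=> n /= hn; apply: contrapT => hrange.
  have hnot k : n \notin sel k.
    elim: k => [|k IH]; first by rewrite inE.
    by rewrite selS in_fset1U (negbTE IH) orbF; apply/eqP => e; apply: hrange; exists k.
  have pos : 0 < abs (a n).
    rewrite lt_def abs_ge0' andbT; apply: contra_neq hn; exact: abs_eq0'.
  have [B hB] := level_bounded pos.
  suff : (#|` sel B.+1| <= B)%N by rewrite card ltnn.
  apply: hB.
  have h k : forall i, i \in sel k -> abs (a n) <= abs (a i).
    elim: k => [i|k IH i]; first by rewrite inE.
    rewrite selS in_fset1U => /orP[/eqP ->|/IH //].
    by case: (prec k n (hnot k)) => [/ltW|[-> _]].
  exact: h.
- move=> j k hjk.
  have : rho k \notin sel j by apply: contra (notin k); exact: (fsubsetP (sub _ _ (ltnW hjk))).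
  move=> /prec[h|[h1 h2]]; [by left|right; split => //].
  by rewrite ltn_neqAle h2 andbT; exact: neq.
Qed.

End GreedyOrdering.

(** * Blockwise domination in Tsirelson's space *)

Section SpaceBlockDomination.
Variable R : realType.
Variables t e : nat -> nat.
Hypothesis te : forall j, (t j <= e j)%N.
Hypothesis tlen : forall j, (e j <= t j + (t j).+1)%N.
Hypothesis tlac : forall j, (4 * e j <= t j.+1)%N.
Hypothesis tid : forall j, (j <= t j)%N.
Local Notation N := (tn (R := R) succn).
Local Notation tsn := (tsirelson_space_norm (R := R)).

(** The finite estimate needs windows that cut no block, so arbitrary windows are first enlarged to
    begin and end at block starts; monotonicity of the norm permits this. *)
Lemma tsn_block_dom (K : R) (a b : nat -> R) : 0 <= K -> tsirelson_space b ->
  (forall n, (forall j, ~~ (t j <= n < e j)%N) -> `|a n| <= K * `|b n|) ->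
  (forall j, blocksum t e a j <= K * blocksum t e b j) ->
  tsirelson_space a /\ tsn a <= 5 * K * tsn b.
Proof.
move=> K0 hb hoff hon.
have key i l : (forall j, (i <= t j)%N \/ (e j <= i)%N) ->
    N (window i (t l) a) <= 5 * K * N (window i (t l) b).
  move=> hi.
  apply: (tn_block_dom te tlen tlac tid K0 (@vanishes_from_window_end _ i (t l) a)
            (@vanishes_from_window_end _ i (t l) b)).
    move=> n hn; rewrite /window; case: ifP => _; first exact: hoff.
    by rewrite normr0 mulr0.
  move=> j; case: (pselect ((i <= t j)%N /\ (j < l)%N)) => hj.
    have w x : blocksum t e (window i (t l) x) j = blocksum t e x j.
      apply: eq_big_nat => n /andP[h1 h2]; rewrite /window.
      by rewrite (leq_trans hj.1 h1) (leq_trans h2 (e_le_t te tlac hj.2)).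
    by rewrite !w.
  rewrite blocksum_eq0 ?mulr_ge0 ?blocksum_ge0 // => n /andP[h1 h2].
  rewrite /window; case: ifP => // /andP[h3 h4]; exfalso; apply: hj; split.
    by case: (hi j) => // h; lia.
  by rewrite ltnNge; apply/negP => /(t_mono te tlac); lia.
have safe l j : (t l <= t j)%N \/ (e j <= t l)%N.
  by case: (leqP l j) => [/(t_mono te tlac)|/(e_le_t te tlac)]; [left|right].
have ha : tsirelson_space a.
  apply/tsirelson_spaceP => x x0.
  have x1 : 0 < x / (5 * K + 1) by rewrite divr_gt0 // ltr_wpDl // mulr_ge0.
  have [n0 hn0] := (tsirelson_spaceP b).1 hb _ x1.
  exists (t n0) => i n /andP[hi hin].
  apply: (@le_lt_trans _ _ (N (window (t n0) (t n) a))).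
    by apply: tn_window_mono.
  apply: (le_lt_trans (key _ _ (safe n0))).
  have hN : N (window (t n0) (t n) b) < x / (5 * K + 1).
    apply: hn0; rewrite tid /=; apply: (t_mono te tlac).
    by apply: leq_trans hin; apply: leq_trans hi; exact: tid.
  have K5 : 0 <= 5 * K by rewrite mulr_ge0.
  apply: (le_lt_trans (ler_wpM2l K5 (ltW hN))).
  rewrite mulrA ltr_pdivrMr; last by rewrite ltr_wpDl.
  by rewrite mulrC ltr_pM2l // ltrDl.
split => //; apply: tsn_le => // n.
apply: (@le_trans _ _ (N (window 0 (t n) a))); first exact: tn_window_mono.
apply: (le_trans (key _ _ _)); first by move=> j; left.
by apply: ler_wpM2l; [rewrite mulr_ge0|exact: window_le_tsn].
Qed.

End SpaceBlockDomination.

(** * Diagonal sums of block operators and greediness of their bases *)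

Section BlockOperators.
Variables (R : realType) (F : scalars) (p : R).
Hypothesis p1 : 1 < p.
Local Notation K := (scalar_field R F).
Local Notation abs := (@modulus R F).
Local Notation V := (scalar_seq R F).
Variables t m : nat -> nat.
Variables A B : nat -> nat -> nat -> R.
Variable K0 : R.
Hypothesis K01 : 1 <= K0.
Hypothesis tm : forall j, (m j <= (t j).+1)%N.
Hypothesis tlac : forall j, (4 * (t j + m j) < t j.+1)%N.
Hypothesis sys : forall j, block_system p K0 (m j) (A j) (B j).
Implicit Types (f g a : nat -> K) (M : nat -> nat -> nat -> R) (D : pred nat).

Let e j := (t j + m j)%N.
Let p0 : 0 < p. Proof. exact: lt_trans p1. Qed.

Lemma block_te j : (t j <= e j)%N. Proof. exact: leq_addr. Qed.
Lemma block_tlen j : (e j <= t j + (t j).+1)%N. Proof. by rewrite leq_add2l. Qed.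
Lemma block_tlac j : (4 * e j <= t j.+1)%N. Proof. exact: ltnW (tlac j). Qed.
Lemma block_tid j : (j <= t j)%N.
Proof. by elim: j => // j IH; have := tlac j; lia. Qed.

Local Notation bsum := (blocksum t e).

Lemma block_index_ex k : exists j, (k < t j.+1)%N.
Proof. by exists k; exact: (block_tid k.+1). Qed.

Definition block_index k := ex_minn (block_index_ex k).

Lemma block_indexE j k : (t j <= k < e j)%N -> block_index k = j.
Proof.
move=> /andP[h1 h2]; rewrite /block_index; case: ex_minnP => i hi hmin.
have hj : (k < t j.+1)%N by have := block_tlac j; lia.
have := hmin _ hj; rewrite leq_eqVlt => /orP[/eqP //|hij].
by have := t_mono block_te block_tlac hij; lia.
Qed.

Definition in_block k := (t (block_index k) <= k < e (block_index k))%N.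

Lemma in_blockP k : reflect (exists j, (t j <= k < e j)%N) (in_block k).
Proof.
apply: (iffP idP) => [h|[j hj]]; first by exists (block_index k).
by rewrite /in_block (block_indexE hj).
Qed.

Lemma off_block k : ~~ in_block k <-> forall j, ~~ (t j <= k < e j)%N.
Proof.
split=> [h j|h]; first by apply: contra h => hj; apply/in_blockP; exists j.
by apply/negP => /in_blockP[j]; apply/negP.
Qed.

Definition blockop M f : nat -> K := fun k =>
  if in_block k then
    let j := block_index k in
    \sum_(c < m j) sc_inj F (M j (k - t j)%N c) * f (t j + c)%N
  else f k.

Lemma blockop_in M f j x : (x < m j)%N ->
  blockop M f (t j + x)%N = \sum_(c < m j) sc_inj F (M j x c) * f (t j + c)%N.
Proof.
move=> hx; have h : (t j <= t j + x < e j)%N by rewrite leq_addr ltn_add2l.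
by rewrite /blockop /in_block (block_indexE h) h addKn.
Qed.

Lemma blockop_off M f k : ~~ in_block k -> blockop M f k = f k.
Proof. by rewrite /blockop => /negbTE ->. Qed.

Lemma in_block_split k : in_block k -> exists j x, (x < m j)%N /\ k = (t j + x)%N.
Proof.
move=> /in_blockP[j /andP[h1 h2]]; exists j, (k - t j)%N; split; last by rewrite subnKC.
by rewrite ltn_subLR.
Qed.

Lemma blockopP M (c : K) f g k :
  blockop M (fun n => c * f n + g n) k = c * blockop M f k + blockop M g k.
Proof.
rewrite /blockop; case: ifP => // _ /=.
rewrite mulr_sumr -big_split /=; apply: eq_bigr => i _; ring.
Qed.

Lemma blockop0 M k : blockop M (fun _ => 0) k = 0.
Proof. by rewrite /blockop; case: ifP => // _; rewrite big1 // => i _; rewrite mulr0. Qed.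

Lemma blockop_sum M (r : seq nat) (c : nat -> K) (u : nat -> nat -> K) k :
  blockop M (fun n => \sum_(i <- r) c i * u i n) k = \sum_(i <- r) c i * blockop M (u i) k.
Proof.
elim: r => [|i r IH].
  have -> : (fun n => \sum_(i <- [::]) c i * u i n) = fun _ => 0.
    by apply/funext => n; rewrite big_nil.
  by rewrite big_nil blockop0.
rewrite big_cons -IH -blockopP.
by apply: (congr1 (fun f => blockop M f k)); apply/funext => n; rewrite big_cons.
Qed.

Lemma sc_inj_sum (I : Type) (r : seq I) (G : I -> R) :
  sc_inj F (\sum_(i <- r) G i) = \sum_(i <- r) sc_inj F (G i).
Proof.
by elim: r => [|i r IH]; rewrite ?big_nil ?sc_inj0 // !big_cons sc_injD IH.
Qed.

Lemma blockop_inv M M' f :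
  (forall j i l, (i < m j)%N -> (l < m j)%N -> \sum_(c < m j) M j i c * M' j c l = (i == l)%:R) ->
  blockop M (blockop M' f) = f.
Proof.
move=> h; apply/funext => k; case: (boolP (in_block k)) => hk; last by rewrite !blockop_off.
have [j [x [hx ->]]] := in_block_split hk; rewrite blockop_in //.
transitivity (\sum_(l < m j) \sum_(c < m j) sc_inj F (M j x c * M' j c l) * f (t j + l)%N).
  rewrite exchange_big /=; apply: eq_bigr => c _; rewrite blockop_in // mulr_sumr.
  by apply: eq_bigr => l _; rewrite sc_injM mulrA.
rewrite (bigD1 (Ordinal hx)) //= -mulr_suml -sc_inj_sum h // eqxx sc_inj1 mul1r.
rewrite big1 ?addr0 // => l; rewrite -val_eqE /= => hl.
by rewrite -mulr_suml -sc_inj_sum h // eq_sym (negbTE hl) sc_inj0 mul0r.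
Qed.

Lemma blockAB f : blockop A (blockop B f) = f.
Proof. by apply: blockop_inv => j i l hi hl; case: (sys j) => h _ _ _ _; exact: h. Qed.
Lemma blockBA f : blockop B (blockop A f) = f.
Proof. by apply: blockop_inv => j i l hi hl; case: (sys j) => _ h _ _ _; exact: h. Qed.

Definition lre f j (c : nat) : R := sc_re (f (t j + c)%N).
Definition lim_ f j (c : nat) : R := sc_im (f (t j + c)%N).

Lemma lre_blockop M f j x : (x < m j)%N -> lre (blockop M f) j x = mxapp (m j) (M j) (lre f j) x.
Proof.
move=> hx; rewrite /lre blockop_in // /mxapp.
rewrite (big_morph (@sc_re R F) (@sc_reD R F) (sc_re0 R F)).
by apply: eq_bigr => c _; rewrite sc_re_inj.
Qed.

Lemma lim_blockop M f j x : (x < m j)%N -> lim_ (blockop M f) j x = mxapp (m j) (M j) (lim_ f j) x.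
Proof.
move=> hx; rewrite /lim_ blockop_in // /mxapp.
rewrite (big_morph (@sc_im R F) (@sc_imD R F) (sc_im0 R F)).
by apply: eq_bigr => c _; rewrite sc_im_inj.
Qed.

Local Notation apow := (abs_pow p).

Lemma apow_ge0 f k : 0 <= apow f k.
Proof. exact: powR_ge0. Qed.

Lemma bsumE (a : nat -> R) j : bsum a j = \sum_(c < m j) `|a (t j + c)%N|.
Proof.
rewrite /blocksum /e -{1}[t j]add0n big_addn addKn big_mkord.
by apply: eq_bigr => c _; rewrite addnC.
Qed.

Lemma bsum_apow f j : bsum (apow f) j = \sum_(c < m j) abs (f (t j + c)%N) `^ p.
Proof. by rewrite bsumE; apply: eq_bigr => c _; rewrite ger0_norm // powR_ge0. Qed.

Lemma bsum_apow_le f j :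
  bsum (apow f) j <= 2 `^ p * (seqsum (m j) p (lre f j) + seqsum (m j) p (lim_ f j)).
Proof.
rewrite bsum_apow -big_split /= mulr_sumr; apply: ler_sum => c _.
apply: (le_trans (le_powR (ltW p0) (abs_ge0 _) (abs_le_parts _))).
by apply: powR_quasi => //; exact: ltW.
Qed.

Lemma lre_le_bsum f j : seqsum (m j) p (lre f j) <= bsum (apow f) j.
Proof. by rewrite bsum_apow; apply: ler_sum => c _; apply: le_powR => //; [exact: ltW|exact: abs_re_le]. Qed.

Lemma lim_le_bsum f j : seqsum (m j) p (lim_ f j) <= bsum (apow f) j.
Proof. by rewrite bsum_apow; apply: ler_sum => c _; apply: le_powR => //; [exact: ltW|exact: abs_im_le]. Qed.

Lemma seqsum_eq n (a b : nat -> R) : (forall i, (i < n)%N -> a i = b i) -> seqsum n p a = seqsum n p b.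
Proof. by move=> h; apply: eq_bigr => i _; rewrite h. Qed.

Definition keepK D f : nat -> K := fun k => if D k then f k else 0.

(** The factor 2^p comes from bounding the modulus by the sum of real and imaginary part, the factor
    2 from bounding each part by the same quantity. *)
Definition CK : R := 2 * 2 `^ p * K0.

Let twop0 : 0 <= 2 `^ p :> R. Proof. exact: powR_ge0. Qed.
Let K00 : 0 <= K0. Proof. exact: le_trans K01. Qed.

Lemma CK_ge1 : 1 <= CK.
Proof.
have h : 1 <= 2 `^ p :> R.
  have h2 : 1 <= 2 :> R by lra.
  by have := ler_powR h2 (ltW p0); rewrite powRr0.
rewrite /CK -[leLHS]mulr1; apply: ler_pM => //.
by have := twop0; lra.
Qed.

Let CK0 : 0 <= CK. Proof. exact: le_trans CK_ge1. Qed.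

Lemma le_CK x y z w : x <= 2 `^ p * (y + z) -> y <= K0 * w -> z <= K0 * w -> x <= CK * w.
Proof.
move=> h1 h2 h3; apply: (le_trans h1).
have := ler_wpM2l twop0 (lerD h2 h3); rewrite /CK; lra.
Qed.

Lemma mxapp_ext n (M : nat -> nat -> R) (a b : nat -> R) i : (forall c, (c < n)%N -> a c = b c) ->
  mxapp n M a i = mxapp n M b i.
Proof. by move=> h; apply: eq_bigr => c _; rewrite h. Qed.

Lemma bsum_proj D f j :
  bsum (apow (blockop A (keepK D (blockop B f)))) j <= CK * bsum (apow f) j.
Proof.
case: (sys j) => _ _ h _ _; set g := blockop A _.
pose D' c := D (t j + c)%N.
apply: (le_CK (bsum_apow_le g j)).
  apply: (@le_trans _ _ (K0 * seqsum (m j) p (lre f j))); last by apply: ler_wpM2l => //; exact: lre_le_bsum.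
  apply: le_trans (h D' (lre f j)); rewrite le_eqVlt; apply/orP; left; apply/eqP.
  apply: seqsum_eq => x hx; rewrite lre_blockop //; apply: mxapp_ext => c hc.
  by rewrite /keep /D' -lre_blockop // /lre /keepK; case: ifP; rewrite ?sc_re0.
apply: (@le_trans _ _ (K0 * seqsum (m j) p (lim_ f j))); last by apply: ler_wpM2l => //; exact: lim_le_bsum.
apply: le_trans (h D' (lim_ f j)); rewrite le_eqVlt; apply/orP; left; apply/eqP.
apply: seqsum_eq => x hx; rewrite lim_blockop //; apply: mxapp_ext => c hc.
by rewrite /keep /D' -lim_blockop // /lim_ /keepK; case: ifP; rewrite ?sc_im0.
Qed.

(** A multiple of an indicator in Tsirelson's space itself; it is used with w^p, the p-th power of a
    coefficient of modulus w. *)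
Definition weight (w : R) D : nat -> R := fun k => w * (D k)%:R.

Lemma bsum_weight w D j : 0 <= w ->
  bsum (weight w D) j = w * (count_lt (m j) (fun c => D (t j + c)%N))%:R.
Proof.
move=> w0; rewrite bsumE -count_ltE mulr_sumr; apply: eq_bigr => c _.
by rewrite ger0_norm // mulr_ge0.
Qed.

Lemma bsum_upper D (w : R) a j : 0 <= w -> (forall i, abs (a i) <= w * (D i)%:R) ->
  bsum (apow (blockop A a)) j <= CK * bsum (weight (w `^ p) D) j.
Proof.
move=> w0 ha; case: (sys j) => _ _ _ h _; rewrite bsum_weight ?powR_ge0 //.
apply: (le_CK (bsum_apow_le _ j)).
  rewrite (seqsum_eq (b := mxapp (m j) (A j) (lre a j))); last by move=> x; exact: lre_blockop.
  by apply: h => // i; apply: le_trans (ha _); exact: abs_re_le.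
rewrite (seqsum_eq (b := mxapp (m j) (A j) (lim_ a j))); last by move=> x; exact: lim_blockop.
by apply: h => // i; apply: le_trans (ha _); exact: abs_im_le.
Qed.

(* Where the modulus is at least w, the real or the imaginary part is at least w / 2. *)
Lemma bsum_lower D (w : R) a j : 0 <= w -> (forall i, D i -> w <= abs (a i)) ->
  bsum (weight (w `^ p) D) j <= CK * bsum (apow (blockop A a)) j.
Proof.
move=> w0 ha; case: (sys j) => _ _ _ _ h; rewrite bsum_weight ?powR_ge0 //.
have w2 : 0 <= w / 2 by rewrite divr_ge0.
pose D1 c := D (t j + c)%N && (w / 2 <= `|lre a j c|).
pose D2 c := D (t j + c)%N && (w / 2 <= `|lim_ a j c|).
have h1 := h (lre a j) D1 _ w2 (fun i hi => proj2 (andP hi)).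
have h2 := h (lim_ a j) D2 _ w2 (fun i hi => proj2 (andP hi)).
set S := bsum (apow (blockop A a)) j.
have e1 : seqsum (m j) p (mxapp (m j) (A j) (lre a j)) <= S.
  apply: le_trans (lre_le_bsum _ _); rewrite le_eqVlt; apply/orP; left; apply/eqP.
  by apply: seqsum_eq => x hx; rewrite lre_blockop.
have e2 : seqsum (m j) p (mxapp (m j) (A j) (lim_ a j)) <= S.
  apply: le_trans (lim_le_bsum _ _); rewrite le_eqVlt; apply/orP; left; apply/eqP.
  by apply: seqsum_eq => x hx; rewrite lim_blockop.
have hcount : (count_lt (m j) (fun c => D (t j + c)%N) <= count_lt (m j) D1 + count_lt (m j) D2)%N.
  rewrite /count_lt -big_split /=; apply: leq_sum => c _; rewrite /D1 /D2.
  case: (boolP (D _)) => //= hD.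
  case: (leP (w / 2) `|lre a j c|) => //= h3; case: (leP (w / 2) `|lim_ a j c|) => //= h4.
  by have := ha _ hD; have := abs_le_parts (a (t j + c)%N); rewrite /lre /lim_ in h3 h4; lra.
have ew : w `^ p = 2 `^ p * (w / 2) `^ p by rewrite -powRM // mulrC divfK.
have hw := powR_ge0 (w / 2) p.
have hc : (count_lt (m j) (fun c => D (t j + c)%N))%:R <= (count_lt (m j) D1)%:R + (count_lt (m j) D2)%:R :> R.
  by rewrite -natrD ler_nat.
apply: (@le_CK _ _ _ _ _ (le_trans h1 (ler_wpM2l K00 e1)) (le_trans h2 (ler_wpM2l K00 e2))).
by rewrite ew -mulrA; apply: ler_wpM2l => //; rewrite -mulrDr; apply: ler_wpM2l.
Qed.

Local Notation tsn := (tsirelson_space_norm (R := R)).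
Local Notation X := (@tsirelson_conv R F p).
Local Notation T f := (tsn (apow f)).
Local Notation dom := (tsn_block_dom block_te block_tlen block_tlac block_tid).

Lemma off_apow_le f g k c : 1 <= c -> abs (f k) <= abs (g k) -> `|apow f k| <= c * `|apow g k|.
Proof.
move=> c1 h; rewrite !ger0_norm ?apow_ge0 //.
apply: (@le_trans _ _ (apow g k)); last by rewrite ler_peMl // apow_ge0.
by apply: le_powR => //; [exact: ltW|exact: abs_ge0].
Qed.

Lemma proj_bound D f : X f ->
  X (blockop A (keepK D (blockop B f)) : V) /\
  T (blockop A (keepK D (blockop B f))) <= 5 * CK * T f.
Proof.
move=> hf; apply: (dom CK0 hf); last by move=> j; exact: bsum_proj.
move=> n /off_block hn; apply: (off_apow_le CK_ge1).
rewrite blockop_off // /keepK; case: ifP => _; first by rewrite blockop_off.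
by rewrite abs0 abs_ge0.
Qed.

Lemma weight_space w (S : {fset nat}) : 0 <= w ->
  tsirelson_space (weight w (fun k => k \in S)) /\
  tsn (weight w (fun k => k \in S)) <= w * (#|` S|)%:R.
Proof.
move=> w0; pose l := (\max_(n <- S) n).+1.
have hl n : n \in S -> (n < l)%N.
  by move=> hn; rewrite ltnS; exact: (@leq_bigmax_seq _ (enum_fset S) xpredT (fun i => i) n hn isT).
have hv : vanishes_from l (weight w (fun k => k \in S)).
  move=> n hn; rewrite /weight; case: (boolP (n \in S)) => [/hl|_]; last by rewrite mulr0.
  by rewrite ltnNge hn.
have [h1 ->] := tsn_finite hv; split => //.
apply: (le_trans (tn_l1 _ hv)).
under eq_bigr do rewrite ger0_norm ?mulr_ge0 //.
rewrite -mulr_sumr ler_wpM2l // -natr_sum ler_nat.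
rewrite -(big_mkord xpredT (fun i => nat_of_bool (i \in S))).
have -> : (\sum_(0 <= i < l) (i \in S) = \sum_(0 <= i < l | i \in S) 1)%N.
  by rewrite [RHS]big_mkcond; apply: eq_bigr => i _; case: (i \in S).
rewrite sum1_count -size_filter; apply: uniq_leq_size.
  by rewrite filter_uniq // iota_uniq.
by move=> i; rewrite mem_filter => /andP[].
Qed.

Lemma fset_sorted (S : {fset nat}) :
  exists ps, [/\ sorted ltn ps, size ps = #|` S| & forall k, (k \in ps) = (k \in S)].
Proof.
exists (sort leq S); split.
- by rewrite ltn_sorted_uniq_leq sort_uniq fset_uniq sort_sorted //; exact: leq_total.
- by rewrite size_sort.
- by move=> k; rewrite mem_sort.
Qed.

Lemma weight_lower w (S : {fset nat}) : 0 <= w ->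
  w * (#|` S|)%:R <= 4 * tsn (weight w (fun k => k \in S)).
Proof.
move=> w0; have [ps [h1 h2 h3]] := fset_sorted S.
have [hs _] := weight_space S w0.
pose l := (\max_(n <- S) n).+1.
have hv : vanishes_from l (weight w (fun k => k \in S)).
  move=> n hn; rewrite /weight; case: (boolP (n \in S)) => [hS|_]; last by rewrite mulr0.
  have := @leq_bigmax_seq _ (enum_fset S) xpredT (fun i => i) n hS isT.
  by rewrite leqNgt hn.
have [_ ->] := tsn_finite hv; rewrite -h2; apply: (tn_indicator_lower hv h1 w0) => k.
by rewrite h3 /weight => ->; rewrite mulr1 ger0_norm.
Qed.

Lemma upper_bound (S : {fset nat}) (w : R) a : 0 <= w ->
  (forall i, abs (a i) <= w * (i \in S)%:R) ->
  X (blockop A a : V) /\ T (blockop A a) <= 5 * CK * (w `^ p * (#|` S|)%:R).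
Proof.
move=> w0 ha; have wp0 := powR_ge0 w p.
have [h1 h2] := weight_space S wp0.
have := dom CK0 h1 (a := apow (blockop A a)) _ (fun j => bsum_upper j w0 ha).
case=> [n /off_block hn|h3 h4].
  have -> : apow (blockop A a) n = abs (a n) `^ p by rewrite /abs_pow blockop_off.
  rewrite !ger0_norm ?powR_ge0 ?mulr_ge0 //.
  apply: (@le_trans _ _ (weight (w `^ p) (fun k => k \in S) n)); last first.
    by rewrite ler_peMl ?CK_ge1 // mulr_ge0.
  apply: (le_trans (le_powR (ltW p0) (abs_ge0 _) (ha n))); rewrite powRM // /weight.
  by case: (n \in S) => /=; rewrite ?powR1 ?powR0 ?gt_eqF.
split => //; apply: (le_trans h4); apply: ler_wpM2l => //.
by rewrite mulr_ge0.
Qed.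

(** Block domination compares f with a multiple of an indicator, at cost 5 [CK], and the democracy
    of the unit vectors costs 4. *)
Lemma lower_bound_coord (S : {fset nat}) (w : R) f : 0 <= w -> X (f : V) ->
  (forall i, i \in S -> w <= abs (blockop B f i)) ->
  w `^ p * (#|` S|)%:R <= 20 * CK * T f.
Proof.
move=> w0 hf ha; have wp0 := powR_ge0 w p.
have hb j := bsum_lower (D := fun k => k \in S) j w0 ha.
have := dom CK0 hf (a := weight (w `^ p) (fun k => k \in S)).
case=> [n /off_block hn|j|h3 h4].
- rewrite !ger0_norm ?apow_ge0 ?mulr_ge0 //.
  apply: (@le_trans _ _ (apow f n)); last by rewrite ler_peMl ?CK_ge1 // apow_ge0.
  rewrite /weight; case: (boolP (n \in S)) => [/ha|_] /=; last by rewrite mulr0 apow_ge0.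
  by rewrite blockop_off // mulr1 => h; apply: le_powR => //; exact: ltW.
- by have := hb j; rewrite blockAB.
by have := weight_lower S wp0; lra.
Qed.



Local Notation nrm := (@tsirelson_conv_norm R F p).

Lemma T_ge0 (f : V) : X f -> 0 <= T f.
Proof. exact: tsn_ge0. Qed.

Lemma nrm_ge0 (f : V) : 0 <= nrm f.
Proof. exact: powR_ge0. Qed.

Lemma nrm_pow (f : V) : X f -> nrm f `^ p = T f.
Proof. by move=> hf; rewrite /tsirelson_conv_norm powRVK // T_ge0. Qed.

Lemma nrm_le_mul (C : R) (f g : V) : 0 <= C -> X f -> X g -> T f <= C * T g ->
  nrm f <= C `^ p^-1 * nrm g.
Proof.
move=> C0 hf hg h; rewrite /tsirelson_conv_norm -powRM ?T_ge0 //.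
by apply: le_powR => //; [rewrite invr_ge0 ltW|exact: T_ge0].
Qed.

Lemma nrm_lt (w : R) (f : V) : 0 < w -> X f -> T f < w `^ p -> nrm f < w.
Proof.
move=> w0 hf h; rewrite -(powRK p0 (ltW w0)).
by apply: gt0_ltr_powR => //; rewrite ?invr_gt0 // nnegrE ?T_ge0 // powR_ge0.
Qed.

Lemma X_comb (c : K) (f g h : V) : X f -> X g ->
  (forall k, abs (h k) <= abs c * abs (f k) + abs (g k)) ->
  X h /\ T h <= 2 `^ p * abs c `^ p * T f + 2 `^ p * T g.
Proof.
move=> hf hg hh.
apply: (tsn_comb _ twop0 hf hg); first by rewrite mulr_ge0 ?powR_ge0.
move=> k; rewrite !ger0_norm ?apow_ge0 //.
apply: (le_trans (le_powR (ltW p0) (abs_ge0 _) (hh k))).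
have a0 := abs_ge0 c; have f0 := abs_ge0 (f k).
apply: (le_trans (powR_quasi (ltW p0) (mulr_ge0 a0 f0) (abs_ge0 (g k)))).
by rewrite mulrDr powRM // mulrA.
Qed.

Lemma X_linear (c : K) (f g : V) : X f -> X g -> X (c *: f + g).
Proof.
move=> hf hg; apply: (proj1 (X_comb (c := c) hf hg _)) => k.
by apply: (le_trans (absD _ _)); rewrite lerD2r -absM lexx.
Qed.

Lemma X_sub (f g : V) : X f -> X g -> X (f - g).
Proof.
move=> hf hg; have := X_linear (-1) hg hf; rewrite scaleN1r addrC; exact.
Qed.

Lemma X_0 : X (0 : V).
Proof.
apply: (proj1 (@tsn_finite R 0 _ _)) => k _.
by rewrite /abs_pow abs0 powR0 ?gt_eqF.
Qed.

Definition bv (i : nat) : V := blockop A (fun k => (k == i)%:R).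

Lemma sum_delta (r : seq nat) (c : nat -> K) k : uniq r ->
  \sum_(n <- r) c n * (k == n)%:R = keepK (fun n => n \in r) c k.
Proof.
move=> hr; rewrite /keepK; case: ifP => hk.
  rewrite (bigD1_seq k) //= eqxx mulr1 big1 ?addr0 // => n hn.
  by rewrite eq_sym (negbTE hn) mulr0.
rewrite big_seq big1 // => n hn; case: eqP => [ek|_]; last by rewrite mulr0.
by move: hk; rewrite ek hn.
Qed.

Lemma bv_sum (r : seq nat) (c : nat -> K) : uniq r ->
  \sum_(n <- r) c n *: bv n = blockop A (keepK (fun n => n \in r) c) :> V.
Proof.
move=> hr; apply/funext => k.
have -> : keepK (fun n => n \in r) c = fun k => \sum_(n <- r) c n * (k == n)%:R.
  by apply/funext => i; rewrite sum_delta.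
by rewrite blockop_sum fct_sumE.
Qed.

Lemma bv_sum_bound (r : seq nat) (c : nat -> K) (w : R) : uniq r -> 0 <= w ->
  (forall n, n \in r -> abs (c n) <= w) ->
  X (\sum_(n <- r) c n *: bv n) /\
  T (\sum_(n <- r) c n *: bv n) <= 5 * CK * (w `^ p * (size r)%:R).
Proof.
move=> hr w0 hc; rewrite bv_sum //.
have es : #|` [fset x in r]%fset| = size r by rewrite card_fseq undup_id.
rewrite -es; apply: upper_bound => // i; rewrite inE /= /keepK.
by case: ifP => [/hc|_]; rewrite ?mulr1 // abs0 mulr_ge0.
Qed.

Lemma X_bv i : X (bv i).
Proof.
have := @bv_sum_bound [:: i] (fun _ => 1) 1 isT ler01.
by rewrite big_seq1 scale1r => -[n _|//]; rewrite abs1.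
Qed.

Lemma T_bv i : T (bv i) <= 5 * CK.
Proof.
have := @bv_sum_bound [:: i] (fun _ => 1) 1 isT ler01.
rewrite big_seq1 scale1r powR1 /= !mulr1 => -[n _|//]; by rewrite abs1.
Qed.

Lemma X_span (n : nat) (c : nat -> K) : X (\sum_(i < n) c i *: bv i).
Proof.
elim: n => [|n IH]; first by rewrite big_ord0; exact: X_0.
by rewrite big_ord_recr /= addrC; apply: X_linear => //; exact: X_bv.
Qed.

Lemma coord_le (f : V) i : X f -> abs (blockop B f i) `^ p <= 20 * CK * T f.
Proof.
move=> hf; have := @lower_bound_coord [fset i]%fset _ f (abs_ge0 (blockop B f i)) hf.
by rewrite cardfs1 mulr1; apply => k; rewrite inE => /eqP ->.
Qed.

Definition coordf (n : nat) (f : V) : K := blockop B f n.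

Let C20 : 0 <= 20 * CK. Proof. by rewrite mulr_ge0. Qed.

Lemma coordf_bound n (f : V) : X f -> abs (coordf n f) <= (20 * CK) `^ p^-1 * nrm f.
Proof.
move=> hf; rewrite -(powRK p0 (abs_ge0 (coordf n f))) -powRM ?T_ge0 //.
by apply: le_powR; [rewrite invr_ge0 ltW|exact: powR_ge0|exact: coord_le].
Qed.

Lemma coordf_dual : dual_system abs X nrm bv coordf.
Proof.
split.
- move=> n c u v _ _; rewrite /coordf.
  exact: (blockopP B c u v n).
- by exists ((20 * CK) `^ p^-1) => n f; exact: coordf_bound.
- by move=> i n; rewrite /coordf /bv blockBA.
Qed.

(** Partial sums that stop at a block start are plain truncations, as no block is cut; hence the
    tails of f in Tsirelson's space control the approximation by finite sums. *)
Lemma keep_below (J : nat) f k :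
  blockop A (keepK (fun i => (i < t J)%N) (blockop B f)) k = if (k < t J)%N then f k else 0.
Proof.
case: (boolP (in_block k)) => hk; last by rewrite blockop_off // /keepK blockop_off.
have [j [x [hx ->]]] := in_block_split hk.
have hlt c : (c < m j)%N -> (t j + c < t J)%N = (j < J)%N.
  move=> hc; case: (ltnP j J) => h.
    by have := e_le_t block_te block_tlac h; rewrite /e; lia.
  by apply/negbTE; rewrite -leqNgt; have := t_mono block_te block_tlac h; lia.
rewrite hlt // blockop_in //; case: (boolP (j < J)%N) => h.
  rewrite -[RHS](congr1 (fun g => g (t j + x)%N) (blockAB f)) blockop_in //.
  by apply: eq_bigr => c _; rewrite /keepK hlt ?h.
by rewrite big1 // => c _; rewrite /keepK hlt ?(negbTE h) ?mulr0.
Qed.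

Lemma span_dense (f : V) (w : R) : X f -> 0 < w ->
  exists J, X (f - \sum_(i < t J) coordf i f *: bv i) /\
    nrm (f - \sum_(i < t J) coordf i f *: bv i) < w.
Proof.
move=> hf w0; have wp : 0 < w `^ p by exact: powR_gt0.
have [J hJ] := tsn_tail hf wp; exists J.
have -> : \sum_(i < t J) coordf i f *: bv i = \sum_(i <- iota 0 (t J)) coordf i f *: bv i.
  by rewrite -(big_mkord xpredT (fun i => coordf i f *: bv i)) /index_iota subn0.
rewrite bv_sum ?iota_uniq //.
set g : V := blockop A _.
have efg : apow (f - g) = from (t J) (apow f).
  apply/funext => k; rewrite /from /abs_pow.
  have -> : (f - g) k = f k - g k by [].
  have -> : g k = if (k < t J)%N then f k else 0.
    rewrite -keep_below /g; congr (blockop A _ k); apply/funext => i.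
    by rewrite /keepK mem_iota /= add0n.
  case: ltnP => h; last by rewrite subr0.
  by rewrite subrr abs0 powR0 ?gt_eqF.
have [h1 h2] := hJ _ (block_tid J).
have hX : X (f - g) by rewrite /tsirelson_conv /= efg.
by split => //; apply: nrm_lt => //; rewrite efg.
Qed.

Lemma bv_closed_span (f : V) : X f -> closed_span X nrm bv f.
Proof.
move=> hf; split => // w w0; have [J [_ h]] := span_dense hf w0.
exists (\sum_(i < t J) coordf i f *: bv i) => //.
by exists (t J), (fun i => coordf i f).
Qed.

Lemma bv_basis : Defs.basis abs X nrm bv.
Proof.
split.
- exact: X_bv.
- exists ((5 * CK) `^ p^-1) => n; rewrite /tsirelson_conv_norm; apply: le_powR.
  + by rewrite invr_ge0 ltW.
  + exact: T_ge0 (X_bv n).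
  + exact: T_bv.
- exact: bv_closed_span.
- by exists coordf; exact: coordf_dual.
Qed.

Lemma dual_on_span (xs : nat -> V -> K) n N (c : nat -> K) : dual_system abs X nrm bv xs ->
  xs n (\sum_(i < N) c i *: bv i) = \sum_(i < N) c i * (n == i)%:R.
Proof.
move=> [hl _ hd].
have x0 : xs n 0 = 0.
  have := hl n (-1) 0 0 X_0 X_0; rewrite scaler0 addr0 scaleN1r => h.
  by move: h; rewrite addNr.
elim: N => [|N IH]; first by rewrite !big_ord0.
rewrite !big_ord_recr /= addrC hl; [|exact: X_bv|exact: X_span].
by rewrite IH hd addrC.
Qed.

(** [coord] is picked by [xget], so uniqueness identifies it: two dual systems agree on the span and
    are bounded, hence agree on the space by density. *)
Lemma dual_unique (xs ys : nat -> V -> K) n (f : V) :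
  dual_system abs X nrm bv xs -> dual_system abs X nrm bv ys -> X f -> xs n f = ys n f.
Proof.
move=> hx hy hf; have [lx [Mx bx] _] := hx; have [ly [My by_] _] := hy.
have M0 : 0 < `|Mx| + `|My| + 1 by rewrite ltr_wpDl ?addr_ge0.
apply/eqP; rewrite -subr_eq0; apply/eqP/(@abs_eq0 R F).
apply/eqP; rewrite eq_le abs_ge0 andbT; apply/ler_addgt0Pr => w w0; rewrite add0r.
have w1 : 0 < w / (`|Mx| + `|My| + 1) by rewrite divr_gt0.
have [J [hX hn]] := span_dense hf w1.
set s := \sum_(i < t J) coordf i f *: bv i in hX hn.
have hs : X s by exact: (X_span _ (fun i => coordf i f)).
have es : xs n s = ys n s by rewrite /s !dual_on_span.
have ex zs : dual_system abs X nrm bv zs -> zs n (f - s) = zs n f - zs n s.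
  move=> [lz _ _]; have := lz n (-1) s f hs hf; rewrite scaleN1r addrC => ->.
  by rewrite scaleN1r addrC.
have -> : xs n f - ys n f = xs n (f - s) - ys n (f - s).
  by rewrite !ex // es opprB addrA subrK.
apply: (le_trans (absB _ _)).
have h1 := bx n _ hX; have h2 := by_ n _ hX.
have n0 := nrm_ge0 (f - s).
have h3 := ler_wpM2r n0 (ler_norm Mx); have h4 := ler_wpM2r n0 (ler_norm My).
move: hn; rewrite ltr_pdivlMr // => hn; lra.
Qed.

Lemma coordE n (f : V) : X f -> Defs.coord abs X nrm bv n f = coordf n f.
Proof.
move=> hf; apply: dual_unique => //; last exact: coordf_dual.
by apply: (xgetPex (fun _ _ => 0)); exists coordf; exact: coordf_dual.
Qed.

Lemma coordf_level (f : V) : X f -> forall w, 0 < w -> exists n : nat,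
  forall S : {fset nat}, (forall i, i \in S -> w <= abs (coordf i f)) -> (#|` S| <= n)%N.
Proof.
move=> hf w w0; have wp : 0 < w `^ p by exact: powR_gt0.
exists (Num.truncn (20 * CK * T f / w `^ p)).+1 => S hS.
have := lower_bound_coord (ltW w0) hf hS.
rewrite mulrC -ler_pdivlMr // => h; apply: ltnW.
rewrite -(ltr_nat R); apply: (le_lt_trans h); exact: truncnS_gt.
Qed.

Lemma greedy_orderingP (f : V) : X f ->
  is_greedy_ordering abs (fun i => coordf i f) (greedy_ordering abs (fun i => coordf i f)).
Proof.
move=> hf; apply: (xgetPex (id : nat -> nat)).
by apply: greedy_ordering_exists;
  [exact: abs_ge0|exact: abs_eq0|exact: coordf_level].
Qed.

Definition greedy_const : R := 2 `^ p * (5 * CK) + 2 `^ p * (5 * CK * (20 * CK)).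

(** The argument of Konyagin and Temlyakov. Let r be the greedy set and g the error of the
    competitor on S. The greedy error is a projection of g off r and S plus the terms of f on S
    outside r. These have modulus at most w, the least one on r, and are as many as the indices of r
    outside S, where g still has the coefficients of f, of modulus at least w; so upper and lower
    democracy bound them by g. *)
Lemma greedy_error_bound (f : V) (l : nat) (S : {fset nat}) (al : nat -> K) :
  X f -> (0 < l)%N -> #|` S| = l ->
  X (f - greedy_sum abs X nrm bv l f) /\ X (f - \sum_(n <- S) al n *: bv n) /\
  T (f - greedy_sum abs X nrm bv l f) <= greedy_const * T (f - \sum_(n <- S) al n *: bv n).
Proof.
move=> hf l0 hS; pose c n := coordf n f.
have [inj supp ord] := greedy_orderingP hf.
set rho := greedy_ordering _ _ in inj supp ord.
pose r := [seq rho j | j <- iota 0 l].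
have ur : uniq r by rewrite map_inj_uniq ?iota_uniq.
have eG : greedy_sum abs X nrm bv l f = \sum_(n <- r) c n *: bv n.
  rewrite /greedy_sum.
  have -> : (fun i => Defs.coord abs X nrm bv i f) = fun i => coordf i f.
    by apply/funext => i; rewrite coordE.
  rewrite -/rho /r big_map -(big_mkord xpredT (fun j =>
    let n := rho j in Defs.coord abs X nrm bv n f *: bv n)) /index_iota subn0.
  by apply: eq_bigr => j _; rewrite /= coordE.
set g : V := f - \sum_(n <- S) al n *: bv n.
have hXS : X (\sum_(n <- S) al n *: bv n).
  pose w := \sum_(n <- S) abs (al n).
  have w0 : 0 <= w by apply: sumr_ge0 => n _; exact: abs_ge0.
  apply: (proj1 (bv_sum_bound (w := w) (fset_uniq S) w0 _)) => n hn.
  rewrite /w (big_rem n) //= lerDl; apply: sumr_ge0 => i _; exact: abs_ge0.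
have hg : X g by exact: X_sub.
have hXr : X (\sum_(n <- r) c n *: bv n).
  rewrite bv_sum //; exact: (proj1 (proj_bound (fun n => n \in r) hf)).
rewrite eG; split; [exact: X_sub|split; [exact: hg|]].
have cg n : n \notin S -> blockop B g n = c n.
  move=> hn; rewrite /g bv_sum ?fset_uniq //.
  have -> : f - blockop A (keepK (fun n => n \in S) al) =
     (fun k => (-1) * blockop A (keepK (fun n => n \in S) al) k + f k) :> (nat -> K).
    by apply/funext => k; rewrite mulN1r addrC.
  by rewrite blockopP blockBA /keepK (negbTE hn) mulr0 add0r.
pose w := abs (c (rho l.-1)).
have w0 : 0 <= w by exact: abs_ge0.
have big n : n \in r -> w <= abs (c n).
  move=> /mapP[j]; rewrite mem_iota add0n => /andP[_ hj] ->.
  case: (ltnP j l.-1) => hj'; last by have -> : j = l.-1 by lia.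
  by case: (ord _ _ hj') => [/ltW|[-> _]].
have small n : n \notin r -> abs (c n) <= w.
  move=> hn; case: (eqVneq (c n) 0) => [->|hc]; first by rewrite abs0.
  have [k _ ek] := supp n hc.
  have hk : (l.-1 < k)%N.
    rewrite ltnNge; apply: contra hn => hk; rewrite -ek; apply: map_f.
    by rewrite mem_iota add0n /=; lia.
  by rewrite -ek; case: (ord _ _ hk) => [/ltW|[<- _]].
pose L := [fset x in r]%fset.
have cL : #|` L| = l by rewrite card_fseq undup_id // size_map size_iota.
have inL n : (n \in L) = (n \in r) by rewrite !inE.
pose D1 n := (n \notin r) && (n \notin S).
pose S2 := (S `\` L)%fset; pose S3 := (L `\` S)%fset.
have c23 : #|` S2| = #|` S3|.
  by rewrite !cardfsD cL hS fsetIC.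
have [h1X h1] := proj_bound D1 hg.
pose c2 := keepK (fun n => n \in S2) c.
have hc2 i : abs (c2 i) <= w * (i \in S2)%:R.
  rewrite /c2 /keepK; case: ifP => [|_]; last by rewrite abs0 mulr0.
  by rewrite mulr1 in_fsetD inL => /andP[/small].
have [h2X h2] := upper_bound w0 hc2.
have h3 : w `^ p * (#|` S3|)%:R <= 20 * CK * T g.
  apply: lower_bound_coord => // i; rewrite in_fsetD inL => /andP[hi1 hi2].
  by rewrite cg //; exact: big.
have split_f : f - \sum_(n <- r) c n *: bv n =
    (1 *: (blockop A (keepK D1 (blockop B g)) : V) + (blockop A c2 : V)) :> V.
  rewrite scale1r bv_sum //; apply/funext => k.
  have -> : (f - blockop A (keepK (fun n => n \in r) c) : V) k =
     (-1) * blockop A (keepK (fun n => n \in r) c) k + blockop A c k.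
    by rewrite /c /coordf blockAB mulN1r addrC.
  have -> : ((blockop A (keepK D1 (blockop B g)) : V) + (blockop A c2 : V)) k =
     1 * blockop A (keepK D1 (blockop B g)) k + blockop A c2 k by rewrite mul1r.
  rewrite -!blockopP; congr (blockop A _ k); apply/funext => n.
  rewrite /keepK /D1 /c2 /keepK in_fsetD inL.
  case: (boolP (n \in r)) => hr /=; first by rewrite mulr0 add0r mulN1r addNr.
  case: (boolP (n \in S)) => hnS /=; first by rewrite !mulr0 !add0r.
  by rewrite cg // mulr0 add0r addr0 mul1r.
have := X_comb (c := 1) h1X h2X (h := f - \sum_(n <- r) c n *: bv n).
case=> [k|_ h4].
  rewrite split_f abs1 mul1r scale1r; exact: absD.
apply: (le_trans h4); rewrite abs1 powR1 mulr1 /greedy_const mulrDl.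
rewrite c23 in h2; have C5 : 0 <= 5 * CK by rewrite mulr_ge0.
have h5 := ler_wpM2l C5 h3.
rewrite -(mulrA _ (5 * CK) (T g)) -(mulrA _ (5 * CK * (20 * CK)) (T g)).
apply: lerD; apply: ler_wpM2l => //.
by rewrite -(mulrA (5 * CK)); exact: le_trans h2 h5.
Qed.

Let greedy_const0 : 0 <= greedy_const.
Proof. by rewrite /greedy_const addr_ge0 ?mulr_ge0. Qed.

(** The added 1 secures that the constant is at least 1, and positive for the division under the
    infimum. *)
Lemma bv_greedy_with : greedy_with abs X nrm bv (1 + greedy_const `^ p^-1).
Proof.
have gc := powR_ge0 greedy_const p^-1.
split; first by rewrite lerDl.
move=> f l hf l0; rewrite /best_error -ler_pdivrMl; last by rewrite ltr_pwDl.
apply: lb_le_inf.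
  exists (nrm (f - \sum_(n <- [fset x in iota 0 l]%fset) (0 : K) *: bv n)).
  exists [fset x in iota 0 l]%fset, (fun _ => 0); split => //.
  by rewrite card_fseq undup_id ?iota_uniq // size_iota.
move=> _ [S [al [hS ->]]]; rewrite ler_pdivrMl; last by rewrite ltr_pwDl.
have [h1 [h2 h3]] := greedy_error_bound al hf l0 hS.
apply: (le_trans (nrm_le_mul greedy_const0 h1 h2 h3)).
by apply: ler_wpM2r; [exact: nrm_ge0|rewrite lerDr].
Qed.

Theorem bv_greedy : greedy_basis abs X nrm bv /\
  greedy_constant abs X nrm bv <= 1 + greedy_const `^ p^-1.
Proof.
split; first by split; [exact: bv_basis|exists (1 + greedy_const `^ p^-1); exact: bv_greedy_with].
apply: ge_inf; last exact: bv_greedy_with.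
by exists 1 => C [].
Qed.

Theorem bv_fundamental (n : nat) : (0 < n)%N ->
  (20 * CK)^-1 `^ p^-1 * n%:R `^ p^-1 <= fundamental_function nrm bv n /\
  fundamental_function nrm bv n <= (5 * CK) `^ p^-1 * n%:R `^ p^-1.
Proof.
move=> n0; have C5 : 0 <= 5 * CK by rewrite mulr_ge0.
have ip : 0 <= p^-1 by rewrite invr_ge0 ltW.
have ub (S : {fset nat}) : (#|` S| <= n)%N -> X (\sum_(k <- S) bv k) /\
    nrm (\sum_(k <- S) bv k) <= (5 * CK) `^ p^-1 * n%:R `^ p^-1.
  move=> hS; have := bv_sum_bound (c := fun _ => 1) (fset_uniq S) ler01.
  under eq_bigr do rewrite scale1r.
  rewrite powR1 mul1r => -[k _|h1 h2]; first by rewrite abs1.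
  split => //; rewrite -powRM // /tsirelson_conv_norm; apply: le_powR => //.
    exact: T_ge0.
  by apply: (le_trans h2); apply: ler_wpM2l => //; rewrite ler_nat.
pose S : {fset nat} := [fset x in iota 0 n]%fset.
have hS : #|` S| = n by rewrite card_fseq undup_id ?iota_uniq // size_iota.
split; last first.
  apply: ge_sup; last by move=> _ [S' hS' <-]; exact: (proj2 (ub S' hS')).
  by exists (nrm (\sum_(k <- S) bv k)), S => //=; rewrite hS.
have [hX _] := ub S (eq_leq hS).
apply: (@le_trans _ _ (nrm (\sum_(k <- S) bv k))); last first.
  apply: sup_upper_bound; last by exists S => //=; rewrite hS.
  split; first by exists (nrm (\sum_(k <- S) bv k)), S => //=; rewrite hS.
  by exists ((5 * CK) `^ p^-1 * n%:R `^ p^-1) => _ [S' hS' <-]; exact: (proj2 (ub S' hS')).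
have CKp : 0 < 20 * CK by rewrite mulr_gt0 // (lt_le_trans ltr01) // CK_ge1.
rewrite -powRM ?invr_ge0 ?(ltW CKp) // /tsirelson_conv_norm; apply: le_powR => //.
  by rewrite mulr_ge0 // invr_ge0 ltW.
rewrite ler_pdivrMl // -hS.
have := lower_bound_coord (S := S) ler01 hX; rewrite powR1 mul1r; apply => i hi.
have -> : \sum_(k <- S) bv k = \sum_(k <- S) (1 : K) *: bv k.
  by apply: eq_bigr => k _; rewrite scale1r.
by rewrite (bv_sum (fun _ => 1)) ?fset_uniq // blockBA /keepK hi abs1.
Qed.

Definition injs (b : nat -> R) : V := fun k => sc_inj F (b k).

Lemma apow_injs (b : nat -> R) k : apow (injs b) k = `|b k| `^ p.
Proof. by rewrite /abs_pow abs_inj. Qed.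

Lemma blockop_injs (b : nat -> R) j x : (x < m j)%N ->
  blockop A (injs b) (t j + x)%N = sc_inj F (mxapp (m j) (A j) (fun c => b (t j + c)%N) x).
Proof.
move=> hx; rewrite blockop_in // /mxapp sc_inj_sum.
by apply: eq_bigr => c _; rewrite sc_injM.
Qed.

Lemma bsum_injs (b : nat -> R) j :
  bsum (apow (injs b)) j = seqsum (m j) p (fun c => b (t j + c)%N).
Proof. by rewrite bsum_apow; apply: eq_bigr => c _; rewrite abs_inj. Qed.

Lemma bsum_blockop_injs (b : nat -> R) j :
  bsum (apow (blockop A (injs b))) j =
  seqsum (m j) p (mxapp (m j) (A j) (fun c => b (t j + c)%N)).
Proof. by rewrite bsum_apow; apply: eq_bigr => c _; rewrite blockop_injs // abs_inj. Qed.

Lemma blockop_distortion (b : nat -> R) (W : R) : 1 <= W ->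
  (forall j, bsum (apow (blockop A (injs b))) j <= W * bsum (apow (injs b)) j /\
             bsum (apow (injs b)) j <= W * bsum (apow (blockop A (injs b))) j) ->
  (X (injs b) -> T (blockop A (injs b)) <= 5 * W * T (injs b)) /\
  (X (blockop A (injs b) : V) -> T (injs b) <= 5 * W * T (blockop A (injs b))).
Proof.
move=> W1 hW; have W0 : 0 <= W by exact: le_trans W1.
split=> hX; apply: (proj2 (dom W0 hX _ _)).
- by move=> n /off_block hn; apply: off_apow_le => //; rewrite blockop_off.
- by move=> j; exact: (proj1 (hW j)).
- by move=> n /off_block hn; apply: off_apow_le => //; rewrite blockop_off.
- by move=> j; exact: (proj2 (hW j)).
Qed.

Lemma sum_over_list (G : nat -> R) (r : seq nat) l : uniq r ->
  (forall k, k \notin r -> G k = 0) -> (forall k, k \in r -> (k < l)%N) ->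
  \sum_(k < l) G k = \sum_(k <- r) G k.
Proof.
move=> hr hG hl; rewrite -(big_mkord xpredT G) (bigID (fun k => k \in r)) /=.
rewrite [X in _ + X]big1 ?addr0; last by move=> k /hG.
rewrite -big_filter; apply: perm_big; apply: uniq_perm => //.
  by rewrite filter_uniq // iota_uniq.
move=> k; rewrite mem_filter mem_index_iota /=.
by case: (boolP (k \in r)) => // /hl ->.
Qed.

Lemma list_bound (r : seq nat) : exists l : nat, forall k, k \in r -> (k < l)%N.
Proof.
exists (\max_(n <- r) n).+1 => k hk.
by rewrite ltnS; exact: (@leq_bigmax_seq _ r xpredT (fun i => i) k hk isT).
Qed.

(** At most n + 1 coordinates, all from n on, behave like l_p up to a factor 2, wherever a
    permutation has put them. *)
Lemma T_list (b : nat -> R) (r : seq nat) : uniq r -> (forall k, k \notin r -> b k = 0) ->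
  [/\ X (injs b), T (injs b) <= \sum_(k <- r) `|b k| `^ p &
    forall n : nat, (forall k, k \in r -> (n <= k)%N) -> (size r <= n.+1)%N ->
      \sum_(k <- r) `|b k| `^ p <= 2 * T (injs b)].
Proof.
move=> hr hb; have [l hl] := list_bound r.
have z k : k \notin r -> apow (injs b) k = 0.
  by move=> /hb h; rewrite apow_injs h normr0 powR0 ?gt_eqF.
have hv : vanishes_from l (apow (injs b)).
  by move=> k hk; apply: z; apply/negP => /hl; rewrite ltnNge hk.
have [hX hT] := tsn_finite hv; rewrite hT; split => //.
  apply: (le_trans (tn_l1 _ hv)).
  rewrite (sum_over_list (G := fun k => `|apow (injs b) k|) hr) //; last first.
    by move=> k /z ->; rewrite normr0.
  by apply: ler_sum => k _; rewrite apow_injs ger0_norm ?powR_ge0.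
move=> n hn hsz.
have hsrt : sorted ltn (sort leq r).
  by rewrite ltn_sorted_uniq_leq sort_uniq hr sort_sorted //; exact: leq_total.
have h := @tn_l1_lower _ succn _ l n _ hv hsrt.
have -> : \sum_(k <- r) `|b k| `^ p = \sum_(k <- sort leq r) `|apow (injs b) k|.
  rewrite (perm_big (sort leq r)) /=; last by rewrite perm_sym perm_sort.
  by apply: eq_bigr => k _; rewrite apow_injs [RHS]ger0_norm ?powR_ge0.
have h1 : forall k, k \in sort leq r -> (n <= k)%N by move=> k; rewrite mem_sort; exact: hn.
have h2 : (size (sort leq r) <= n.+1)%N by rewrite size_sort.
have := h h1 h2; set s := \sum_(k <- _) _ => h3; lra.
Qed.

Lemma T_single_block (b : nat -> R) j : (forall k, ~~ (t j <= k < e j)%N -> b k = 0) ->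
  [/\ X (blockop A (injs b) : V),
      T (blockop A (injs b)) <= bsum (apow (blockop A (injs b))) j &
      bsum (apow (blockop A (injs b))) j <= 2 * T (blockop A (injs b))].
Proof.
move=> hb; set f := blockop A (injs b).
have z k : ~~ (t j <= k < e j)%N -> apow f k = 0.
  move=> hk; rewrite /abs_pow; have -> : f k = 0; last by rewrite abs0 powR0 ?gt_eqF.
  case: (boolP (in_block k)) => hk2; last by rewrite /f blockop_off // /injs hb // sc_inj0.
  have [i [x [hx ek]]] := in_block_split hk2.
  rewrite ek /f blockop_in // big1 // => c _.
  rewrite /injs hb ?sc_inj0 ?mulr0 //; apply: contra hk => hc.
  have hic : (t i <= t i + c < e i)%N by have := ltn_ord c; rewrite /e; lia.
  have eij := block_unique block_te block_tlac hic hc.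
  by rewrite ek -eij /e; lia.
have hv : vanishes_from (e j) (apow f).
  by move=> k hk; apply: z; rewrite negb_and -leqNgt hk orbT.
have [hX hT] := tsn_finite hv; rewrite hT; split => //.
  apply: (le_trans _ (tn_block block_te (apow f) j)).
  apply: (tn_mono _ (@vanishes_from_window_end _ (t j) (e j) (apow f))) => k.
  by rewrite /window; case: ifP => // /negbT/z ->.
exact: (blocksum_le_tn block_tlen _ hv).
Qed.

End BlockOperators.

(** * The continuum of bases *)

Section Combinatorics.
Variable R : realType.

Definition hsum (k : nat) : R := \sum_(i < k) i.+1%:R^-1.

Lemma hsum_mono a k : (a <= k)%N -> hsum a <= hsum k.
Proof.
by move=> /subnKC <-; rewrite /hsum big_split_ord /= lerDl sumr_ge0.
Qed.

Lemma hsum_unbounded (c : R) : exists k, c <= hsum k.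
Proof.
apply: contrapT => /forallNP h; apply: (@dvg_harmonic R).
apply: nondecreasing_is_cvgn.
  by apply: nondecreasing_series => n _ _; exact: harmonic_ge0.
exists c => _ [n _ <-]; rewrite seriesEord; apply: ltW.
by rewrite ltNge; apply/negP; exact: h.
Qed.

Lemma sum_weights a d : \sum_(i < d) ((a + i).+1%:R^-1 : R) = hsum (a + d) - hsum a.
Proof. by rewrite /hsum big_split_ord /= [RHS]addrC addKr. Qed.

(** The conditions prepare the comparison of d n coordinates: earlier types have total weight at
    most h n, in later types these coordinates carry at most d n weights of size 1/(d n), and type n
    itself exceeds h n by the unbounded factor n + 1. *)
Lemma weight_sequences : exists (d : nat -> nat) (del : nat -> nat -> R) (h : nat -> R),
  forall n, let H k := \sum_(i < d k) del k i in
  [/\ forall i, 0 < del n i <= 1, forall i, del n i <= i.+1%:R^-1, (0 < d n)%N, 1 <= h n &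
    [/\ n.+1%:R * h n <= H n, forall k, (k < n)%N -> H k <= h n &
        forall k i, (n < k)%N -> (d n)%:R * del k i <= 1]].
Proof.
have hd (an : nat * nat) : exists k : nat,
    an.2.+1%:R * (1 + hsum an.1) <= hsum (an.1 + k)%N - hsum an.1.
  have [k hk] := hsum_unbounded (hsum an.1 + an.2.+1%:R * (1 + hsum an.1)).
  exists (k - an.1)%N; rewrite lerBrDl; apply: (le_trans hk).
  by apply: hsum_mono; lia.
(* Segments of the harmonic series, each dominating the sum of the earlier ones. *)
have [dd ddP] := choice hd.
pose fix a n := if n is k.+1 then (a k + dd (a k, k))%N else 0%N.
pose d n := dd (a n, n).
have aS n : a n.+1 = (a n + d n)%N by [].
have amono k n : (k <= n)%N -> (a k <= a n)%N.
  by move=> /subnKC <-; elim: (n - k)%N => [|i IH]; rewrite ?addn0 // addnS aS; lia.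
have hs0 k : 0 <= hsum k by rewrite sumr_ge0 // => i _; rewrite invr_ge0.
(* The segments are consecutive, so [hsum (a n)] is the total weight of all earlier types, and a
   later segment starts beyond d n. *)
exists d, (fun n i => (a n + i).+1%:R^-1), (fun n => 1 + hsum (a n)) => n /=.
have hn : n.+1%:R * (1 + hsum (a n)) <= hsum (a n + d n)%N - hsum (a n) := ddP (a n, n).
split.
- by move=> i; rewrite invr_gt0 ltr0Sn invf_le1 ?ltr0Sn // ler1n.
- by move=> i; rewrite lef_pV2 ?posrE ?ltr0Sn // ler_nat ltnS leq_addl.
- rewrite lt0n; apply/eqP => dn; move: hn; rewrite dn addn0 subrr leNgt.
  by rewrite mulr_gt0 // ltr_pwDl.
- by rewrite lerDl.
split; first by rewrite sum_weights.
- move=> k hk; rewrite sum_weights -aS.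
  have := hsum_mono (amono _ _ hk); have := hs0 (a k); lra.
- move=> k i hk; rewrite ler_pdivrMr ?ltr0Sn // mul1r ler_nat.
  by have := amono _ _ hk; rewrite aS; lia.
Qed.

Lemma logn2_infinite n B : exists2 j, (B <= j)%N & logn 2 j.+1 = n.
Proof.
have h : (0 < 2 ^ n * B.*2.+1)%N by rewrite muln_gt0 expn_gt0.
(* The odd cofactor fixes the 2-adic valuation and makes the index at least B. *)
exists (2 ^ n * B.*2.+1).-1.
  rewrite -ltnS prednK //; apply: (@leq_trans (1 * B.*2.+1)).
    by rewrite mul1n -addnn; lia.
  by rewrite leq_mul2r expn_gt0 orbT.
rewrite prednK // lognM ?expn_gt0 // pfactorK // logn_coprime ?addn0 //.
by rewrite coprime2n /= odd_double.
Qed.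

Lemma injective_unbounded (f : nat -> nat) B : injective f -> exists i, (B <= f i)%N.
Proof.
move=> hf; apply: contrapT => /forallNP h.
have lt i : (f i < B)%N by rewrite ltnNge; apply/negP; exact: h.
have inj : injective (fun i : 'I_B.+1 => Ordinal (lt i)).
  by move=> i k /(congr1 val) /= /hf /val_inj.
by have := leq_card _ inj; rewrite !card_ord ltnn.
Qed.

(* Distinct reals have only finitely many dyadic approximations in common. *)
Definition expansion_code (r : R) (l : nat) : nat := choice.pickle (l, Num.floor (r * 2 ^+ l)).

Lemma expansion_codes_disjoint (r s : R) : r <> s -> exists L : nat, forall l,
  (L <= l)%N -> forall k, expansion_code r l <> expansion_code s k.
Proof.
move=> rs; have x0 : 0 < `|r - s| by rewrite normr_gt0 subr_eq0; apply/eqP.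
(* From this level on 2^l exceeds 1/|r - s|, so the scaled numbers differ by more than 1 and cannot
   have the same integer part; the pairing also forces the levels to agree. *)
exists (Num.truncn `|r - s|^-1).+1 => l hl k /(pcan_inj (@choice.pickleK _)) [<-{k} hfl].
have h2 : `|r - s|^-1 < 2 ^+ l.
  have hx : 0 <= `|r - s|^-1 by rewrite invr_ge0.
  have /andP[_ h1] := truncn_itv hx.
  apply: (lt_le_trans h1); rewrite -natrX ler_nat.
  exact: (leq_trans hl (ltnW (ltn_expl l (leqnn 2)))).
have h3 : 1 < 2 ^+ l * `|r - s| by rewrite -ltr_pdivrMr // mul1r.
have fl (x : R) : (Num.floor x)%:~R <= x < (Num.floor x)%:~R + 1.
  by have := floor_itv x; rewrite intrD.
have := fl (r * 2 ^+ l); have := fl (s * 2 ^+ l); rewrite hfl.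
set z := _%:~R => /andP[a1 a2] /andP[a3 a4].
have : `|r * 2 ^+ l - s * 2 ^+ l| < 1 by rewrite ltr_norml; lra.
by rewrite -mulrBl normrM [X in _ * X]ger0_norm ?exprn_ge0 // mulrC ltNge ltW.
Qed.

Lemma almost_disjoint_family : exists M : R -> pred nat, forall r s, r <> s ->
  forall B : nat, exists n, [/\ (B <= n)%N, M r n & ~~ M s n].
Proof.
exists (fun r n => `[< exists l, n = expansion_code r l >]) => r s rs B.
have [L hL] := expansion_codes_disjoint rs.
have inj : injective (fun i : nat => expansion_code r (L + i)%N).
  by move=> i k /(pcan_inj (@choice.pickleK _)) [] /addnI.
have [i hi] := injective_unbounded B inj.
exists (expansion_code r (L + i)%N); split => //; first by apply/asboolP; exists (L + i)%N.
by apply/negP => /asboolP[k]; apply: hL; exact: leq_addr.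
Qed.

End Combinatorics.

Section LinearOn.
Variables (K : numFieldType) (V W : lmodType K) (X : set V) (T : V -> W).
Hypothesis X0 : X 0.
Hypothesis X_lin : forall (c : K) u v, X u -> X v -> X (c *: u + v).
Hypothesis T_lin : linear_on X T.

Lemma linear_on_sum (I : Type) (r : seq I) (c : I -> K) (u : I -> V) : (forall i, X (u i)) ->
  X (\sum_(i <- r) c i *: u i) /\
  T (\sum_(i <- r) c i *: u i) = \sum_(i <- r) c i *: T (u i).
Proof.
move=> hu; elim: r => [|i r [IH1 IH2]].
  rewrite !big_nil; split => //.
  by have := T_lin (- 1) X0 X0; rewrite scaler0 addr0 scaleN1r addNr.
by rewrite !big_cons; split; [exact: X_lin|rewrite T_lin // IH2].
Qed.

End LinearOn.

(** * Positions and types of the blocks *)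

Section BlockLayout.
Variable bm : nat -> nat.

(* Any type function with infinite fibres would do. *)
Definition block_type (j : nat) : nat := logn 2 j.+1.
Definition block_size j := bm (block_type j).
(** The summand [block_size i.+1] makes the start at least the length of its own block, the rest is
    lacunarity. *)
Fixpoint block_start j : nat :=
  if j is i.+1 then (4 * (block_start i + block_size i) + block_size i.+1).+1 else block_size 0.

Lemma start_size j : (block_size j <= (block_start j).+1)%N.
Proof. by case: j => [|j] /=; lia. Qed.

Lemma start_lacunary j : (4 * (block_start j + block_size j) < block_start j.+1)%N.
Proof. by rewrite /=; lia. Qed.

End BlockLayout.

(** * Non-equivalence of bases with different sets of types *)

Section Family.
Variables (R : realType) (F : scalars) (p K th : R).
Hypothesis p1 : 1 < p.
Hypothesis K1 : 1 <= K.
Hypothesis th0 : 0 < th.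
Variables (d : nat -> nat) (del : nat -> nat -> R) (h : nat -> R).
Local Notation H k := (\sum_(i < d k) del k i).
Hypothesis del01 : forall n i, 0 < del n i <= 1.
Hypothesis d_gt0 : forall n, (0 < d n)%N.
Hypothesis h1 : forall n, 1 <= h n.
Hypothesis H_large : forall n, n.+1%:R * h n <= H n.
Hypothesis H_below : forall n k, (k < n)%N -> H k <= h n.
Hypothesis del_small : forall n k i, (n < k)%N -> (d n)%:R * del k i <= 1.
Variables (bm : nat -> nat) (bA bB : nat -> nat -> nat -> R) (bpos : nat -> nat -> nat).
Hypothesis bsys : forall n, block_system p K (bm n) (bA n) (bB n).
Hypothesis bdis : forall n, distorted p K th (del n) (d n) (bpos n) (bm n) (bA n).
Implicit Types M : pred nat.

Definition select (C : nat -> nat -> nat -> R) M j : nat -> nat -> R :=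
  if M (block_type j) then C (block_type j) else @id_mx R.

Local Notation t := (block_start bm).
Local Notation m := (block_size bm).
Local Notation sA := (select bA).
Local Notation sB := (select bB).

Lemma select_system M j : block_system p K (m j) (sA M j) (sB M j).
Proof.
rewrite /select; case: ifP => _; first exact: bsys.
by apply: id_block_system => //; exact: lt_trans p1.
Qed.

Local Notation tl := (start_lacunary bm).
Local Notation X := (@tsirelson_conv R F p).
Local Notation nrm := (@tsirelson_conv_norm R F p).
Local Notation fld := (scalar_field R F).
Local Notation V := (scalar_seq R F).
Local Notation tsn f := (tsirelson_space_norm (abs_pow p (f : V))).
Local Notation op M := (blockop p1 K1 tl (sA M)).
Local Notation inj := (@injs R F).

Definition modified_basis M : nat -> V := bv F p1 (sA M) K1 tl.

Lemma count_hits (r : seq nat) (g : nat -> nat) l :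
  (forall i k, (i < l)%N -> (k < l)%N -> g i = g k -> i = k) ->
  (\sum_(i < l) (g i \in r) <= size r)%N.
Proof.
move=> hg; rewrite -(big_mkord xpredT (fun i => (g i \in r) : nat)) -big_mkcond /=.
rewrite sum1_count -size_filter -(size_map g); apply: uniq_leq_size.
  rewrite map_inj_in_uniq ?filter_uniq ?iota_uniq // => i k.
  rewrite !mem_filter !mem_index_iota => /andP[_ /andP[_ a]] /andP[_ /andP[_ b]].
  exact: hg.
by move=> x /mapP[k]; rewrite mem_filter => /andP[hi _] ->.
Qed.

(* Vectors with at most d n nonzero coordinates are distorted little by the
   blocks of any type other than n: smaller types have small total weight, and
   larger types have weights at most 1 / d n. *)
Lemma other_types M n (b : nat -> R) (r : seq nat) j : ~~ M n -> (size r <= d n)%N ->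
  (forall k, k \notin r -> b k = 0) ->
  let e := fun i => (t i + m i)%N in
  let W := K * (1 + h n `^ th) in
  blocksum t e (abs_pow p (op M (inj b))) j <= W * blocksum t e (abs_pow p (inj b)) j /\
  blocksum t e (abs_pow p (inj b)) j <= W * blocksum t e (abs_pow p (op M (inj b))) j.
Proof.
move=> Mn hr hb e W; rewrite (bsum_injs F) (bsum_blockop_injs F p1 (sA M) K1 tl).
set a := fun c => b (t j + c)%N.
have W1 : 1 <= W.
  by rewrite /W -[leLHS]mulr1 ler_pM // lerDl powR_ge0.
rewrite /select; case: ifP => hM; last first.
  by rewrite seqsum_id; split; rewrite ler_peMl // seqsum_ge0.
have [hp hpi h3 _] := bdis (block_type j).
apply: (h3 a (fun c => (t j + c)%N \in r)); first by move=> i; exact: hb.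
case: (ltngtP (block_type j) n) => hj.
- apply: (le_trans _ (H_below hj)); apply: ler_sum => i _.
  have /andP[/ltW d0 _] := del01 (block_type j) i.
  by rewrite -[leRHS]mul1r ler_wpM2r // lern1; case: (_ \in _).
- apply: (le_trans _ (h1 n)).
  have dn : 0 < (d n)%:R :> R by rewrite ltr0n.
  apply: (@le_trans _ _ (\sum_(i < d (block_type j)) ((t j + bpos (block_type j) i)%N \in r)%:R * (d n)%:R^-1)).
    apply: ler_sum => i _; apply: ler_wpM2l => //.
    by rewrite -(ler_pM2l dn) mulfV ?gt_eqF // del_small.
  rewrite -mulr_suml ler_pdivrMr // mul1r -natr_sum ler_nat; apply: leq_trans hr.
  apply: (count_hits r (g := fun i => (t j + bpos (block_type j) i)%N)) => i k hi hk /addnI; exact: hpi.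
- by move: Mn; rewrite -hj hM.
Qed.

Lemma large_power (Z : R) : 0 <= Z -> exists N : nat, forall n, (N <= n)%N -> Z < n.+1%:R `^ th.
Proof.
move=> Z0; exists (Num.truncn (Z `^ th^-1)) => n hn.
have -> : Z = (Z `^ th^-1) `^ th by rewrite -powRrM mulVf ?gt_eqF // powRr1.
apply: gt0_ltr_powR; rewrite ?nnegrE ?powR_ge0 //.
have /andP[_ hlt] := truncn_itv (powR_ge0 Z th^-1).
by apply: (lt_le_trans hlt); rewrite ler_nat.
Qed.

(** With rho inverse to the permutation, no index of this block is sent below d n; so d n of its
    vectors land where Tsirelson's space looks like l_1 on d n coordinates. *)
Lemma far_block n (rho : nat -> nat) :
  exists2 j, block_type j = n & forall v, (v < d n)%N -> (rho v < t j)%N.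
Proof.
have [j hj ej] := logn2_infinite n (\sum_(v < d n) rho v).+1.
exists j => [|v hv]; first exact: ej.
have h2 := leq_trans hj (block_tid p1 K1 tl j). apply: leq_trans h2; rewrite ltnS.
by rewrite (bigD1 (Ordinal hv)) //= leq_addr.
Qed.

Lemma block_positions_uniq n j : uniq [seq (t j + bpos n l)%N | l <- iota 0 (d n)].
Proof.
have [_ hpi _ _] := bdis n.
rewrite map_inj_in_uniq ?iota_uniq // => i k; rewrite !mem_iota => /andP[_ hi] /andP[_ hk].
by move=> /addnI; exact: hpi.
Qed.

(** S and bs are the l_p-sums of the test vector before and after the block of type n acts; Tf, Tg
    and Tb are the norms, to the power p, of its image in the first basis, of its permuted image in
    the second, and of the permuted coefficients alone. In either direction of distortion the chain
    of comparisons closes, with 10 = 2 * 5. *)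
Lemma distortion_cancel (Hth S bs C W Tf Tg Tb : R) : 0 < S -> 0 <= Hth -> 0 <= C -> 0 <= W ->
  Hth * S <= K * bs \/ Hth * bs <= K * S ->
  bs <= 2 * Tf -> Tf <= bs -> Tb <= S -> S <= 2 * Tb ->
  Tg <= 5 * W * Tb -> Tb <= 5 * W * Tg -> Tg <= C * Tf -> Tf <= C * Tg ->
  Hth <= 10 * K * C * W.
Proof.
have K0 : 0 <= K := le_trans ler01 K1.
move=> S0 H0 C0 W0 hH a1 a2 a3 a4 a5 a6 a7 a8.
have W5 : 0 <= 5 * W by lra.
case: hH => hH.
  rewrite -(ler_pM2r S0); apply: (le_trans hH).
  have b1 : C * Tg <= C * (5 * W * S).
    by apply: ler_wpM2l => //; apply: (le_trans a5); exact: ler_wpM2l.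
  have b2 : bs <= 10 * C * W * S.
    apply: (le_trans a1); have := le_trans a8 b1.
    rewrite (_ : C * (5 * W * S) = 5 * C * W * S); last by ring.
    by rewrite (_ : 10 * C * W * S = 2 * (5 * C * W * S)); [lra|ring].
  have := ler_wpM2l K0 b2.
  by rewrite (_ : K * (10 * C * W * S) = 10 * K * C * W * S); [|ring].
have b1 : 5 * W * Tg <= 5 * W * (C * bs).
  by apply: ler_wpM2l => //; apply: (le_trans a7); exact: ler_wpM2l.
have b2 : S <= 10 * C * W * bs.
  apply: (le_trans a4); have := le_trans a6 b1.
  rewrite (_ : 5 * W * (C * bs) = 5 * C * W * bs); last by ring.
  by rewrite (_ : 10 * C * W * bs = 2 * (5 * C * W * bs)); [lra|ring].
have bs0 : 0 < bs.
  rewrite ltNge; apply/negP => bs0.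
  have : 10 * C * W * bs <= 0 by rewrite mulr_ge0_le0 // !mulr_ge0.
  by rewrite leNgt (lt_le_trans S0 b2).
rewrite -(ler_pM2r bs0); apply: (le_trans hH).
have := ler_wpM2l K0 b2.
by rewrite (_ : K * (10 * C * W * bs) = 10 * K * C * W * bs); [|ring].
Qed.

(** In the first basis f sees the full distortion of one block of type n. In the second basis no
    block of type n is modified, so wherever the permutation scatters the d n coefficients, the
    distortion is only of order h n^th. *)
Lemma test_vector M1 M2 n (pi rho : nat -> nat) : cancel pi rho -> cancel rho pi ->
  M1 n -> ~~ M2 n ->
  exists (r : seq nat) (c : nat -> fld),
  let f := \sum_(k <- r) c k *: modified_basis M1 k in
  let g := \sum_(k <- r) c k *: modified_basis M2 (pi k) in
  forall C, 0 <= C -> tsn g <= C * tsn f -> tsn f <= C * tsn g ->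
    H n `^ th <= 10 * K * C * (K * (1 + h n `^ th)).
Proof.
move=> piK rhoK M1n M2n; set W := K * _.
have [j ej hj] := far_block n rho.
have [hp hpi _ [alpha [al0 al1 al2]]] := bdis n.
have mj : m j = bm n by rewrite /block_size ej.
pose b k := if (t j <= k < t j + m j)%N then alpha (k - t j)%N else 0.
pose r := [seq (t j + bpos n l)%N | l <- iota 0 (d n)].
have rU : uniq r by exact: block_positions_uniq.
have b0 k : k \notin r -> b k = 0.
  rewrite /b; case: ifP => // /andP[hk _]; move=> hr; apply: al0 => i hi ek.
  by move/negP: hr; apply; apply/mapP; exists i; rewrite ?mem_iota // -ek subnKC.
have rt k : k \in r -> (t j <= k)%N by case/mapP => l _ ->; exact: leq_addr.
(* The coefficients of g with respect to the second basis in its own order. *)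
pose b2 v := b (rho v); pose r2 := map pi r.
have r2U : uniq r2 by rewrite map_inj_uniq //; exact: can_inj piK.
have b20 v : v \notin r2 -> b2 v = 0.
  move=> hv; apply: b0; apply: contra hv => hv.
  by apply/mapP; exists (rho v); rewrite ?rhoK.
have r2d v : v \in r2 -> (d n <= v)%N.
  case/mapP => k hk ->; rewrite leqNgt; apply/negP => /hj; rewrite piK.
  by rewrite ltnNge rt.
have sz2 : size r2 = d n by rewrite !size_map size_iota.
have bt c : (c < m j)%N -> b (t j + c)%N = alpha c.
  by move=> hc; rewrite /b leq_addr ltn_add2l hc /= addKn.
pose S := seqsum (bm n) p alpha.
have sumS : \sum_(k <- r) `|b k| `^ p = S.
  rewrite /S /seqsum (@sum_over_list R (fun c => `|alpha c| `^ p) [seq bpos n l | l <- iota 0 (d n)]).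
  - rewrite !big_map big_seq_cond [RHS]big_seq_cond; apply: eq_bigr => l.
    by rewrite mem_iota andbT => /andP[_ hl]; rewrite bt // mj; exact: hp.
  - rewrite map_inj_in_uniq ?iota_uniq // => i k; rewrite !mem_iota => /andP[_ hi] /andP[_ hk].
    exact: hpi.
  - move=> k hk; rewrite al0 ?normr0 ?powR0 ?gt_eqF ?(lt_trans ltr01) // => i hi ek.
    by move/negP: hk; apply; apply/mapP; exists i; rewrite ?mem_iota.
  - by move=> k /mapP[l]; rewrite mem_iota => /andP[_ hl] ->; exact: hp.
have sumS2 : \sum_(v <- r2) `|b2 v| `^ p = S.
  by rewrite big_map -sumS; apply: eq_bigr => k _; rewrite /b2 piK.
have [X1 T1 _] := T_list F p1 rU b0.
have [X2 T2 T2'] := T_list F p1 r2U b20.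
have {}T2' := T2' (d n) r2d; rewrite sz2 leqnSn sumS2 in T2'; have {}T2' := T2' isT.
rewrite sumS2 in T2.
exists r, (inj b) => f g C C0 hgf hfg.
have ef : f = op M1 (inj b).
  rewrite /f bv_sum //; congr (blockop _ _ _ _ _); apply: funext => k; rewrite /keepK.
  by case: (boolP (k \in r)) => // hk; rewrite /injs b0 // sc_inj0.
have eg : g = op M2 (inj b2).
  have -> : g = \sum_(v <- r2) inj b2 v *: modified_basis M2 v.
    by rewrite /g [RHS]big_map; apply: eq_bigr => k _; rewrite /injs /b2 piK.
  rewrite bv_sum //; congr (blockop _ _ _ _ _); apply: funext => k; rewrite /keepK.
  by case: (boolP (k \in r2)) => // hk; rewrite /injs b20 // sc_inj0.
have boff k : ~~ (t j <= k < t j + m j)%N -> b k = 0 by rewrite /b => /negbTE ->.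
have [Xf Tf1 Tf2] := T_single_block F p1 (sA M1) K1 (start_size bm) tl boff.
have eb : blocksum t (fun i => (t i + m i)%N) (abs_pow p (op M1 (inj b))) j =
    seqsum (bm n) p (mxapp (bm n) (bA n) alpha).
  rewrite (bsum_blockop_injs F p1 (sA M1) K1 tl) /select ej M1n mj.
  apply: seqsum_eq => i _; apply: mxapp_ext => c hc; apply: bt; by rewrite mj.
rewrite eb in Tf1 Tf2.
have W1 : 1 <= W by rewrite /W -[leLHS]mulr1 ler_pM // lerDl powR_ge0.
have hd i := other_types (b := b2) (r := r2) i M2n (eq_leq sz2) b20.
have [D1 D2] := blockop_distortion (start_size bm) W1 hd.
have Xg : X (op M2 (inj b2)).
  rewrite -eg; apply: (proj1 (linear_on_sum (T := id) _ _ _ _ _ _)).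
  - exact: X_0.
  - by move=> c u v; exact: X_linear.
  - by [].
  - by move=> k; exact: (X_bv F p1 K1 (start_size bm) tl (select_system M2)).
rewrite -ef in Tf1 Tf2; rewrite -eg in D1 D2 Xg.
apply: (distortion_cancel _ _ C0 _ al2 Tf2 Tf1 T2 T2' (D1 X2) (D2 Xg) hgf hfg).
- exact: al1.
- exact: powR_ge0.
- exact: le_trans W1.
Qed.

Lemma nrm_ratio (C : R) (f g : V) : 0 <= C -> X f -> X g -> nrm g <= C * nrm f ->
  tsn g <= C `^ p * tsn f.
Proof.
move=> C0 Xf Xg hfg; rewrite -(nrm_pow p1 Xf) -(nrm_pow p1 Xg) -powRM ?nrm_ge0 //.
by apply: ge0_ler_powR; rewrite ?nnegrE ?nrm_ge0 ?mulr_ge0 ?nrm_ge0 // ltW // (lt_trans ltr01).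
Qed.

Lemma not_perm_equivalent M1 M2 :
  (forall N : nat, exists n, [/\ (N <= n)%N, M1 n & ~~ M2 n]) ->
  ~ permutatively_equivalent X nrm (modified_basis M1) (modified_basis M2).
Proof.
move=> hM [pi [rho piK rhoK] [T [Tlin _ [M0 hM0] Tpi]]].
have cs f : X f -> closed_span X nrm (modified_basis M1) f.
  exact: (bv_closed_span p1 K1 tl (select_system M1)).
have XM M i : X (modified_basis M i) := X_bv F p1 K1 (start_size bm) tl (select_system M) i.
(* The equivalence constant, made nonnegative and raised to the power p to match p-th powers of
   norms. *)
pose C := (`|M0| + 1) `^ p.
have C0 : 0 <= C by exact: powR_ge0.
(* Since h n >= 1, the bound 10 K C K (1 + h n^th) is at most 20 K^2 C h n^th, while H n^th >=
   (n+1)^th h n^th; so n is chosen with (n+1)^th above 20 K^2 C. *)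
have [N hN] := @large_power (20 * K ^+ 2 * C) (mulr_ge0 (mulr_ge0 (ler0n _ _) (sqr_ge0 _)) C0).
have [n [hn M1n M2n]] := hM N.
have [r [c hfg]] := test_vector piK rhoK M1n M2n.
have X0 : X 0 := X_0 F p1.
have Xl (a : fld) (u v : V) : X u -> X v -> X (a *: u + v) := @X_linear R F p p1 a u v.
have [Xf Tf] := linear_on_sum X0 Xl (fun a u v hu hv => Tlin a u v (cs u hu) (cs v hv)) r c (XM M1).
have [Xg _] := @linear_on_sum _ V V X id X0 Xl (fun a u v _ _ => erefl) _ r c
  (modified_basis M2 \o pi) (fun k => XM M2 (pi k)).
have {Tf} : T (\sum_(k <- r) c k *: modified_basis M1 k) =
    \sum_(k <- r) c k *: modified_basis M2 (pi k).
  by rewrite Tf; apply: eq_bigr => k _; rewrite Tpi.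
move: hfg Xf Xg; rewrite /=; set g := \sum_(k <- r) _; set f := \sum_(k <- r) _ => hfg Xf Xg Tf.
have [le1 le2] := hM0 f (cs f Xf); rewrite Tf in le1 le2.
have M01 : M0 <= `|M0| + 1 by rewrite (le_trans (ler_norm M0)) // lerDl.
have C1 : 0 <= `|M0| + 1 by rewrite addr_ge0.
have b1 : tsn g <= C * tsn f.
  exact: (nrm_ratio C1 Xf Xg (le_trans le1 (ler_wpM2r (nrm_ge0 p f) M01))).
have b2 : tsn f <= C * tsn g.
  exact: (nrm_ratio C1 Xg Xf (le_trans le2 (ler_wpM2r (nrm_ge0 p g) M01))).
have := hfg C C0 b1 b2; apply/negP; rewrite -ltNge.
have n0 : 0 <= n.+1%:R :> R by [].
have hn0 : 0 <= h n by exact: le_trans (h1 n).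
have hp0 : 1 <= h n `^ th.
  have -> : 1 = 1 `^ th :> R by rewrite powR1.
  by apply: ge0_ler_powR; rewrite ?nnegrE ?(ltW th0).
have Hp : n.+1%:R `^ th * h n `^ th <= H n `^ th.
  rewrite -powRM //; apply: ge0_ler_powR; rewrite ?nnegrE ?(ltW th0) ?mulr_ge0 //.
  exact: (le_trans (mulr_ge0 n0 hn0) (H_large n)).
apply: lt_le_trans Hp; have hlt := hN _ hn.
have hpp : 0 < h n `^ th by exact: lt_le_trans hp0.
apply: (@le_lt_trans _ _ (20 * K ^+ 2 * C * h n `^ th)); last by rewrite ltr_pM2r.
have KC : 0 <= K ^+ 2 * C by rewrite mulr_ge0 // sqr_ge0.
have := ler_wpM2l KC hp0; rewrite mulr1 => hle.
rewrite (_ : 10 * K * C * _ = 10 * (K ^+ 2 * C) + 10 * (K ^+ 2 * C * h n `^ th)); last by ring.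
rewrite (_ : 20 * K ^+ 2 * C * _ = 20 * (K ^+ 2 * C * h n `^ th)); last by ring.
rewrite -lerBrDr -mulrBl (_ : 20 - 10 = 10 :> R); last by ring.
exact: ler_wpM2l.
Qed.

End Family.

Lemma perm_equivalent_refl (R : realType) (K : numFieldType) (V : lmodType K) (X : set V)
  (nrm : V -> R) (x : nat -> V) : permutatively_equivalent X nrm x x.
Proof.
exists id; first by exists id.
exists id; split => //; first by split => //; move=> f hf; exists f.
by exists 1 => f _; rewrite mul1r.
Qed.

Local Open Scope card_scope.
Local Open Scope ring_scope.

Theorem theorem4p11 (R : realType) (F : scalars) (p : R)
    (hp1 : 1 < p) (hp2 : p != 2) :
  let X := @tsirelson_conv R F p in
  let nrm := @tsirelson_conv_norm R F p in
  let abs := @modulus R F in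
  exists (B : set (nat -> scalar_seq R F)) (G c C : R),
    [/\ B #= [set: R],
        forall x, B x ->
          greedy_basis abs X nrm x /\ greedy_constant abs X nrm x <= G,
        forall x y, B x -> B y -> x <> y ->
          ~ permutatively_equivalent X nrm x y,
        0 < c &
        forall x m, B x -> (0 < m)%N ->
          c * m%:R `^ p^-1 <= fundamental_function nrm x m
          /\ fundamental_function nrm x m <= C * m%:R `^ p^-1].
Proof.
move=> X nrm abs.
have [K [th [K1 th0 hsys]]] := block_systems_exist hp1 hp2.
have [d [del [h hw]]] := weight_sequences R.
have {hsys} hb n : exists mABpos : nat * (nat -> nat -> R) * (nat -> nat -> R) * (nat -> nat),
    let: (m, A, B, pos) := mABpos in
    block_system p K m A B /\ distorted p K th (del n) (d n) pos m A.
  have [w1 w2 _ _ _] := hw n; have [m [A [B [pos h1]]]] := hsys (del n) (d n) w1 w2.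
  by exists (m, A, B, pos).
have [blk blkP] := choice hb.
pose bm n := (blk n).1.1.1; pose bA n := (blk n).1.1.2.
pose bB n := (blk n).1.2; pose bpos n := (blk n).2.
have bsys n : block_system p K (bm n) (bA n) (bB n).
  by have := blkP n; rewrite /bm /bA /bB; case: (blk n) => [[[? ?] ?] ?] [].
have bdis n : distorted p K th (del n) (d n) (bpos n) (bm n) (bA n).
  by have := blkP n; rewrite /bm /bA /bpos; case: (blk n) => [[[? ?] ?] ?] [].
have [M MP] := almost_disjoint_family R.
pose x r := modified_basis F hp1 K1 bm bA (M r).
have ne r s : r <> s -> ~ permutatively_equivalent X nrm (x r) (x s).
  by move=> rs; apply: (@not_perm_equivalent R F p K th hp1 K1 th0 d del h _ _ _ _ _ _
    bm bA bB bpos bsys bdis _ _ (MP r s rs)) => n; case: (hw n) => ? ? ? ? [].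
(* Equal bases are permutatively equivalent, so non-equivalence already makes the parametrization by
   reals injective, which gives the cardinality. *)
have xinj : injective x.
  by move=> u v huv; apply: contrapT => /ne; rewrite huv; apply; exact: perm_equivalent_refl.
exists (range x), (1 + greedy_const p K `^ p^-1),
  ((20 * CK p K)^-1 `^ p^-1), ((5 * CK p K) `^ p^-1).
have sys r := select_system hp1 K1 bsys (M r).
split.
- by apply: inj_card_eq => r s _ _; exact: xinj.
- by move=> _ [r _ <-]; exact: (bv_greedy F hp1 K1 (start_size bm) (start_lacunary bm) (sys r)).
- by move=> _ _ [r _ <-] [s _ <-] rs; apply: ne => e; apply: rs; rewrite e.
- by have c1 := CK_ge1 hp1 K1; rewrite powR_gt0 // invr_gt0 mulr_gt0 // (lt_le_trans ltr01).
- move=> _ n [r _ <-] n0.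
  exact: (bv_fundamental F hp1 K1 (start_size bm) (start_lacunary bm) (sys r) n0).
Qed.
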